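(* Let $\beta>0$ and let $\phi$ be the unique minimizer of $\mathcal{F}_\beta(\phi)=\frac12\|\nabla\phi\|_2^2+\beta\|\phi\|_1$ over $H^1(\mathbb{R}^3)\cap L^1(\mathbb{R}^3)$ under the constraint $\|\phi\|_2=1$ that is spherically symmetrically decreasingly rearranged, i.e. $\phi=\phi^*$. Then there exist parameters $\mu,R\in(0,\infty)$ such that $\phi$ is a solution to the Helmholtz equation on $B_R(0)$ with Neumann (and Dirichlet) boundary conditions: $$(\Delta+\mu^2)\phi(x)=\beta \ \text{ for } |x|<R,\qquad \phi(x)=0\ \text{ for } |x|\ge R,\qquad \partial_{\vec n}\phi(x)=0\ \text{ for } x\in\partial B_R(0).$$
   Context: $\|\cdot\|_p$ denotes the $L^p(\mathbb{R}^3)$ norm, $H^1(\mathbb{R}^3)=W^{1,2}(\mathbb{R}^3)$, $B_R(0)$ is the open ball of radius $R$ about the origin in $\mathbb{R}^3$, and $\partial_{\vec n}$ is the normal derivative on its boundary. Functions are real-valued. $\phi^*$ denotes the spherically symmetric decreasing rearrangement of $|\phi|$. The paper establishes separately that a minimizer of $\mathcal{F}_\beta$ under the constraint $\|\phi\|_2=1$ exists and that its spherically symmetric decreasing rearrangement is unique; ''the unique minimizer with $\phi=\phi^*$'' refers to this function. *)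

(* Defs.v *)
(* Written in MathComp-Analysis; R^3 is R * R * R with its product Borel
   sigma-algebra. *)
From HB Require Import structures.
From mathcomp Require Export all_boot all_order all_algebra.
From mathcomp Require Export all_classical all_reals all_analysis.

Set Implicit Arguments.
Unset Strict Implicit.
Unset Printing Implicit Defensive.

Export Order.TTheory GRing.Theory Num.Theory.
Export numFieldNormedType.Exports.

Local Open Scope classical_set_scope.
Local Open Scope ring_scope.

Section Euclidean_space.
Context {R : realType}.
Implicit Types (u v f : R * R * R -> R) (x : R * R * R).

Definition vol :=
  ((@lebesgue_measure R \x @lebesgue_measure R) \x @lebesgue_measure R)%E.

(* The library norm on R * R * R is the sup norm, hence this definition; the
   two norms induce the same topology. *)
Definition enorm x : R :=
  Num.sqrt (x.1.1 ^+ 2 + x.1.2 ^+ 2 + x.2 ^+ 2).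

Definition eball (r : R) : set (R * R * R) := [set x | enorm x < r].

Definition basis (i : 'I_3) : R * R * R :=
  ((i == 0%N :> nat)%:R, (i == 1%N :> nat)%:R, (i == 2%N :> nat)%:R).

Definition partial (i : 'I_3) f : R * R * R -> R :=
  fun x => 'D_(basis i) f x.

Definition laplacian f : R * R * R -> R :=
  fun x => \sum_(i < 3) partial i (partial i f) x.

(* f is of class C^k on A. This is meant for open A, where the partial
   derivatives at points of A only depend on the restriction of f to A. *)
Fixpoint Ck (k : nat) (A : set (R * R * R)) f : Prop :=
  (forall x, A x -> {for x, continuous f}) /\
  if k is k'.+1 then
    forall i, (forall x, A x -> derivable f x (basis i)) /\
              Ck k' A (partial i f)
  else True.

Definition test_function f : Prop :=
  (forall k, Ck k setT f) /\ compact (closure [set x | f x != 0]).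

Definition weak_gradient u (G : 'I_3 -> R * R * R -> R) : Prop :=
  forall f, test_function f -> forall i,
    \int[vol]_x (u x * partial i f x) = - \int[vol]_x (G i x * f x).

(* u is in H^1 with weak gradient G. Since G is unique up to null sets, the
   quantities below, which take a function together with its gradient, only
   depend on the function. *)
Definition H1 u (G : 'I_3 -> R * R * R -> R) : Prop :=
  [/\ u \in Lfun vol 2%:E, forall i, G i \in Lfun vol 2%:E
    & weak_gradient u G].

Definition grad_norm (G : 'I_3 -> R * R * R -> R) x : R :=
  Num.sqrt (\sum_(i < 3) G i x ^+ 2).

Definition energy (beta : R) u (G : 'I_3 -> R * R * R -> R) : \bar R :=
  ((2^-1)%:E * 'N[vol]_2%:E[EFin \o grad_norm G] ^+ 2
   + beta%:E * 'N[vol]_1%:E[EFin \o u])%E.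

Definition admissible u (G : 'I_3 -> R * R * R -> R) : Prop :=
  [/\ H1 u G, u \in Lfun vol 1%:E & ('N[vol]_2%:E[EFin \o u] = 1)%E].

Definition is_minimizer (beta : R) u : Prop :=
  exists2 G, admissible u G &
    forall v H, admissible v H -> (energy beta u G <= energy beta v H)%E.

(* The open ball about the origin with the same volume as A (everything if A
   has infinite volume): |x| is less than its radius iff the ball of radius
   |x| has smaller volume than A. *)
Definition symm_set (A : set (R * R * R)) : set (R * R * R) :=
  [set x | (vol (eball (enorm x)) < vol A)%E].

(* Layer-cake formula. Rintegral maps +oo to 0, so wherever the rearrangement
   is infinite the value here is 0; for u in L^1 or L^2 this can only concern
   the origin, a null set. *)
Definition symm_rearr u : R * R * R -> R :=
  fun x => \int[@lebesgue_measure R]_(t in `]0, +oo[)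
             \1_(symm_set [set y | t < `|u y|]) x.

(* Classical solution of the overdetermined problem. The normal derivative is
   two-sided; as u vanishes outside the ball, this is equivalent to the
   one-sided derivative from inside the ball being 0. *)
Definition helmholtz_solution (beta mu rad : R) u : Prop :=
  [/\ Ck 2 (eball rad) u /\ continuous u,
      forall x, enorm x < rad -> laplacian u x + mu ^+ 2 * u x = beta,
      forall x, rad <= enorm x -> u x = 0
    & forall x, enorm x = rad -> is_derive x (rad^-1 *: x) u 0].

End Euclidean_space.

(* Main.v *)
From HB Require Import structures.
Require Import Defs.
From mathcomp Require Import measurable_realfun ring lra.

(** Write [phi x = g (enorm x)], where the profile [g] is nonnegative and, on
the positive axis, nonincreasing. At the outset [phi] is only a function with
a weak gradient, so every derivative is moved onto test functions until the
profile is known to be differentiable.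

First variation. Comparing [phi] with the normalized functions
[phi + e * psi] shows that [Delta phi + lam phi = beta] holds weakly where
[phi > 0], the multiplier [lam] being [||grad phi||^2 + beta ||phi||_1]. The
absolute value in the [L^1] norm has a kink at 0, which leaves an inequality
carried by the zero set: this is [euler_lagrange].

Radial testing. Take for [psi] a smoothed Newtonian potential, with radial
derivative [- Q r / r ^+ 2], where [Q] climbs from 0 to 1 just after radius
[a] and comes down to 0 just before radius [b]. Its Laplacian lives on the two
thin shells, and each of them carries total mass [3 * ball_vol], the area of
the unit sphere. As [g] is monotone, [flux_inequality] follows; in the limit
of thin shells it reads
[3 c (g b - g a) = (1/a - 1/b) flux a] up to an error quadratic in [b - a],
where [flux r] is the integral of [beta - lam phi] over the ball of radius
[r]. This is the integrated form of the divergence theorem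
[3 c r^2 g' = flux r], and it makes [g] differentiable as long as it is
positive ([profile_derivable]).

Free boundary. Since [g] decreases, [flux r] is nonpositive as long as [g]
stays positive; but [flux r >= beta c r^3 - lam ||phi||_1], so [g] vanishes
from some finite radius [rho] on. The increment of [g] across [rho] shows that
[g] is continuous there, and its increment beyond [rho] that
[flux rho = 0]. The error being quadratic, [g t] is at most
[C (t - rho)^2] near [rho] ([profile_flat]): the Dirichlet and the Neumann
condition hold together.

Explicit solution. On the ball [w = r (g - beta / lam)] solves
[w'' = - lam w], hence is a combination of [sin (mu r)] and [cos (mu r)] with
[mu ^+ 2 = lam]; the cosine is excluded because the mass of small balls is
[O(r)] ([b1_eq0]). Therefore [phi] is [beta / lam] plus a multiple of
[sin (mu |x|) / |x|], which is an entire function of [|x|^2]; smoothness and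
the equation at the origin follow. The value of [phi] at the origin itself is
read off from the layer-cake formula ([phi0E]). *)

Set Implicit Arguments.
Unset Strict Implicit.
Unset Printing Implicit Defensive.

Local Open Scope classical_set_scope.
Local Open Scope ring_scope.

(** * Lebesgue measure in space *)

Section Space.
Context {R : realType}.
Local Notation M1 := (measurableTypeR R).
Local Notation M2 := (measurableTypeR R * measurableTypeR R)%type.
Local Notation M3 := (measurableTypeR R * measurableTypeR R * measurableTypeR R)%type.

Definition leb : {sigma_finite_measure set M1 -> \bar R} :=
  @lebesgue_measure R.

Definition seg (K : R) : set M1 := `[- K, K]%classic.

Lemma measurable_seg K : measurable (seg K).
Proof. exact: measurable_itv. Qed.

Lemma leb_seg K : 0 <= K -> leb (seg K) = (2 * K)%:E.
Proof.
move=> K0; rewrite /leb /seg /= lebesgue_measure_itv/= lte_fin.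
case: ltP => [|h]; first by move=> _; rewrite -EFinB; congr EFin; ring.
have -> : K = 0 by apply/eqP; rewrite eq_le K0 andbT; lra.
by rewrite mulr0.
Qed.

Definition square (K : R) : set M2 :=
  seg K `*` seg K.

Lemma measurable_square K : measurable (square K).
Proof. by apply: measurableX; exact: measurable_seg. Qed.

Lemma leb2_square K : 0 <= K -> (leb \x leb)%E (square K) = ((2 * K) ^+ 2)%:E.
Proof.
move=> K0; rewrite product_measure1E; [|exact: measurable_seg..].
by rewrite expr2 EFinM; congr (_ * _)%E; exact: leb_seg.
Qed.

Lemma leb2_sigma_finite : sigma_finite setT (leb \x leb)%E.
Proof.
exists (fun n => square n%:R).
  apply/seteqP; split => // -[x y] _.
  near \oo => n; exists n => //=.
  have xn : `|x| + `|y| <= n%:R by near: n; exact: nbhs_infty_ger.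
  by split; rewrite /seg /= in_itv/= -ler_norml (le_trans _ xn)//
    (lerDl, lerDr).
move=> n; split; first exact: measurable_square.
exact: (eq_ind_r (fun u : \bar R => (u < +oo)%E) (ltry _) (leb2_square (ler0n _ _))).
Unshelve. all: by end_near. Qed.

Definition leb2 : {sigma_finite_measure set M2 -> \bar R} :=
  HB.pack (leb \x leb)%E
    (Measure_isSigmaFinite.Build _ _ _ (leb \x leb)%E leb2_sigma_finite).

(** Convertible to [vol]; Fubini's theorem asks for the inner product to be
bundled as a sigma-finite measure, which [leb2] does. *)
Definition vol3 : {measure set M3 -> \bar R} :=
  (leb2 \x leb)%E.

(** [q = (n, i, j, k)] codes a cube of side [1 / (n + 1)] of the grid of that
step. *)
Definition cell (q : nat * int * int * int) : set M3 :=
  let a (k : int) := k%:~R / q.1.1.1.+1%:R : R in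
  `[a q.1.1.2, a (q.1.1.2 + 1)[%classic `*` `[a q.1.2, a (q.1.2 + 1)[%classic
    `*` `[a q.2, a (q.2 + 1)[%classic.

Lemma measurable_cell q : measurable (cell q).
Proof. by apply: measurableX; [apply: measurableX|]; exact: measurable_itv. Qed.

(** There are countably many grid cells, and every point of an open set lies in
one that is contained in the set as soon as the step is small. *)
Lemma open_measurable3 (U : set (R * R * R)) : open U -> measurable (U : set M3).
Proof.
move=> oU.
have -> : U = \bigcup_q (if `[< cell q `<=` U >] then cell q else set0).
  apply/seteqP; split => [[[x y] z] Uxyz|p [q _]]; last first.
    by case: asboolP => // /[apply].
  have /nbhs_ballP[e /= e0 eU] : nbhs (x, y, z) U by apply: open_nbhs_nbhs.
  near \oo => n.
  have ne : n.+1%:R^-1 < e by near: n; exact: near_infty_natSinv_lt (PosNum e0).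
  pose k (t : R) : int := Num.floor (t * n.+1%:R).
  have n0 : 0 < n.+1%:R :> R by rewrite ltr0n.
  have kP t : (k t)%:~R / n.+1%:R <= t < (k t + 1)%:~R / n.+1%:R.
    by rewrite ler_pdivrMr// ltr_pdivlMr// floor_itv.
  have kP' t s : (k t)%:~R / n.+1%:R <= s < (k t + 1)%:~R / n.+1%:R -> `|t - s| < e.
    move=> h; have := kP t; move: h; rewrite intrD mulrDl mul1r => h h'.
    move: ne h h'; move: (_ / _) => u; move: (_^-1) => v ve /andP[? ?] /andP[? ?].
    by rewrite ltr_norml; apply/andP; split; lra.
  have xyzc : cell (n, k x, k y, k z) (x, y, z).
    by split; [split|]; rewrite /= in_itv /=; exact: kP.
  exists (n, k x, k y, k z) => //.
  case: asboolP => // -[] -[[x' y'] z'] [[/= xx yy] zz]; apply: eU.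
  by split; [split|]; rewrite /ball /=; apply: kP'; move: xx yy zz; rewrite !in_itv.
apply: countable_bigcupT_measurable; first exact: countableP.
by move=> q; case: ifP => // _; exact: measurable_cell.
Unshelve. all: by end_near. Qed.

Lemma continuous_measurable3 (f : R * R * R -> R) :
  continuous f -> measurable_fun (setT : set M3) f.
Proof.
move=> /continuousP cf; apply: (measurability _ (measurable_realfun.RGenOpens.measurableE R)).
move=> _ [_ [a [b ->] <-]]; rewrite setTI; apply: open_measurable3.
exact/cf/interval_open.
Qed.

End Space.

(** * Functions supported in a cube *)

Section Cube.
Context {R : realType}.
Local Notation M1 := (measurableTypeR R).
Local Notation M2 := (measurableTypeR R * measurableTypeR R)%type.
Local Notation M3 := (measurableTypeR R * measurableTypeR R * measurableTypeR R)%type.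
Local Notation leb := (@leb R).
Local Notation leb2 := (@leb2 R).
Local Notation vol3 := (@vol3 R).
Implicit Types f : R * R * R -> R.

Definition cube (K : R) : set M3 := square K `*` seg K.

Lemma measurable_cube K : measurable (cube K).
Proof. by apply: measurableX; [exact: measurable_square|exact: measurable_seg]. Qed.

Lemma vol3X (A B C : set M1) : measurable A -> measurable B -> measurable C ->
  vol3 (A `*` B `*` C) = (leb A * leb B * leb C)%E.
Proof.
move=> mA mB mC.
transitivity (leb2 (A `*` B) * leb C)%E.
  exact: (product_measure1E leb2 leb (measurableX mA mB) mC).
by congr (_ * _)%E; exact: (product_measure1E leb leb mA mB).
Qed.

Lemma vol3_cube K : 0 <= K -> vol3 (cube K) = ((2 * K) ^+ 3)%:E.
Proof.
move=> K0; rewrite vol3X; try exact: measurable_seg.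
have E : leb (seg K) = (2 * K)%:E by exact: leb_seg.
by rewrite E -!EFinM; congr EFin; ring.
Qed.

Definition supported (K : R) f := forall x, ~ cube K x -> f x = 0.

Lemma cubeP K (x y z : R) :
  cube K (x, y, z) <-> [/\ `|x| <= K, `|y| <= K & `|z| <= K].
Proof.
rewrite /cube /square /seg; split => [[[/= + +] +]|[hx hy hz]].
  by rewrite !in_itv/= -!ler_norml.
by split; [split|]; rewrite /= in_itv /= -ler_norml.
Qed.

Lemma cube_compact K : compact (cube K : set (R * R * R)).
Proof.
by apply: compact_setX; [apply: compact_setX|]; exact: segment_compact.
Qed.

Lemma continuous_cube_bounded K f : continuous f ->
  exists2 C, 0 <= C & forall x, cube K x -> `|f x| <= C.
Proof.
move=> cf.
have : compact (f @` (cube K : set (R * R * R))).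
  by apply: continuous_compact; [exact: continuous_subspaceT|exact: cube_compact].
move=> /compact_bounded[C [_ CP]].
exists (`|C| + 1); first by rewrite addr_ge0.
move=> x Kx; apply: CP; last by exists x.
by rewrite (le_lt_trans (ler_norm C))// ltrDl.
Qed.

Lemma supported_bounded K f : continuous f -> supported K f ->
  exists2 C, 0 <= C & forall x, `|f x| <= C.
Proof.
move=> cf sf; have [C C0 CP] := continuous_cube_bounded K cf.
exists C => // x; have [/CP//|/sf ->] := pselect (cube K x).
by rewrite normr0.
Qed.

Lemma bounded_supp_integrable d (T : measurableType d)
    (m : {measure set T -> \bar R}) (A : set T) (C : R) (f : T -> R) :
  measurable A -> (m A < +oo)%E -> measurable_fun setT f ->
  (forall x, `|f x| <= C) -> (forall x, ~ A x -> f x = 0) ->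
  m.-integrable setT (EFin \o f).
Proof.
move=> mA mAoo mf fC fA.
have -> : EFin \o f = (EFin \o f) \_ A.
  apply/funext => x /=; rewrite patchE; case: ifPn => // /negP xA.
  by rewrite /= fA// => Ax; apply: xA; rewrite inE.
apply/(integrable_mkcond (EFin \o f)) => //.
apply: measurable_bounded_integrable => //; first exact: measurable_funS mf.
by exists C; split; [exact: num_real|move=> M /ltW CM x _; exact: le_trans CM].
Qed.

Lemma supported_integrable K f : continuous f -> supported K f ->
  vol3.-integrable setT (EFin \o f).
Proof.
move=> cf sf; have [C C0 CP] := supported_bounded cf sf.
have [K0|K0] := leP 0 K.
  apply: (@bounded_supp_integrable _ _ _ (cube K) C) => //.
  - exact: measurable_cube.
  - by rewrite vol3_cube// ltry.
  - exact: continuous_measurable3.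
rewrite (_ : EFin \o f = cst 0%E); first exact: integrable0.
apply/funext => -[[x y] z] /=; rewrite sf// => /cubeP[xK _ _].
by have := le_trans (normr_ge0 x) xK; rewrite leNgt K0.
Qed.

(** Both derivatives are limits of the same difference quotient. *)
Lemma derive_slice (f : R * R * R -> R) (g : R -> R) (p v : R * R * R) (t : R) :
  (forall h, f (h *: v + p) = g (h + t)) -> derivable f p v ->
  is_derive t 1 g ('D_v f p).
Proof.
move=> fg.
have E : (fun h : R => h^-1 *: ((f \o shift p) (h *: v) - f p)) =
         (fun h : R => h^-1 *: ((g \o shift t) (h *: 1) - g t)).
  apply/funext => h /=; rewrite fg -[f p]/(f p) -[p in f p]add0r -(scale0r v) fg.
  by rewrite add0r [h *: 1]mulr1.
rewrite /derivable /derive E => d; split; first exact: d.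
by rewrite /derive.
Qed.

Lemma is_derive_slice0 f (x y z : R) : derivable f (x, y, z) (basis (inord 0)) ->
  is_derive x 1 (fun t => f (t, y, z)) (partial (inord 0) f (x, y, z)).
Proof.
apply: derive_slice => h; rewrite /basis !inordK//=.
by congr f; congr (_, _, _); rewrite /= ?[h *: _]mulr1 ?[h *: _]mulr0 ?add0r.
Qed.

Lemma is_derive_slice1 f (x y z : R) : derivable f (x, y, z) (basis (inord 1)) ->
  is_derive y 1 (fun t => f (x, t, z)) (partial (inord 1) f (x, y, z)).
Proof.
apply: derive_slice => h; rewrite /basis !inordK//=.
by congr f; congr (_, _, _); rewrite /= ?[h *: _]mulr1 ?[h *: _]mulr0 ?add0r.
Qed.

Lemma is_derive_slice2 f (x y z : R) : derivable f (x, y, z) (basis (inord 2)) ->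
  is_derive z 1 (fun t => f (x, y, t)) (partial (inord 2) f (x, y, z)).
Proof.
apply: derive_slice => h; rewrite /basis !inordK//=.
by congr f; congr (_, _, _); rewrite /= ?[h *: _]mulr1 ?[h *: _]mulr0 ?add0r.
Qed.

Lemma ord3P (P : 'I_3 -> Prop) :
  P (inord 0) -> P (inord 1) -> P (inord 2) -> forall i, P i.
Proof.
move=> P0 P1 P2 i.
have : i = inord (val i) by apply/val_inj; rewrite /= inordK.
by case: i => -[|[|[|]]]//= ? ->.
Qed.

Lemma supported_near0 K f (x : R * R * R) : supported K f -> ~ cube K x ->
  \forall y \near x, f y = 0.
Proof.
move=> sf xK; apply: (@filterS _ _ _ (~` (cube K : set (R * R * R)))) => //.
apply: open_nbhs_nbhs; split => //.
apply: closed_openC; apply: compact_closed; last exact: cube_compact.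
exact: norm_hausdorff.
Qed.

Lemma supported_partial K f i : supported K f -> supported K (partial i f).
Proof.
move=> sf x xK; rewrite /partial (@near_eq_derive _ _ _ f (cst 0)).
  exact: derive_cst.
exact: supported_near0 xK.
Qed.

Lemma integral_derive_supp (F F' : R -> R) (K : R) :
  (forall t : R, is_derive t 1 F (F' t)) -> continuous F' ->
  (forall t : R, K < `|t| -> F t = 0) -> (forall t : R, K < `|t| -> F' t = 0) ->
  (\int[leb]_t (F' t)%:E)%E = 0%E.
Proof.
move=> dF cF' F0 F'0.
pose L : R := `|K| + 1.
have KL : K < L by rewrite /L (le_lt_trans (ler_norm K))// ltrDl.
have L0 : 0 < L by rewrite /L ltr_wpDl.
have -> : (\int[leb]_t (F' t)%:E = \int[lebesgue_measure]_(t in `[(- L)%R, L%R]) (F' t)%:E)%E.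
  rewrite [RHS]integral_mkcond; apply: eq_integral => t _.
  rewrite patchE; case: ifPn => // /negP tL; rewrite F'0// ltNge; apply/negP => tK.
  by apply: tL; rewrite inE/= in_itv/= -ler_norml (le_trans tK)// ltW.
rewrite (@continuous_FTC2 _ F' F).
- rewrite !F0 ?subee//; first by rewrite normrN gtr0_norm.
  by rewrite gtr0_norm.
- by rewrite ltrNl (lt_trans _ L0)// oppr_lt0.
- exact: continuous_subspaceT.
- have cF : continuous F.
    by move=> t; apply/differentiable_continuous/derivable1_diffP; case: (dF t).
  split; first by move=> t _; case: (dF t).
  + by apply: cvg_at_right_filter; exact: cF.
  + by apply: cvg_at_left_filter; exact: cF.
- by move=> t _; rewrite derive1E; apply: derive_val.
Qed.

Lemma pair_continuous (T U V : topologicalType) (f : T -> U) (g : T -> V) :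
  continuous f -> continuous g -> continuous (fun x => (f x, g x)).
Proof.
move=> cf cg x.
by apply: (@cvg_pair _ _ _ _ (nbhs (f x)) (nbhs (g x)) _ _ _ f g);
  [exact: cf|exact: cg].
Qed.

Lemma slice_integrable f K z : continuous f -> supported K f ->
  (leb \x leb)%E.-integrable (setT : set M2) (fun p => (f (p, z))%:E).
Proof.
move=> cf sf; have [C C0 CP] := supported_bounded cf sf.
apply: (@bounded_supp_integrable _ _ _ (square `|K|) C (fun p => f (p, z))) => //.
- exact: measurable_square.
- exact: (eq_ind_r (fun u : \bar R => (u < +oo)%E) (ltry _) (leb2_square (normr_ge0 K))).
- apply: (@measurableT_comp _ _ _ _ _ _ (f : M3 -> M1)).
    exact: continuous_measurable3.
  exact: measurable_fun_pair.
- move=> -[x y] pK; apply: sf => /cubeP[xK yK _]; apply: pK.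
  by split; rewrite /seg/= in_itv/= -ler_norml (le_trans _ (ler_norm K)).
Qed.

(** Fubini reduces the integral to the lines parallel to the i-th axis, on
which it vanishes by the fundamental theorem of calculus. *)
Lemma integral_partial0 f K i : supported K f ->
  (forall x, derivable f x (basis i)) -> continuous (partial i f) ->
  (\int[vol3]_x (partial i f x)%:E)%E = 0%E.
Proof.
move=> sf; move: i.
have far g x y z t : supported K g -> K < t -> t \in [:: `|x|; `|y|; `|z|] ->
    g (x, y, z) = 0.
  move=> sg Kt; rewrite !inE => h; apply: sg => /cubeP[xK yK zK].
  by move: h Kt => /or3P[]/eqP->; rewrite ltNge ?xK ?yK ?zK.
apply: ord3P => df cf; have sp := supported_partial _ sf.
- have ip := supported_integrable cf (sp _).
  rewrite -[LHS](integral21_prod_meas1 ip); apply: integral0_eq => z _.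
  rewrite /fubini_G /=.
  rewrite -[LHS](integral21_prod_meas1 (slice_integrable z cf (sp _))).
  apply: integral0_eq => y _; rewrite /fubini_G /=.
  apply: (@integral_derive_supp (fun t => f (t, y, z)) _ K).
  + by move=> t; exact: is_derive_slice0.
  + move=> t; apply: (continuous_comp _ (cf (t, y, z))).
    apply: (@pair_continuous _ _ _ (fun t : R => (t, y)) (fun=> z)).
      by apply: pair_continuous => u; [exact: cvg_id|exact: cvg_cst].
    by move=> u; exact: cvg_cst.
  + by move=> t Kt; apply: (far _ _ _ _ `|t|) => //; rewrite !inE eqxx.
  + by move=> t Kt; apply: (far _ _ _ _ `|t|) => //; rewrite !inE eqxx.
- have ip := supported_integrable cf (sp _).
  rewrite -[LHS](integral21_prod_meas1 ip); apply: integral0_eq => z _.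
  rewrite /fubini_G /=.
  rewrite -[LHS](integral12_prod_meas1 (slice_integrable z cf (sp _))).
  apply: integral0_eq => x _; rewrite /fubini_F /=.
  apply: (@integral_derive_supp (fun t => f (x, t, z)) _ K).
  + by move=> t; exact: is_derive_slice1.
  + move=> t; apply: (continuous_comp _ (cf (x, t, z))).
    apply: (@pair_continuous _ _ _ (fun t : R => (x, t)) (fun=> z)).
      by apply: pair_continuous => u; [exact: cvg_cst|exact: cvg_id].
    by move=> u; exact: cvg_cst.
  + by move=> t Kt; apply: (far _ _ _ _ `|t|) => //; rewrite !inE eqxx orbT.
  + by move=> t Kt; apply: (far _ _ _ _ `|t|) => //; rewrite !inE eqxx orbT.
- have ip := supported_integrable cf (sp _).
  rewrite -[LHS](integral12_prod_meas1 ip); apply: integral0_eq => -[x y] _.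
  rewrite /fubini_F /=.
  apply: (@integral_derive_supp (fun t => f (x, y, t)) _ K).
  + by move=> t; exact: is_derive_slice2.
  + move=> t; apply: (continuous_comp _ (cf (x, y, t))).
    by apply: pair_continuous => // u; [exact: cvg_cst|exact: cvg_id].
  + by move=> t Kt; apply: (far _ _ _ _ `|t|) => //; rewrite !inE eqxx !orbT.
  + by move=> t Kt; apply: (far _ _ _ _ `|t|) => //; rewrite !inE eqxx !orbT.
Qed.

End Cube.

(** * The Euclidean norm and the volume of balls *)

Section Ball.
Context {R : realType}.
Local Notation M1 := (measurableTypeR R).
Local Notation M2 := (measurableTypeR R * measurableTypeR R)%type.
Local Notation M3 := (measurableTypeR R * measurableTypeR R * measurableTypeR R)%type.
Local Notation leb := (@leb R).
Local Notation leb2 := (@leb2 R).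
Local Notation vol3 := (@vol3 R).

Definition dil1 (k : R) (x : M1) : M1 := k * x.
Definition dil2 (k : R) (x : M2) : M2 := (dil1 k x.1, dil1 k x.2).
Definition dil3 (k : R) (x : M3) : M3 := (dil2 k x.1, dil1 k x.2).

Lemma measurable_dil1 k : measurable_fun setT (dil1 k).
Proof. exact: measurable_funM. Qed.

Lemma measurable_dil2 k : measurable_fun setT (dil2 k).
Proof.
apply: measurable_fun_pair; apply: (measurableT_comp (measurable_dil1 k)) => //.
Qed.

Lemma measurable_dil3 k : measurable_fun setT (dil3 k).
Proof.
apply: measurable_fun_pair.
  exact: (measurableT_comp (measurable_dil2 k)).
exact: (measurableT_comp (measurable_dil1 k)).
Qed.

(** The right-hand side is a measure in [A] that agrees with the left one on
half-open intervals. *)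
Lemma leb_dilate (k : R) (A : set M1) : 0 < k -> measurable A ->
  leb A = (k%:E * leb (dil1 k @^-1` A))%E.
Proof.
move=> k0 mA.
pose m := mscale (NngNum (ltW k0)) (pushforward leb (dil1 k)).
rewrite [LHS](@lebesgue_measure_unique _ (m (measurable_dil1 k)))//= => _ [[a b] _ <-] /=.
rewrite -[RHS]/((k%:E * leb (dil1 k @^-1` `]a, b]%classic))%E).
have -> : dil1 k @^-1` `]a, b]%classic = `](a / k), (b / k)]%classic.
  by apply/seteqP; split => x /=; rewrite !in_itv/= ltr_pdivrMr// ler_pdivlMr// /dil1 mulrC.
have E c d : leb `]c, d]%classic = if c < d then (d - c)%:E else 0%E.
  by rewrite /leb/= lebesgue_measure_itv/= lte_fin EFinB.
rewrite [LHS]E [X in (_ * X)%E]E ltr_pM2r ?invr_gt0//.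
case: ifPn => _; last by rewrite mule0.
by rewrite -EFinM -mulrBl mulrCA divff ?mulr1 ?gt_eqF.
Qed.

Lemma leb2_dilate (k : R) (A : set M2) : 0 < k -> measurable A ->
  leb2 A = ((k ^+ 2)%:E * leb2 (dil2 k @^-1` A))%E.
Proof.
move=> k0 mA.
pose m := mscale (NngNum (exprn_ge0 2 (ltW k0))) (pushforward leb2 (dil2 k)).
rewrite [LHS](@product_measure_unique _ _ _ _ _ leb leb (m (measurable_dil2 k)))//= => B C mB mC.
rewrite -[LHS]/((k ^+ 2)%:E * leb2 (dil2 k @^-1` (B `*` C)))%E.
rewrite (_ : dil2 k @^-1` (B `*` C) = (dil1 k @^-1` B) `*` (dil1 k @^-1` C))//.
have mdB : measurable (dil1 k @^-1` B).
  by rewrite -[X in measurable X]setTI; exact: measurable_dil1.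
have mdC : measurable (dil1 k @^-1` C).
  by rewrite -[X in measurable X]setTI; exact: measurable_dil1.
rewrite [X in (_ * X)%E](product_measure1E leb leb mdB mdC).
have EB := leb_dilate k0 mB; have EC := leb_dilate k0 mC.
transitivity ((k%:E * leb (dil1 k @^-1` B)) * (k%:E * leb (dil1 k @^-1` C)))%E.
  by rewrite muleACA expr2 EFinM.
by congr (_ * _)%E; [rewrite -EB|rewrite -EC].
Qed.

Lemma vol3_dilate (k : R) (A : set M3) : 0 < k -> measurable A ->
  vol3 A = ((k ^+ 3)%:E * vol3 (dil3 k @^-1` A))%E.
Proof.
move=> k0 mA.
pose m := mscale (NngNum (exprn_ge0 3 (ltW k0))) (pushforward vol3 (dil3 k)).
rewrite [LHS](@product_measure_unique _ _ _ _ _ leb2 leb (m (measurable_dil3 k)))//= => B C mB mC.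
rewrite -[LHS]/((k ^+ 3)%:E * vol3 (dil3 k @^-1` (B `*` C)))%E.
rewrite (_ : dil3 k @^-1` (B `*` C) = (dil2 k @^-1` B) `*` (dil1 k @^-1` C))//.
have mdB : measurable (dil2 k @^-1` B).
  by rewrite -[X in measurable X]setTI; exact: measurable_dil2.
have mdC : measurable (dil1 k @^-1` C).
  by rewrite -[X in measurable X]setTI; exact: measurable_dil1.
rewrite [X in (_ * X)%E](product_measure1E leb2 leb mdB mdC).
have EB := leb2_dilate k0 mB; have EC := leb_dilate k0 mC.
transitivity (((k ^+ 2)%:E * leb2 (dil2 k @^-1` B)) * (k%:E * leb (dil1 k @^-1` C)))%E.
  by rewrite muleACA (exprSr _ 2) EFinM.
by congr (_ * _)%E; [rewrite -EB|rewrite -EC].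
Qed.

Implicit Types x : R * R * R.

Definition sqn x : R := x.1.1 ^+ 2 + x.1.2 ^+ 2 + x.2 ^+ 2.

Lemma sqn_ge0 x : 0 <= sqn x.
Proof. by rewrite !addr_ge0 ?sqr_ge0. Qed.

Lemma enormE x : enorm x = Num.sqrt (sqn x). Proof. by []. Qed.

Lemma enorm_ge0 x : 0 <= enorm x. Proof. exact: sqrtr_ge0. Qed.

Lemma enorm_sqr x : enorm x ^+ 2 = sqn x.
Proof. by rewrite enormE sqr_sqrtr// sqn_ge0. Qed.

Lemma enorm_eq0 x : enorm x = 0 -> x = 0.
Proof.
move=> x0; have := enorm_sqr x; rewrite x0 expr0n /= => /esym/eqP.
rewrite /sqn !paddr_eq0 ?addr_ge0 ?sqr_ge0// !sqrf_eq0.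
by case: x x0 => -[a b] c _ /= /andP[/andP[/eqP-> /eqP->] /eqP->].
Qed.

Lemma enorm0 : enorm (0 : R * R * R) = 0.
Proof. by rewrite enormE /sqn /= !expr0n /= !addr0 sqrtr0. Qed.

Lemma measurable_sqn : measurable_fun (setT : set M3) sqn.
Proof.
apply: measurable_funD; [apply: measurable_funD|]; apply: measurable_funX.
- exact: (measurableT_comp measurable_fst).
- exact: (measurableT_comp measurable_snd).
- exact: measurable_snd.
Qed.

Lemma lt_enorm x r : (enorm x < r) = (0 < r) && (sqn x < r ^+ 2).
Proof.
have [r0|r0] := ltP 0 r; last first.
  by apply/negbTE; rewrite -leNgt (le_trans r0)// enorm_ge0.
by rewrite -enorm_sqr ltr_pXn2r ?nnegrE ?enorm_ge0// ltW.
Qed.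

Lemma measurable_enorm : measurable_fun (setT : set M3) enorm.
Proof.
apply: (measurability _ (measurable_realfun.RGenInftyO.measurableE R)) => _ [_ [r ->] <-].
rewrite setTI (_ : _ @^-1` _ = if 0 < r then sqn @^-1` `]-oo, r ^+ 2[%classic else set0).
  case: ifP => // _; rewrite -[X in measurable X]setTI.
  by apply: measurable_sqn => //; exact: measurable_itv.
apply/seteqP; split => x /=; rewrite in_itv/= lt_enorm; first by move=> /andP[-> ?] /=; rewrite in_itv.
by case: ifP => //= _; rewrite in_itv.
Qed.

Lemma measurable_eball r : measurable (eball r : set M3).
Proof.
rewrite (_ : eball r = enorm @^-1` `]-oo, r[%classic).
  rewrite -[X in measurable X]setTI.
  by apply: measurable_enorm => //; exact: measurable_itv.
by apply/seteqP; split => x /=; rewrite in_itv.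
Qed.

(** The number 4 pi / 3, so that [3 * ball_vol] is the area of the unit
sphere. *)
Definition ball_vol : R := fine (vol3 (eball 1)).

Lemma enorm_le_cube x : cube (enorm x) x.
Proof.
case: x => -[x y] z; apply/cubeP.
have h t : t ^+ 2 <= sqn (x, y, z) -> `|t| <= enorm (x, y, z).
  by move=> h; rewrite -sqrtr_sqr; exact: ler_wsqrtr.
split; apply: h; rewrite /sqn/=.
- by rewrite -addrA lerDl addr_ge0 ?sqr_ge0.
- by rewrite addrAC lerDr addr_ge0 ?sqr_ge0.
- by rewrite lerDr addr_ge0 ?sqr_ge0.
Qed.

(** The ball lies between the cubes of half-side 1/2 and 1. *)
Lemma vol3_ball1 : vol3 (eball 1) = ball_vol%:E /\ 0 < ball_vol.
Proof.
have le8 : (vol3 (eball 1) <= 8%:E)%E.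
  have -> : 8%:E = vol3 (cube 1) by rewrite vol3_cube//; congr EFin; ring.
  apply: le_measure; rewrite ?inE; [exact: measurable_eball|exact: measurable_cube|].
  move=> x /= x1; have := enorm_le_cube x; case: x x1 => -[x y] z x1 /cubeP[? ? ?].
  by apply/cubeP; split; exact: le_trans (ltW x1).
have ge1 : (1%:E <= vol3 (eball 1))%E.
  have -> : 1%:E = vol3 (cube 2^-1) by rewrite vol3_cube//; congr EFin; field.
  apply: le_measure; rewrite ?inE; [exact: measurable_cube|exact: measurable_eball|].
  move=> [[x y] z] /cubeP[hx hy hz]; rewrite /eball /= lt_enorm ltr01/= /sqn/=.
  have sq (t : R) : `|t| <= 2^-1 -> t ^+ 2 <= 4^-1.
    move=> h; rewrite -real_normK ?num_real//.
    by rewrite (_ : 4^-1 = 2^-1 ^+ 2)// ?ler_pXn2r ?nnegrE//; field.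
  by move: (sq _ hx) (sq _ hy) (sq _ hz); rewrite expr1n; lra.
have fin : vol3 (eball 1) \is a fin_num.
  by rewrite ge0_fin_numE// (le_lt_trans le8)// ltry.
have E : vol3 (eball 1) = ball_vol%:E by rewrite /ball_vol fineK.
by split => //; move: ge1; rewrite E lee_fin; exact: lt_le_trans.
Qed.

Lemma ball_vol_gt0 : 0 < ball_vol. Proof. exact: vol3_ball1.2. Qed.

Lemma vol3_eball (r : R) : 0 <= r -> vol3 (eball r) = (ball_vol * r ^+ 3)%:E.
Proof.
rewrite le_eqVlt => /predU1P[<-|r0].
  rewrite expr0n/= mulr0 (_ : eball 0 = set0) ?measure0//.
  by apply/seteqP; split => x; rewrite /eball /= ?ltNge ?enorm_ge0.
rewrite (vol3_dilate r0 (measurable_eball r)).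
rewrite (_ : dil3 r @^-1` eball r = eball 1).
  by rewrite vol3_ball1.1 -EFinM mulrC.
apply/seteqP; split => -[[x y] z]; rewrite /eball /= !lt_enorm r0 ltr01 /=
  /dil3/dil2/dil1 /sqn /= !exprMn -!mulrDr expr1n gtr_pMr// exprn_gt0//.
Qed.
End Ball.

(** * Smooth functions of one variable *)

Section Smooth1.
Context {R : realType}.
Implicit Types (f g : R -> R) (t : R).

Lemma isd_eq f (t a b : R) : is_derive t 1 f a -> a = b -> is_derive t 1 f b.
Proof. by move=> h <-. Qed.

Lemma isd_id (t : R) : is_derive t 1 (fun s : R => s) 1.
Proof. exact: is_derive_id. Qed.

Lemma isd_cst (k t : R) : is_derive t 1 (fun _ : R => k) 0.
Proof. exact: is_derive_cst. Qed.

Lemma isdD f g (t a b : R) : is_derive t 1 f a -> is_derive t 1 g b ->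
  is_derive t 1 (fun s => f s + g s) (a + b).
Proof. by move=> df dg; exact: (is_deriveD df dg). Qed.

Lemma isdB f g (t a b : R) : is_derive t 1 f a -> is_derive t 1 g b ->
  is_derive t 1 (fun s => f s - g s) (a - b).
Proof. by move=> df dg; exact: (is_deriveB df dg). Qed.

Lemma isdN f (t a : R) : is_derive t 1 f a -> is_derive t 1 (fun s => - f s) (- a).
Proof. by move=> df; exact: (is_deriveN df). Qed.

Lemma isdM f g (t a b : R) : is_derive t 1 f a -> is_derive t 1 g b ->
  is_derive t 1 (fun s => f s * g s) (a * g t + f t * b).
Proof.
move=> df dg; apply: (is_derive_eq (is_deriveM df dg)).
by rewrite addrC; congr (_ + _); rewrite ?[_ *: _]mulrC.
Qed.

Lemma isdZ f (t a k : R) : is_derive t 1 f a ->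
  is_derive t 1 (fun s => k * f s) (k * a).
Proof.
move=> df; apply: (is_derive_eq (isdM (is_derive_cst k t 1) df)).
by rewrite mul0r add0r.
Qed.

Lemma isdX f (t a : R) n : is_derive t 1 f a ->
  is_derive t 1 (fun s => f s ^+ n) (n%:R * f t ^+ n.-1 * a).
Proof.
move=> df; elim: n => [|n IH].
  by apply: isd_eq (isd_cst 1 t) _; rewrite !mul0r.
rewrite (_ : (fun s => _) = fun s => f s * f s ^+ n); last first.
  by apply/funext => s; rewrite exprS.
apply: isd_eq (isdM df IH) _; case: n {IH} => [|n] /=; first by rewrite !mul0r expr0; ring.
by rewrite -(natr1 n.+1) !exprS; move: (n.+1%:R) (f t ^+ n) => u v; ring.
Qed.

Lemma isdV f (t a : R) : f t != 0 -> is_derive t 1 f a ->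
  is_derive t 1 (fun s => (f s)^-1) (- a / f t ^+ 2).
Proof.
move=> f0 df; apply: (is_derive_eq (is_deriveV f0 df)).
by rewrite -[LHS]/(- f t ^- 2 * a) mulrC mulrN mulNr.
Qed.

Lemma isd_comp f g (t a b : R) : is_derive (g t) 1 f a -> is_derive t 1 g b ->
  is_derive t 1 (fun s => f (g s)) (a * b).
Proof. exact: is_derive1_comp. Qed.

Lemma isd_unique f (t a b : R) : is_derive t 1 f a -> is_derive t 1 f b -> a = b.
Proof. by move=> /@derive_val <- /@derive_val <-. Qed.

Lemma isd_continuous f (t a : R) : is_derive t 1 f a -> {for t, continuous f}.
Proof. by case=> d _; apply/differentiable_continuous/derivable1_diffP. Qed.

Lemma isd_near f g (t a : R) : (\forall s \near t, f s = g s) ->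
  is_derive t 1 f a -> is_derive t 1 g a.
Proof. exact: near_eq_is_derive. Qed.

(** Carrying a derivative at every order lets the closure properties be proved
by induction on the order. *)
Fixpoint smooth_upto n f : Prop :=
  if n is n'.+1 then
    exists2 f', (forall t : R, is_derive t 1 f (f' t)) & smooth_upto n' f'
  else True.

Definition smooth f := forall n, smooth_upto n f.

Lemma smooth_uptoW n f : smooth_upto n.+1 f -> smooth_upto n f.
Proof.
elim: n f => // n IH f [f' df sf']; exists f' => //; exact: IH.
Qed.

Lemma smooth_upto_ext n f g : f =1 g -> smooth_upto n f -> smooth_upto n g.
Proof. by move=> /funext ->. Qed.

Lemma smooth_ext f g : f =1 g -> smooth f -> smooth g.
Proof. by move=> /funext ->. Qed.

Lemma smooth_upto_cst n k : smooth_upto n (fun=> k : R).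
Proof.
elim: n k => // n IH k; exists (fun=> 0) => // t; exact: isd_cst.
Qed.

Lemma smooth_uptoD n f g : smooth_upto n f -> smooth_upto n g ->
  smooth_upto n (fun t => f t + g t).
Proof.
elim: n f g => // n IH f g [f' df sf] [g' dg sg].
by exists (fun t => f' t + g' t) => [t|]; [exact: isdD|exact: IH].
Qed.

Lemma smooth_uptoM n f g : smooth_upto n f -> smooth_upto n g ->
  smooth_upto n (fun t => f t * g t).
Proof.
elim: n f g => // n IH f g /[dup] /smooth_uptoW sf [f' df sf'].
move=> /[dup] /smooth_uptoW sg [g' dg sg'].
exists (fun t => f' t * g t + f t * g' t) => [t|]; first exact: isdM.
by apply: smooth_uptoD; exact: IH.
Qed.

Lemma smooth_uptoV n f : (forall t, f t != 0) -> smooth_upto n f ->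
  smooth_upto n (fun t => (f t)^-1).
Proof.
move=> f0; elim: n => // n IH /[dup] /smooth_uptoW/IH sf [f' df sf'].
exists (fun t => -1 * f' t * ((f t)^-1 * (f t)^-1)) => [t|].
  apply: (is_derive_eq (isdV (f0 t) (df t))).
  by rewrite mulN1r expr2 invfM.
do 2?[apply: smooth_uptoM => //]; exact: smooth_upto_cst.
Qed.

Lemma smooth_upto_aff n f (a b : R) : smooth_upto n f ->
  smooth_upto n (fun t => f (a * t + b)).
Proof.
elim: n f => // n IH f [f' df sf'].
exists (fun t => a * f' (a * t + b)) => [t|].
  apply: (@isd_eq _ _ (f' (a * t + b) * a)); last by rewrite mulrC.
  apply: (isd_comp (g := fun t => a * t + b)) => //.
  apply: (@isd_eq _ _ (a * 1 + 0)); last by rewrite mulr1 addr0.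
by apply: smooth_uptoM; [exact: smooth_upto_cst|exact: IH].
Qed.

Lemma smooth_cst k : smooth (fun=> k). Proof. move=> n; exact: smooth_upto_cst. Qed.

Lemma smoothD f g : smooth f -> smooth g -> smooth (fun t => f t + g t).
Proof. by move=> sf sg n; exact: smooth_uptoD. Qed.

Lemma smoothM f g : smooth f -> smooth g -> smooth (fun t => f t * g t).
Proof. by move=> sf sg n; exact: smooth_uptoM. Qed.

Lemma smoothV f : (forall t, f t != 0) -> smooth f -> smooth (fun t => (f t)^-1).
Proof. by move=> f0 sf n; exact: smooth_uptoV. Qed.

Lemma smooth_aff f (a b : R) : smooth f -> smooth (fun t => f (a * t + b)).
Proof. by move=> sf n; exact: smooth_upto_aff. Qed.

Lemma smooth_id : smooth (fun t => t).
Proof.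
by case=> // n; exists (fun=> 1) => [t|]; [exact: isd_id|exact: smooth_upto_cst].
Qed.

Lemma smooth_primitive f f' : (forall t : R, is_derive t 1 f (f' t)) ->
  smooth f' -> smooth f.
Proof. by move=> df sf' [|n]//; exists f'. Qed.

Lemma smooth_derive f : smooth f ->
  exists2 f', (forall t : R, is_derive t 1 f (f' t)) & smooth f'.
Proof.
move=> sf; have [f' df _] := sf 1%N; exists f' => // n.
have [g dg sg] := sf n.+1; apply: smooth_upto_ext sg => t.
exact: isd_unique (dg t) (df t).
Qed.

(** The derivatives of [exp (-1/t)] are combinations of these functions. *)
Definition flatk (k : nat) t : R := if 0 < t then t^-1 ^+ k * expR (- t^-1) else 0.

(** Keep the term of order [k + 2] of the exponential series at [1 / t]. The
quadratic bound gives the derivative at the origin. *)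
Lemma flatk_bound k t : 0 < t -> `|flatk k t| <= (k.+2)`!%:R * t ^+ 2.
Proof.
move=> t0; rewrite /flatk t0 ger0_norm ?mulr_ge0 ?exprn_ge0 ?expR_ge0 ?invr_ge0 ?(ltW t0)//.
rewrite expRN -ler_pdivlMl ?exprn_gt0 ?invr_gt0//.
rewrite -[leLHS]mul1r ler_pdivrMr ?expR_gt0//.
have := @expR_ge1Dxn _ t^-1 k.+1; rewrite invr_ge0 => /(_ (ltW t0)) h.
have {}h : t^-1 ^+ k.+2 / (k.+2)`!%:R <= expR t^-1 by apply: le_trans h; rewrite lerDr.
have F0 : 0 < (k.+2)`!%:R :> R by rewrite ltr0n fact_gt0.
have -> : t^-1 ^- k * ((k.+2)`!%:R * t ^+ 2) = (k.+2)`!%:R * t ^+ k.+2.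
  by rewrite exprVn invrK mulrCA -exprD addn2.
have {1}-> : 1 = (k.+2)`!%:R * t ^+ k.+2 * (t^-1 ^+ k.+2 / (k.+2)`!%:R) :> R.
  by rewrite mulrA -(mulrA _ (t ^+ _)) -exprMn divff ?gt_eqF// expr1n mulr1 divff ?gt_eqF.
by rewrite ler_wpM2l// mulr_ge0 ?exprn_ge0 ?(ltW t0)// ltW.
Qed.

Lemma isd_o f t :
  (forall e : R, 0 < e -> \forall s \near t, `|f s - f t| <= e * `|s - t|) ->
  is_derive t 1 f 0.
Proof.
move=> fo.
have h0 : h^-1 *: ((f \o shift t) (h *: (1 : R)) - f t) @[h --> 0^'] --> (0 : R).
  apply/cvgr0Pnorm_le => e e0.
  near=> h.
  have h0 : h != 0 by near: h; exact: nbhs_dnbhs_neq.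
  rewrite -[h^-1 *: _]/(h^-1 * _) normrM normfV ler_pdivrMl ?normr_gt0//=.
  have -> : h *: (1 : R) = h by rewrite -[LHS]/(h * 1) mulr1.
  rewrite mulrC; near: h; apply: nbhs_dnbhs; move/nbhs0P: (fo _ e0); apply: filterS => h.
  by rewrite (addrC t) addrK.
split; first by apply/cvg_ex; exists 0.
exact: cvg_lim h0.
Unshelve. all: by end_near. Qed.

Lemma near_dist (t e : R) : 0 < e -> \forall s \near t, `|s - t| < e.
Proof.
by move=> e0; apply/nbhs_ballP; exists e => //= s; rewrite /ball/= distrC.
Qed.

(** How a quadratic error estimate becomes a derivative; the profile of the
minimizer is differentiated this way. *)
Lemma isd_sq f t (C : R) : (\forall s \near t, `|f s - f t| <= C * (s - t) ^+ 2) ->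
  is_derive t 1 f 0.
Proof.
move=> fC; apply: isd_o => e e0.
have C1 : 0 < `|C| + 1 by rewrite ltr_wpDl.
near=> s; have hC : `|f s - f t| <= C * (s - t) ^+ 2 by near: s.
apply: le_trans hC _; rewrite -real_normK ?num_real// expr2 mulrA ler_wpM2r//.
have he : `|s - t| < e / (`|C| + 1).
  by near: s; apply: near_dist; rewrite divr_gt0.
rewrite ltr_pdivlMr// in he; apply/ltW; apply: le_lt_trans he.
by rewrite mulrC ler_wpM2l// (le_trans (ler_norm C))// lerDl.
Unshelve. all: by end_near. Qed.

Lemma flatk_derive k t :
  is_derive t 1 (flatk k) (- k%:R * flatk k.+1 t + flatk k.+2 t).
Proof.
have [t0|t0|->] := ltgtP t 0.
- apply: (@isd_near (fun=> 0)).
    near=> s; rewrite /flatk ifN// -leNgt ltW//; near: s; exact: lt_nbhsl.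
  apply: (is_derive_eq (isd_cst 0 t)).
  by rewrite /flatk !ifN -?leNgt ?ltW// mulr0 addr0.
- apply: (@isd_near (fun s => s^-1 ^+ k * expR (- s^-1))).
    by near=> s; rewrite /flatk ifT//; near: s; exact: lt_nbhsr.
  have dV : is_derive t 1 (fun s : R => s^-1) (- 1 / t ^+ 2).
    by apply: (isdV (f := fun s => s)); rewrite gt_eqF.
  have dX : is_derive t 1 (fun s : R => s^-1 ^+ k) (- k%:R * t^-1 ^+ k.+1).
    case: k => [|k].
      by apply: (is_derive_eq (isd_cst 1 t)); rewrite oppr0 mul0r.
    apply: isd_eq (isdX k.+1 dV) _ => /=.
    by rewrite mulN1r mulrN mulNr -exprVn -mulrA -exprD addn2.
  have dE : is_derive t 1 (fun s : R => expR (- s^-1)) (t^-1 ^+ 2 * expR (- t^-1)).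
    apply: (is_derive_eq (isd_comp (f := expR) (is_derive_expR _) (isdN dV))).
    by rewrite mulN1r opprK exprVn mulrC.
  apply: (is_derive_eq (isdM dX dE)).
  rewrite /flatk !t0 mulrA; congr (_ + _); first by rewrite mulrA.
  by rewrite -exprD addn2.
- apply: (@isd_eq _ _ 0); last by rewrite /flatk ltxx mulr0 addr0.
  apply: (@isd_sq _ _ (k.+2)`!%:R); near=> s.
  rewrite /flatk ltxx !subr0 -/(flatk k s).
  have [s0|s0] := ltP 0 s; first exact: flatk_bound.
  by rewrite /flatk ltNge s0 /= normr0 mulr_ge0 ?sqr_ge0.
Unshelve. all: by end_near. Qed.

Lemma flatk_smooth k : smooth (flatk k).
Proof.
move=> n; elim: n k => // n IH k; exists (fun t => - k%:R * flatk k.+1 t + flatk k.+2 t).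
  exact: flatk_derive.
apply: smooth_uptoD => //; apply: smooth_uptoM => //; exact: smooth_upto_cst.
Qed.

Lemma flatk_gt0 k t : 0 < t -> 0 < flatk k t.
Proof. by move=> t0; rewrite /flatk t0 mulr_gt0 ?exprn_gt0 ?invr_gt0 ?expR_gt0. Qed.

Lemma flatk_ge0 k t : 0 <= flatk k t.
Proof. by have [/flatk_gt0/ltW//|t0] := ltP 0 t; rewrite /flatk ltNge t0. Qed.

Lemma flatk_le0 k t : t <= 0 -> flatk k t = 0.
Proof. by move=> t0; rewrite /flatk ltNge t0. Qed.

End Smooth1.

(** * Smooth steps *)

Section Step.
Context {R : realType}.
Implicit Types (F f g : R -> R) (r t : R).

(** Quotient [u / (u + v)] of two flat functions, vanishing to the left of
[p] and to the right of [q] respectively. *)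
Lemma smooth_step (p q : R) : p < q ->
  exists P P' : R -> R, [/\ smooth P, (forall r : R, is_derive r 1 P (P' r)),
    (forall r, 0 <= P r <= 1), (forall r, 0 <= P' r)
    & (forall r, r <= p -> P r = 0 /\ P' r = 0) /\
      (forall r, q <= r -> P r = 1 /\ P' r = 0)].
Proof.
move=> pq.
pose u r := flatk 0 (1 * r + - p) : R; pose v r := flatk 0 (-1 * r + q) : R.
pose u' r := flatk 2 (1 * r + - p) : R; pose v' r := flatk 2 (-1 * r + q) : R.
have su : smooth u by apply: smooth_aff; exact: flatk_smooth.
have sv : smooth v by apply: smooth_aff; exact: flatk_smooth.
have aff (a b r : R) : is_derive r 1 (fun s => a * s + b) a.
  by apply: isd_eq (isdD (isdZ a (isd_id r)) (isd_cst b r)) _; rewrite mulr1 addr0.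
have du r : is_derive r 1 u (u' r).
  apply: isd_eq (isd_comp (g := fun s => 1 * s + - p) (flatk_derive 0 _) (aff _ _ _)) _.
  by rewrite mulr1 oppr0 mul0r add0r.
have dv r : is_derive r 1 v (- v' r).
  apply: isd_eq (isd_comp (g := fun s => -1 * s + q) (flatk_derive 0 _) (aff _ _ _)) _.
  by rewrite mulrN1 oppr0 mul0r add0r.
have u0 r : 0 <= u r by exact: flatk_ge0.
have v0 r : 0 <= v r by exact: flatk_ge0.
have u'0 r : 0 <= u' r by exact: flatk_ge0.
have v'0 r : 0 <= v' r by exact: flatk_ge0.
have uv r : 0 < u r + v r.
  have [rp|rp] := ltP p r; first by rewrite ltr_wpDr// flatk_gt0// mul1r subr_gt0.
  by rewrite ltr_wpDl// flatk_gt0//; lra.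
have up r : r <= p -> u r = 0 /\ u' r = 0.
  by move=> rp; rewrite /u /u' !flatk_le0//; lra.
have vq r : q <= r -> v r = 0 /\ v' r = 0.
  by move=> rp; rewrite /v /v' !flatk_le0//; lra.
pose P r := u r * (u r + v r)^-1.
pose P' r := (u' r * v r + u r * v' r) / (u r + v r) ^+ 2.
have uvn r : u r + v r != 0 by rewrite gt_eqF.
exists P, P'; split.
- by apply: smoothM => //; apply: smoothV => //; exact: smoothD.
- move=> r; apply: isd_eq (isdM (du r) (isdV (f := fun s => u s + v s) (uvn r) (isdD (du r) (dv r)))) _.
  by rewrite /P'; field.
- move=> r; rewrite /P; apply/andP; split; first by rewrite divr_ge0// ltW.
  by rewrite ler_pdivrMr// mul1r lerDl.
- by move=> r; rewrite /P' divr_ge0 ?sqr_ge0// addr_ge0// mulr_ge0.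
- split=> r hr; rewrite /P /P'.
    by have [-> ->] := up _ hr; rewrite !mul0r addr0 mul0r.
  have [v00 ->] := vq _ hr; rewrite v00 !mulr0 !addr0 mul0r divff//.
  by have := uvn r; rewrite v00 addr0.
Qed.

(** Vanishing near 0 keeps [F (enorm x)] smooth at the origin, where the norm is
not differentiable. *)
Definition profile F := smooth F /\ exists2 a : R, 0 < a & forall r, r <= a -> F r = 0.

Lemma profile_derive F : profile F ->
  exists2 F', (forall r : R, is_derive r 1 F (F' r)) & profile F'.
Proof.
move=> [/smooth_derive[F' dF sF'] [a a0 Fa]]; exists F' => //; split => //.
exists (a / 2); first by rewrite divr_gt0.
move=> r ra; apply: (isd_unique (dF r)); apply: (@isd_near _ (fun=> 0)).
  near=> s; rewrite Fa//; apply/ltW; near: s.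
  by apply: lt_nbhsl; rewrite (le_lt_trans ra)// ltr_pdivrMr// ltr_pMr// ltrDl.
Unshelve. all: by end_near. Qed.

(** The divisor may be changed near 0, where [F] vanishes, into a smooth function
without zeros. *)
Lemma profile_div F : profile F -> profile (fun r => F r / r).
Proof.
move=> [sF [a a0 Fa]]; split; last by exists a => // r /Fa ->; rewrite mul0r.
pose v r := r * r + flatk 0 (-1 * r + a).
have v0 r : v r != 0.
  have [ra|ra] := leP a r.
    by rewrite gt_eqF// ltr_wpDr ?flatk_ge0// mulr_gt0// (lt_le_trans a0).
  by rewrite gt_eqF// ltr_wpDl ?flatk_gt0 -?expr2 ?sqr_ge0//; lra.
apply: (@smooth_ext _ (fun r => F r * r * (v r)^-1)) => [r|].
  have [/Fa->|ra] := leP r a; first by rewrite !mul0r.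
  rewrite /v flatk_le0; last by lra.
  have r0 : r != 0 by rewrite gt_eqF// (lt_trans a0).
  by rewrite addr0; field.
apply: smoothM; first by apply: smoothM => //; exact: smooth_id.
apply: smoothV => //; apply: smoothD; first by apply: smoothM; exact: smooth_id.
by apply: smooth_aff; exact: flatk_smooth.
Qed.
End Step.

(** * Radial functions of class C^k *)

Section Dir.
Context {R : realType}.
Local Notation R3 := (R * R * R)%type.
Implicit Types (f : R3 -> R) (x : R3) (i j : 'I_3).

Lemma is_derive_dir f (p v : R3) (a : R) :
  is_derive (0 : R) (1 : R) (fun s : R => f (s *: v + p)) a -> is_derive p v f a.
Proof.
have E : (fun h : R => h^-1 *: ((f \o shift p) (h *: v) - f p)) =
         (fun h : R => h^-1 *: (((fun s : R => f (s *: v + p)) \o shift 0) (h *: 1) - f (0 *: v + p))).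
  by apply/funext => h /=; rewrite scale0r add0r addr0 [h *: 1]mulr1.
move=> [dv ev]; split; first by rewrite /derivable E.
by rewrite -ev /derive E.
Qed.

Definition coord i x : R := if val i is k.+1 then (if k is 0 then x.1.2 else x.2) else x.1.1.

Lemma coord_continuous i : continuous (coord i).
Proof.
rewrite /coord; case: (val i) => [|[|k]] x /=.
- by apply: (@cvg_comp _ _ _ fst fst _ (nbhs x.1)); exact: cvg_fst.
- by apply: (@cvg_comp _ _ _ fst snd _ (nbhs x.1)); [exact: cvg_fst|exact: cvg_snd].
- exact: cvg_snd.
Qed.

Lemma coord_basis i j (s : R) x :
  coord i (s *: basis j + x) = (i == j)%:R * s + coord i x.
Proof.
rewrite -val_eqE; move: i j.
by apply: ord3P; apply: ord3P; rewrite /coord /basis /= !inordK//= -?[s *: _]/(s * _)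
  ?mulr1 ?mulr0 ?mul1r ?mul0r.
Qed.

Lemma sqn_basis j (s : R) x :
  sqn (s *: basis j + x) = sqn x + 2 * s * coord j x + s ^+ 2.
Proof.
case: x => -[x y] z; move: j.
by apply: ord3P; rewrite /sqn /coord /basis /= !inordK//= -?[s *: _]/(s * _)
  ?mulr1 ?mulr0; ring.
Qed.

Lemma sqn_continuous : continuous (@sqn R).
Proof.
have E : @sqn R = (fun x => coord (inord 0) x * coord (inord 0) x +
   coord (inord 1) x * coord (inord 1) x + coord (inord 2) x * coord (inord 2) x).
  by apply/funext => x; rewrite /sqn /coord /= !inordK//= !expr2.
rewrite E => x; apply: cvgD; [apply: cvgD|];
  by apply: cvgM; exact: coord_continuous.
Qed.

Lemma is_derive_coord i j x : is_derive x (basis j) (coord i) (i == j)%:R.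
Proof.
apply: is_derive_dir; rewrite (_ : (fun s => _) = fun s => (i == j)%:R * s + coord i x).
  by apply: isd_eq (isdD (isdZ _ (isd_id 0)) (isd_cst _ 0)) _; rewrite mulr1 addr0.
by apply/funext => s; rewrite coord_basis.
Qed.

(** Along a coordinate line the squared norm is a polynomial of degree 2. *)
Lemma is_derive_comp_sqn (h : R -> R) (a : R) j x :
  is_derive (sqn x) 1 h a ->
  is_derive x (basis j) (fun y => h (sqn y)) (2 * coord j x * a).
Proof.
move=> dh; apply: is_derive_dir.
pose g (s : R) := sqn x + 2 * s * coord j x + s ^+ 2.
rewrite (_ : (fun s => _) = fun s => h (g s)); last first.
  by apply/funext => s; rewrite sqn_basis.
have dg : is_derive (0 : R) 1 g (2 * coord j x).
  rewrite (_ : g = fun s => (sqn x + (2 * coord j x) * s) + s * s); last first.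
    by apply/funext => s; rewrite /g expr2; ring.
  apply: isd_eq (isdD (isdD (isd_cst _ 0) (isdZ _ (isd_id 0))) (isdM (isd_id 0) (isd_id 0))) _.
  by rewrite !mulr0 !mulr1 add0r !addr0.
apply: isd_eq (isd_comp (g := g) _ dg) _; last by rewrite mulrC.
by rewrite /g mulr0 mul0r expr0n /= !addr0; exact: dh.
Qed.

Lemma is_derive_rad (F F' : R -> R) j x : profile F ->
  (forall r : R, is_derive r 1 F (F' r)) ->
  is_derive x (basis j) (fun y => F (enorm y)) (coord j x * (F' (enorm x) / enorm x)).
Proof.
move=> [_ [a a0 Fa]] dF.
suff dk : is_derive (sqn x) 1 (fun t => F (Num.sqrt t)) (F' (enorm x) / enorm x / 2).
  apply: is_derive_eq (is_derive_comp_sqn j dk) _.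
  by move: (F' _ / _) => u; field.
have [xa|xa] := ltP (enorm x) a.
  have -> : F' (enorm x) = 0.
    apply: (isd_unique (dF _)); apply: (@isd_near _ (fun=> 0)).
    by near=> s; rewrite Fa//; apply/ltW; near: s; exact: lt_nbhsl.
  rewrite !mul0r; apply: (@isd_near _ (fun=> 0)).
  near=> s; rewrite Fa// -(ger0_norm (ltW a0)) -sqrtr_sqr ler_wsqrtr//.
  apply/ltW; near: s; apply: lt_nbhsl.
  by rewrite -enorm_sqr ltr_pXn2r ?nnegrE ?enorm_ge0// ltW.
have x0 : 0 < enorm x by rewrite (lt_le_trans a0).
have sx : 0 < sqn x by rewrite -enorm_sqr exprn_gt0.
apply: isd_eq (isd_comp (g := Num.sqrt) (dF _) (is_derive1_sqrt sx)) _.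
by rewrite -[Num.sqrt (sqn x)]/(enorm x); field; rewrite gt_eqF.
Unshelve. all: by end_near. Qed.

Lemma enorm_continuous : continuous (@enorm R).
Proof.
move=> x; apply: (@continuous_comp _ _ _ (@sqn R) Num.sqrt).
  exact: sqn_continuous.
exact: sqrt_continuous.
Qed.

(** The class is stable under partial derivatives, because
[d_j F(|x|) = x_j F'(|x|) / |x|] and [F' r / r] is again a profile; this is what
makes its members smooth ([radclass_Ck]). *)
Inductive radclass : (R3 -> R) -> Prop :=
| rad_profile F : profile F -> radclass (fun x => F (enorm x))
| rad_cst (c : R) : radclass (fun=> c)
| rad_coord i f : radclass f -> radclass (fun x => coord i x * f x)
| rad_scale c f : radclass f -> radclass (fun x => c * f x)
| rad_add f g : radclass f -> radclass g -> radclass (fun x => f x + g x).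

Lemma radclass_continuous f : radclass f -> continuous f.
Proof.
elim => [F [sF _]|c|i {}f _ cf|c {}f _ cf|{}f g _ cf _ cg] x.
- apply: continuous_comp; first exact: enorm_continuous.
  by have [F' dF _] := smooth_derive sF; exact: isd_continuous (dF _).
- exact: cvg_cst.
- by apply: cvgM; [exact: coord_continuous|exact: cf].
- by apply: cvgM; [exact: cvg_cst|exact: cf].
- by apply: cvgD; [exact: cf|exact: cg].
Qed.

Lemma radclass_derive f j : radclass f ->
  exists2 f', radclass f' & forall x, is_derive x (basis j) f (f' x).
Proof.
elim => [F pF|c|i {}f rf [f' rf' df]|c {}f rf [f' rf' df]|{}f g _ [f' rf' df] _ [g' rg' dg]].
- have [F' dF pF'] := profile_derive pF.
  exists (fun x => coord j x * (F' (enorm x) / enorm x)) => [|x].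
    by apply: rad_coord; exact: (rad_profile (profile_div pF')).
  exact: is_derive_rad.
- exists (fun=> 0) => [|x]; [exact: rad_cst|exact: is_derive_cst].
- exists (fun x => (i == j)%:R * f x + coord i x * f' x) => [|x].
    by apply: rad_add; [exact: rad_scale|exact: rad_coord].
  apply: (is_derive_eq (is_deriveM (is_derive_coord i j x) (df x))).
  by rewrite addrC; congr (_ + _); rewrite -[LHS]/(_ * _) mulrC.
- exists (fun x => c * f' x) => [|x]; first exact: rad_scale.
  apply: (is_derive_eq (is_deriveM (is_derive_cst c x (basis j)) (df x))).
  by rewrite scaler0 addr0.
- exists (fun x => f' x + g' x) => [|x]; first exact: rad_add.
  exact: is_deriveD.
Qed.

Lemma radclass_partial f j : radclass f ->
  radclass (partial j f) /\ forall x, derivable f x (basis j).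
Proof.
move=> /(radclass_derive j)[f' rf' df]; split; last by move=> x; case: (df x).
by rewrite (_ : partial j f = f')//; apply/funext => x; exact: (@derive_val _ _ _ _ _ _ _ (df x)).
Qed.

Lemma radclass_Ck k f (A : set R3) : radclass f -> Ck k A f.
Proof.
elim: k f => [|k IH] f rf /=; split => //.
- by move=> x _; exact: radclass_continuous.
- by move=> x _; exact: radclass_continuous.
- move=> i; have [rp df] := radclass_partial i rf; split; last exact: IH.
  by move=> x _.
Qed.

End Dir.

(** * Monotonicity and primitives *)

Section Mono.
Context {R : realType}.
Implicit Types (f g : R -> R).

Lemma isd_le (f f' : R -> R) (a b : R) : a <= b ->
  (forall r, a <= r <= b -> is_derive r 1 f (f' r)) ->
  (forall r, a < r < b -> 0 <= f' r) -> f a <= f b.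
Proof.
rewrite le_eqVlt => /predU1P[->//|ab] df f0.
have cf : {within `[a, b], continuous f}.
  apply: derivable_within_continuous => r; rewrite in_itv/= => rab.
  by case: (df r rab).
have dfo r : r \in `]a, b[ -> is_derive r 1 f (f' r).
  by rewrite in_itv/= => /andP[ra rb]; apply: df; rewrite !ltW.
have [c cab E] := MVT ab dfo cf.
rewrite -subr_ge0 E; apply: mulr_ge0; last by rewrite subr_ge0 ltW.
by apply: f0; move: cab; rewrite in_itv.
Qed.

Lemma isd_eq_cst (f f' : R -> R) (a b : R) : a <= b ->
  (forall r, a <= r <= b -> is_derive r 1 f (f' r)) ->
  (forall r, a < r < b -> f' r = 0) -> f a = f b.
Proof.
move=> ab df f0; apply/eqP; rewrite eq_le (isd_le ab df)/=; last first.
  by move=> r /f0 ->.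
rewrite -lerN2; apply: (@isd_le (fun r => - f r) (fun r => - f' r) _ _ ab) => r.
  by move=> rab; apply: isdN; exact: df.
by move=> /f0 ->; rewrite oppr0.
Qed.

Lemma profile_primitive (K : R -> R) : profile K ->
  exists2 I : R -> R, profile I & forall r : R, is_derive r 1 I (K r).
Proof.
move=> [sK [a a0 Ka]].
pose I (r : R) := \int[@lebesgue_measure R]_(t in `[0, r]) K t.
have cK : continuous K by move=> r; have [K' dK _] := smooth_derive sK; exact: isd_continuous (dK r).
have Ia r : r <= a -> I r = 0.
  move=> ra; rewrite /I /Rintegral integral0_eq// => t /=; rewrite in_itv/= => /andP[_ tr].
  by rewrite Ka// (le_trans tr).
have dI (r : R) : is_derive r 1 I (K r).
  have [ra|ra] := ltP r a.
    rewrite Ka 1?ltW//; apply: (@isd_near _ (fun=> 0)).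
    by near=> s; rewrite Ia// ltW//; near: s; exact: lt_nbhsl.
  have r0 : 0 < r by exact: lt_le_trans ra.
  have r1 : r < r + 1 by rewrite ltrDl.
  have iK : lebesgue_measure.-integrable `[0, (r + 1)] (EFin \o K).
    apply: continuous_compact_integrable; first exact: segment_compact.
    exact: continuous_subspaceT.
  have := @continuous_FTC1_closed _ K 0 r (r + 1) r1 iK r0 (cK r).
  by rewrite derive1E => -[d E]; apply: DeriveDef.
exists I => //; split; first exact: smooth_primitive sK.
by exists a.
Unshelve. all: by end_near. Qed.

End Mono.

(** * Radial test functions *)

Section Test.
Context {R : realType}.
Local Notation R3 := (R * R * R)%type.

Lemma sum3 (F : 'I_3 -> R) : \sum_(i < 3) F i = F (inord 0) + F (inord 1) + F (inord 2).
Proof.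
rewrite !big_ord_recl big_ord0 addr0 addrA.
by congr (F _ + F _ + F _); apply/val_inj; rewrite /= inordK.
Qed.

Lemma sum_coord_sqr (x : R3) : \sum_(i < 3) coord i x ^+ 2 = sqn x.
Proof. by rewrite sum3 /coord /= !inordK. Qed.

Lemma cube_test_function (K : R) (f : R3 -> R) :
  radclass f -> supported K f -> test_function f.
Proof.
move=> rf sf; split; first by move=> k; exact: radclass_Ck.
apply: (@subclosed_compact _ _ (cube K)); [exact: closed_closure|exact: cube_compact|].
have cK : closed (cube K : set R3).
  by apply: compact_closed; [exact: norm_hausdorff|exact: cube_compact].
apply: (@subset_trans _ (closure (cube K : set R3))).
  apply: closure_subset => x /= fx.
  by apply: contrapT => /sf /eqP; rewrite (negbTE fx).
by rewrite -(iffLR (closure_id _) cK).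
Qed.

(** The gradient of [Th(|x|)] is [L(|x|) x], whose divergence is [3 L + r L']. *)
Lemma laplacian_rad (Th K L L' : R -> R) (T : R) (x : R3) :
  profile Th -> (forall r : R, is_derive r 1 Th (K r)) ->
  profile L -> (forall r, L r = K r / r) -> (forall r : R, is_derive r 1 L (L' r)) ->
  laplacian (fun x => T + -1 * Th (enorm x)) x =
  - (3 * L (enorm x) + enorm x * L' (enorm x)).
Proof.
move=> pTh dTh pL LE dL; rewrite /laplacian.
have p1 i : partial i (fun x => T + -1 * Th (enorm x)) = fun x => -1 * (coord i x * L (enorm x)).
  apply/funext => y; apply: derive_val.
  have := is_deriveD (is_derive_cst T y (basis i))
    (is_deriveM (is_derive_cst (-1 : R) y (basis i)) (is_derive_rad i y pTh dTh)).
  by move=> h; apply: (is_derive_eq h); rewrite scaler0 addr0 add0r -LE.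
have p2 i : partial i (partial i (fun x => T + -1 * Th (enorm x))) x =
    - (L (enorm x) + coord i x ^+ 2 * (L' (enorm x) / enorm x)).
  rewrite p1; apply: derive_val.
  have := is_deriveM (is_derive_cst (-1 : R) x (basis i))
    (is_deriveM (is_derive_coord i i x) (is_derive_rad i x pL dL)).
  move=> h; apply: (is_derive_eq h); rewrite scaler0 addr0 eqxx -[LHS]/(-1 * (coord i x * _ + _ * 1)) mulr1 mulN1r.
  by rewrite mulrA -expr2 addrC.
rewrite (eq_bigr _ (fun i _ => p2 i)) sumrN big_split/= -big_distrl/= sum_coord_sqr -enorm_sqr.
rewrite sumr_const card_ord; congr (- (_ + _)); first by rewrite mulr_natl.
have [->|x0] := eqVneq (enorm x) 0; first by rewrite expr0n/= !mul0r.
by field.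
Qed.

(** The function is [T - I(|x|)] with [I' = Q / r^2] and [Q = P1 - P2], the
potential of two opposite unit charges smeared over the shells [p, p'] and
[q, q']. The bounds on its central value [T] compare [I'] with [1 / r^2]. *)
Lemma radial_test (p p' q q' : R) (P1 D1 P2 D2 : R -> R) :
  0 < p -> p < p' -> p' <= q -> q < q' ->
  smooth P1 -> (forall r : R, is_derive r 1 P1 (D1 r)) -> (forall r, 0 <= P1 r <= 1) ->
  (forall r, r <= p -> P1 r = 0) -> (forall r, p' <= r -> P1 r = 1) ->
  smooth P2 -> (forall r : R, is_derive r 1 P2 (D2 r)) -> (forall r, 0 <= P2 r <= 1) ->
  (forall r, r <= q -> P2 r = 0) -> (forall r, q' <= r -> P2 r = 1) ->
  exists (psi : R3 -> R) (T : R), [/\ test_function psi /\ supported q' psi,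
    (forall x, laplacian psi x = - ((D1 (enorm x) - D2 (enorm x)) / enorm x ^+ 2)),
    p'^-1 - q^-1 <= T <= p^-1 - q'^-1,
    (forall x, enorm x <= p -> psi x = T) & (forall x, 0 <= psi x <= T) /\
    (forall x, q' <= enorm x -> psi x = 0)].
Proof.
move=> p0 pp' p'q qq' sP1 dP1 P1b P1p P1p' sP2 dP2 P2b P2q P2q'.
have p'0 : 0 < p' by exact: lt_trans pp'.
have q0 : 0 < q by exact: lt_le_trans p'q.
have q'0 : 0 < q' by exact: lt_trans qq'.
pose Q r := P1 r + -1 * P2 r.
have Qp r : r <= p -> Q r = 0.
  by move=> rp; rewrite /Q P1p// P2q ?mulr0 ?addr0//; lra.
have Qq' r : q' <= r -> Q r = 0.
  by move=> rp; rewrite /Q P1p' ?P2q' ?mulr1 ?subrr//; lra.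
have Q1 r : p' <= r <= q -> Q r = 1.
  by move=> /andP[r1 r2]; rewrite /Q P1p' ?P2q ?mulr0 ?addr0.
have Q01 r : 0 <= Q r <= 1.
  rewrite /Q; move: (P1b r) (P2b r); have [rp'|rp'] := leP p' r.
    by rewrite P1p'//; lra.
  by rewrite (P2q r)//; lra.
have sQ : smooth Q by apply: smoothD => //; apply: smoothM => //; exact: smooth_cst.
have dQ (r : R) : is_derive r 1 Q (D1 r - D2 r).
  by apply: isd_eq (isdD (dP1 r) (isdZ (-1) (dP2 r))) _; rewrite mulN1r.
have pQ : profile Q by split => //; exists p.
pose K r := Q r / r / r.
have pK : profile K by do 2 apply: profile_div.
pose L r := K r / r.
have pL : profile L by exact: profile_div.
have [L' dL _] := profile_derive pL.
have [I0 pI0 dI0] := profile_primitive pK.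
pose I r := I0 r - I0 p.
have dI (r : R) : is_derive r 1 I (K r).
  by apply: isd_eq (isdB (dI0 r) (isd_cst _ r)) _; rewrite subr0.
have K0 r : 0 <= r -> 0 <= K r.
  by move=> r0; rewrite /K !divr_ge0//; case/andP: (Q01 r).
have Ip r : r <= p -> I r = 0.
  move=> rp; suff -> : I r = I p by rewrite /I subrr.
  apply: (isd_eq_cst rp) => s /andP[_ sp].
  by rewrite /K Qp ?mul0r// ltW.
have pI : profile I.
  by split; [exact: smooth_primitive dI pK.1|exists p].
have Iq' r : q' <= r -> I r = I q'.
  move=> rq; symmetry; apply: (isd_eq_cst rq) => s /andP[sp _].
  by rewrite /K Qq' ?mul0r// ltW.
have Ile r s : 0 <= r -> r <= s -> I r <= I s.
  move=> r0 rs; apply: (isd_le rs) => t /andP[rt _].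
  by apply: K0; rewrite (le_trans r0)// ltW.
pose T := I q'.
pose psi (x : R3) := T + -1 * I (enorm x).
have dinv (r : R) : 0 < r -> is_derive r 1 (fun s => s^-1) (- (r ^+ 2)^-1).
  by move=> r0; apply: isd_eq (isdV (f := fun s => s) _ (isd_id r)) _; rewrite ?gt_eqF// mulN1r.
have psi0 x : q' <= enorm x -> psi x = 0.
  by move=> xq; rewrite /psi Iq'// mulN1r subrr.
have spsi : supported q' psi.
  move=> [[x y] z] xK; apply: psi0; rewrite leNgt; apply/negP => xq'; apply: xK.
  have /cubeP[h1 h2 h3] := enorm_le_cube (x, y, z).
  by apply/cubeP; split; apply: le_trans (ltW xq').
exists psi, T; split.
- split => //; apply: cube_test_function spsi.
  apply: rad_add; first exact: rad_cst.
  by apply: rad_scale; exact: rad_profile.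
- move=> x; rewrite (@laplacian_rad I K L L' T x pI dI pL)//; congr (- _).
  have [x0|x0] := eqVneq (enorm x) 0.
    by rewrite x0 mul0r addr0 expr0n/= invr0 mulr0 /L invr0 mulr0 mulr0.
  have {}x0 : 0 < enorm x by rewrite lt_def x0 enorm_ge0.
  move: (enorm x) x0 => r r0.
  have dd := isdM (isdM (isdM (dQ r) (dinv r r0)) (dinv r r0)) (dinv r r0).
  rewrite (isd_unique (dL r) dd) /L /K; field; rewrite gt_eqF//.
- apply/andP; split.
    apply: (@le_trans _ _ (I q - I p')).
      suff : I p' + p'^-1 <= I q + q^-1 by lra.
      apply: (@isd_le _ (fun r => I r + r^-1) (fun r => K r - (r ^+ 2)^-1)) => // r.
        move=> /andP[rp' rq]; exact: (isdD (dI r) (dinv r (lt_le_trans p'0 rp'))).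
      move=> /andP[rp' rq]; rewrite /K Q1 ?(ltW rp') ?(ltW rq)//.
      by rewrite mul1r -invfM -expr2 subrr.
    have : 0 <= I p' by rewrite -(Ip p)// Ile ?(ltW pp') ?(ltW p0).
    have : I q <= T by rewrite Ile ?(ltW q0) ?(ltW qq').
    lra.
  suff : - (I p + -1 * - p^-1) <= - (I q' + -1 * - q'^-1) by rewrite Ip// -/T; lra.
  have pq' : p <= q' by lra.
  apply: (@isd_le _ (fun r => - (I r + -1 * - r^-1)) (fun r => - (K r - (r ^+ 2)^-1)) _ _ pq') => r.
    move=> /andP[rp _]; have r0 : 0 < r by exact: lt_le_trans rp.
    apply: isd_eq (isdN (isdD (dI r) (isdZ (-1) (isdN (dinv r r0))))) _.
    by rewrite opprK mulN1r.
  move=> /andP[rp _]; have r0 : 0 < r by exact: lt_trans rp.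
  rewrite oppr_ge0 subr_le0 /K -mulrA -invfM -expr2 ler_piMl ?invr_ge0 ?sqr_ge0//.
  by case/andP: (Q01 r).
- by move=> x xp; rewrite /psi Ip// mulr0 addr0.
- split => // x; rewrite /psi mulN1r subr_ge0 gerBl; apply/andP; split.
    have [xq|xq] := leP (enorm x) q'; first by rewrite Ile ?enorm_ge0.
    by rewrite Iq'// ltW.
  by rewrite -(Ip 0) ?(ltW p0)// Ile ?enorm_ge0.
Qed.

End Test.

(** * Integration over shells *)

Section ShellDerivative.
Context {R : realType}.

(** The hypothesis says that over a shell [J] grows by a mean value of [F] times
the volume of the shell; continuity of [F] turns this into a derivative. It
serves both for test functions and for the mass of the minimizer. *)
Lemma shell_derivative (J F : R -> R) (c r : R) : 0 <= c -> 0 < r ->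
  (forall s t m M : R, 0 < s -> s <= t -> (forall u, s <= u < t -> m <= F u <= M) ->
     m * (c * (t ^+ 3 - s ^+ 3)) <= J t - J s <= M * (c * (t ^+ 3 - s ^+ 3))) ->
  {for r, continuous F} -> is_derive r 1 J (3 * c * r ^+ 2 * F r).
Proof.
move=> c0 r0 JF cF.
pose E t := J t - F r * c * t ^+ 3.
suff dE : is_derive r 1 E 0.
  rewrite (_ : J = fun t => E t + F r * c * t ^+ 3); last first.
    by apply/funext => t; rewrite /E subrK.
  apply: isd_eq (isdD dE (isdZ (F r * c) (isdX 3 (isd_id r)))) _.
  by rewrite /=; ring.
apply: isd_o => e e0.
pose d := e / (c * 12 * r ^+ 2 + 1).
have D0 : 0 < c * 12 * r ^+ 2 + 1 by apply: ltr_wpDl => //; apply: mulr_ge0; [exact: mulr_ge0|exact: sqr_ge0].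
have d0 : 0 < d by rewrite divr_gt0.
have /nbhs_ballP[h /= h0 hF] : \forall s \near r, `|F r - F s| < d by exact: (cvgr_dist_lt F (F r) cF d d0).
have key (s t : R) : 0 < s -> s <= t -> t < 2 * r -> `|r - s| < h -> `|r - t| < h ->
    `|E t - E s| <= e * (t - s).
  move=> s0 st t2 rs rt.
  have Fb u : s <= u < t -> F r - d <= F u <= F r + d.
    move=> /andP[su ut]; have : `|F r - F u| < d.
      apply: hF; rewrite /ball/=; move: rs rt; rewrite !ltr_norml => /andP[? ?] /andP[? ?].
      by apply/andP; split; lra.
    by rewrite ltr_norml => /andP[? ?]; apply/andP; split; lra.
  have /andP[] := JF s t _ _ s0 st Fb.
  have ts : t ^+ 3 - s ^+ 3 <= 12 * r ^+ 2 * (t - s).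
    have -> : t ^+ 3 - s ^+ 3 = (t ^+ 2 + t * s + s ^+ 2) * (t - s) by ring.
    by apply: ler_wpM2r; [lra|nra].
  have ts0 : 0 <= t ^+ 3 - s ^+ 3 by rewrite subr_ge0 ler_pXn2r ?nnegrE//; lra.
  have dc : d * (c * (t ^+ 3 - s ^+ 3)) <= e * (t - s).
    apply: (@le_trans _ _ (d * (c * (12 * r ^+ 2 * (t - s))))).
      by rewrite ler_wpM2l ?(ltW d0)// ler_wpM2l.
    have -> : d * (c * (12 * r ^+ 2 * (t - s))) = d * (c * 12 * r ^+ 2) * (t - s) by ring.
    apply: ler_wpM2r; first by rewrite subr_ge0.
    rewrite -[leRHS](divfK (lt0r_neq0 D0)) -/d ler_pM2l//.
    by rewrite lerDl.
  rewrite /E ler_norml.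
  set X := c * _ in dc *; have -> : F r * c * t ^+ 3 = F r * c * s ^+ 3 + F r * X by rewrite /X; ring.
  by rewrite !mulrDl mulNr => ? ?; apply/andP; split; lra.
near=> s.
have s0 : 0 < s by near: s; exact: lt_nbhsr.
have s2 : s < 2 * r by near: s; apply: lt_nbhsl; lra.
have sh : `|r - s| < h by rewrite distrC; near: s; exact: near_dist.
have [sr|/ltW rs] := leP s r.
  rewrite (distrC (E s)) (ler0_norm (x := s - r)) ?subr_le0//.
  have -> : - (s - r) = r - s by rewrite opprB.
  by apply: key => //; [lra|rewrite subrr normr0].
rewrite (ger0_norm (x := s - r)) ?subr_ge0//.
by apply: key => //; rewrite subrr normr0.
Unshelve. all: by end_near. Qed.
End ShellDerivative.

Section Shell.
Context {R : realType}.
Local Notation R3 := (R * R * R)%type.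
Local Notation M3 := (measurableTypeR R * measurableTypeR R * measurableTypeR R)%type.
Local Notation vol3 := (@vol3 R).
Local Notation c3 := (@ball_vol R).
Implicit Types (f : R3 -> R).

Definition shell (r s : R) : set M3 := eball s `\` eball r.

Lemma shellP r s (x : R3) : shell r s x <-> r <= enorm x < s.
Proof.
rewrite /shell /eball; split => [[/= ? /negP]|/andP[rx xs]].
  by rewrite -leNgt => ->.
by split => //=; apply/negP; rewrite -leNgt.
Qed.

Lemma measurable_shell r s : measurable (shell r s).
Proof. by apply: measurableD; exact: measurable_eball. Qed.

Lemma eball_shell r s : r <= s -> (eball s : set M3) = eball r `|` shell r s.
Proof.
move=> rs; rewrite /shell setDUK// => x; rewrite /eball /= => xr.
exact: lt_le_trans rs.
Qed.

Lemma vol3_shell r s : 0 <= r -> r <= s -> vol3 (shell r s) = (c3 * (s ^+ 3 - r ^+ 3))%:E.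
Proof.
move=> r0 rs; have s0 := le_trans r0 rs.
rewrite /shell measureD; [|exact: measurable_eball..|]; last first.
  exact: (eq_ind_r (fun u : \bar R => (u < +oo)%E) (ltry _) (vol3_eball s0)).
rewrite setIidr; last by move=> x; rewrite /eball /= => xr; exact: lt_le_trans rs.
transitivity ((c3 * s ^+ 3)%:E - (c3 * r ^+ 3)%:E)%E.
  by congr (_ - _)%E; exact: vol3_eball.
by rewrite -EFinB mulrBr.
Qed.

Definition ball_int f (r : R) : R := \int[vol3]_(x in eball r) f x.

Lemma ball_int_shell f r s : r <= s -> vol3.-integrable setT (EFin \o f) ->
  ball_int f s - ball_int f r = \int[vol3]_(x in shell r s) f x.
Proof.
move=> rs fi; rewrite /ball_int (eball_shell rs) Rintegral_setU.
- by rewrite addrAC subrr add0r.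
- exact: measurable_eball.
- exact: measurable_shell.
- apply: integrableS fi => //; apply: measurableU.
    exact: measurable_eball.
  exact: measurable_shell.
- by apply/disj_setPS => x [] h1 [_ h2].
Qed.

Lemma shell_cst_integrable (k r s : R) : 0 <= r -> r <= s ->
  vol3.-integrable (shell r s) (EFin \o cst k).
Proof.
move=> r0 rs; apply: measurable_bounded_integrable.
- exact: measurable_shell.
- exact: (eq_ind_r (fun u : \bar R => (u < +oo)%E) (ltry _) (vol3_shell r0 rs)).
- exact: measurable_cst.
- exists `|k|; split; first exact: num_real.
  by move=> M kM x _; exact: ltW.
Qed.

Lemma shell_bounds f (m M r s : R) : 0 <= r -> r <= s ->
  vol3.-integrable setT (EFin \o f) ->
  (forall x, r <= enorm x < s -> m <= f x <= M) ->
  m * (c3 * (s ^+ 3 - r ^+ 3)) <= ball_int f s - ball_int f r <= M * (c3 * (s ^+ 3 - r ^+ 3)).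
Proof.
move=> r0 rs fi fb; rewrite ball_int_shell//.
have ms := measurable_shell r s.
have fis : vol3.-integrable (shell r s) (EFin \o f) by exact: integrableS fi.
have cstE k : \int[vol3]_(x in shell r s) k = k * (c3 * (s ^+ 3 - r ^+ 3)).
  rewrite Rintegral_cst//; congr (_ * _).
  exact: (congr1 fine (vol3_shell r0 rs)).
rewrite -!cstE; apply/andP; split; apply: le_Rintegral => //.
- exact: shell_cst_integrable.
- by move=> x /shellP/fb/andP[].
- exact: shell_cst_integrable.
- by move=> x /shellP/fb/andP[].
Qed.

(** In polar coordinates this is the integral of [P'] times the area of the unit
sphere: by [shell_derivative], the integral over the ball of radius [r] and
[3 * ball_vol * P r] have the same derivative. *)
Lemma profile_integral (P D : R -> R) (p q : R) : 0 < p -> p < q ->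
  smooth P -> (forall r : R, is_derive r 1 P (D r)) ->
  (forall r, r <= p -> P r = 0 /\ D r = 0) -> (forall r, q <= r -> P r = 1 /\ D r = 0) ->
  vol3.-integrable setT (EFin \o (fun x : R3 => D (enorm x) / enorm x ^+ 2)) /\
  \int[vol3]_x (D (enorm x) / enorm x ^+ 2) = 3 * c3.
Proof.
move=> p0 pq sP dP Pp Pq.
have pP : profile P by split => //; exists p => // r /Pp[].
have [D' dD pD] := profile_derive pP.
have DE : D = D' by apply/funext => r; exact: isd_unique (dP r) (dD r).
rewrite -DE in pD; pose F r := D r / r ^+ 2.
have FE : F = fun r => D r / r / r by apply/funext => r; rewrite /F expr2 invfM mulrA.
have pF : profile F by rewrite FE; do 2 apply: profile_div.
have cF r : {for r, continuous F}.
  by have [F' dF _] := smooth_derive pF.1; exact: isd_continuous (dF r).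
pose f (x : R3) := F (enorm x).
have F0 r : q <= r -> F r = 0 by move=> /Pq[_]; rewrite /F => ->; rewrite mul0r.
have sf : supported q f.
  move=> [[x y] z] xK; apply: F0; rewrite leNgt; apply/negP => xq'; apply: xK.
  have /cubeP[h1 h2 h3] := enorm_le_cube (x, y, z).
  by apply/cubeP; split; apply: le_trans (ltW xq').
have fi : vol3.-integrable setT (EFin \o f).
  by apply: supported_integrable sf; apply: radclass_continuous; exact: rad_profile.
split; first exact: fi.
have q0 : 0 < q by exact: lt_trans pq.
pose J := ball_int f.
have dJ r : p <= r <= q -> is_derive r 1 (fun r => J r - 3 * c3 * P r) 0.
  move=> /andP[pr _]; have r0 : 0 < r by exact: lt_le_trans pr.
  have dJ : is_derive r 1 J (3 * c3 * r ^+ 2 * F r).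
    apply: shell_derivative => //; first exact: ltW (ball_vol_gt0).
    move=> s t m M s0 st mM; apply: shell_bounds => //; first exact: ltW.
    by move=> x xst; exact: mM.
  apply: isd_eq (isdB dJ (isdZ (3 * c3) (dP r))) _.
  by rewrite /F; field; rewrite gt_eqF.
have E := isd_eq_cst (ltW pq) dJ (fun _ _ => erefl).
have Jp : J p = 0.
  rewrite /J /ball_int /Rintegral integral0_eq// => x; rewrite /eball /= => xp.
  by rewrite /f /F; have [_ ->] := Pp _ (ltW xp); rewrite mul0r.
have Jq : J q = \int[vol3]_x f x.
  rewrite /J /ball_int Rintegral_mkcond; apply: eq_Rintegral => x _.
  rewrite patchE; case: ifPn => // /negP xq; rewrite /f F0// leNgt; apply/negP => xq'.
  by apply: xq; rewrite inE.
rewrite -[LHS]/(\int[vol3]_x f x) -Jq.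
move: E; rewrite /= Jp (Pp p _).1// (Pq q _).1//; lra.
Qed.
End Shell.

(** * Integrable functions and the energy *)

Section L2.
Context {R : realType}.
Local Notation R3 := (R * R * R)%type.
Local Notation M3 := (measurableTypeR R * measurableTypeR R * measurableTypeR R)%type.
Local Notation vol3 := (@vol3 R).
Implicit Types (f g u v : R3 -> R).

Definition intg f := vol3.-integrable (setT : set M3) (EFin \o f).
Definition meas f := measurable_fun (setT : set M3) f.
Definition I3 f : R := \int[vol3]_x f x.
Definition L2 f := meas f /\ intg (fun x => f x ^+ 2).

Lemma intg_meas f : intg f -> meas f.
Proof. by move=> /measurable_int/measurable_EFinP. Qed.

Lemma intgD f g : intg f -> intg g -> intg (fun x => f x + g x).
Proof. by move=> hf hg; exact: (integrableD _ hf hg). Qed.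

Lemma intgB f g : intg f -> intg g -> intg (fun x => f x - g x).
Proof. by move=> hf hg; exact: (integrableB _ hf hg). Qed.

Lemma intgZ k f : intg f -> intg (fun x => k * f x).
Proof. by move=> hf; exact: (integrableZl _ k hf). Qed.

Lemma intg_norm f : intg f -> intg (fun x => `|f x|).
Proof. by move=> hf; exact: (integrable_abse hf). Qed.

Lemma intg_le f g : meas f -> (forall x, `|f x| <= g x) -> intg g -> intg f.
Proof.
move=> mf fg hg; apply: (le_integrable _ _ _ hg) => //; first exact/measurable_EFinP.
by move=> x _ /=; rewrite lee_fin (le_trans (fg x))// ler_norm.
Qed.

Lemma I3D f g : intg f -> intg g -> I3 (fun x => f x + g x) = I3 f + I3 g.
Proof. by move=> hf hg; exact: RintegralD. Qed.

Lemma I3B f g : intg f -> intg g -> I3 (fun x => f x - g x) = I3 f - I3 g.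
Proof. by move=> hf hg; exact: RintegralB. Qed.

Lemma I3Z k f : intg f -> I3 (fun x => k * f x) = k * I3 f.
Proof. by move=> hf; exact: RintegralZl. Qed.

Lemma I3_le f g : intg f -> intg g -> (forall x, f x <= g x) -> I3 f <= I3 g.
Proof. by move=> hf hg fg; apply: le_Rintegral => // x _. Qed.

Lemma I3_ge0 f : (forall x, 0 <= f x) -> 0 <= I3 f.
Proof. by move=> f0; apply: Rintegral_ge0. Qed.

Lemma I3_EFin f : intg f -> (\int[vol3]_x (f x)%:E)%E = (I3 f)%:E.
Proof.
by move=> hf; rewrite /I3 /Rintegral fineK//; exact: (integrable_fin_num measurableT hf).
Qed.

Lemma eq_I3 f g : f =1 g -> I3 f = I3 g.
Proof. by move=> /funext ->. Qed.

Lemma intg_ext f g : f =1 g -> intg f -> intg g.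
Proof. by move=> /funext ->. Qed.

Lemma measM f g : meas f -> meas g -> meas (fun x => f x * g x).
Proof. by move=> mf mg; exact: measurable_funM. Qed.

Lemma measD f g : meas f -> meas g -> meas (fun x => f x + g x).
Proof. by move=> mf mg; exact: measurable_funD. Qed.

Lemma meas_norm f : meas f -> meas (fun x => `|f x|).
Proof. by move=> mf; exact: measurableT_comp. Qed.

Lemma meas_cst k : meas (fun=> k).
Proof. exact: measurable_cst. Qed.

Lemma L2M f g : L2 f -> L2 g -> intg (fun x => f x * g x).
Proof.
move=> [mf if2] [mg ig2]; apply: (@intg_le _ (fun x => f x ^+ 2 + g x ^+ 2)).
- exact: measM.
- move=> x; rewrite normrM -(real_normK (num_real (f x))) -(real_normK (num_real (g x))).
  by move: `|f x| `|g x| (normr_ge0 (f x)) (normr_ge0 (g x)) => a b a0 b0; nra.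
- exact: intgD.
Qed.

Lemma L2D f g : L2 f -> L2 g -> L2 (fun x => f x + g x).
Proof.
move=> hf hg; split; first exact: measD hf.1 hg.1.
apply: (@intg_ext (fun x => f x ^+ 2 + (2 * (f x * g x) + g x ^+ 2))).
  by move=> x; ring.
by apply: intgD; [exact: hf.2|apply: intgD; [apply: intgZ; exact: L2M|exact: hg.2]].
Qed.

Lemma L2Z k f : L2 f -> L2 (fun x => k * f x).
Proof.
move=> hf; split; first exact: measM (meas_cst k) hf.1.
by apply: (@intg_ext (fun x => k ^+ 2 * f x ^+ 2)) => [x|]; [ring|apply: intgZ; exact: hf.2].
Qed.

Lemma poweR2_fin (x : \bar R) (a : R) : (0 <= x)%E -> (x `^ 2 = a%:E)%E ->
  (x ^+ 2 = a%:E)%E /\ x \is a fin_num.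
Proof.
case: x => [r| |]//; last by rewrite poweRyr.
rewrite lee_fin poweR_EFin => r0 [<-]; split => //.
by rewrite powR_mulrn// expe2 -EFinM expr2.
Qed.

Lemma Lnorm2 f : intg (fun x => f x ^+ 2) ->
  ('N[vol3]_2%:E[EFin \o f] ^+ 2 = (I3 (fun x => f x ^+ 2))%:E)%E /\
  'N[vol3]_2%:E[EFin \o f]%E \is a fin_num.
Proof.
move=> if2; apply: poweR2_fin; first exact: Lnorm_ge0.
rewrite poweR_Lnorm// -I3_EFin//; apply: eq_integral => x _ /=.
by rewrite powR_mulrn// real_normK ?num_real.
Qed.

Lemma L2P f : L2 f <-> f \in Lfun vol3 2%:E.
Proof.
split => [[mf if2]|hf]; last first.
  split; last exact: (Lfun2_integrable_sqr hf).
  by have := sub_Lfun_mfun hf; rewrite inE.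
have [_ ffin] := Lnorm2 if2.
rewrite inE; apply/andP; split; first by rewrite inE; exact: mf.
rewrite inE /= /finite_norm; move: ffin; rewrite ge0_fin_numE//; exact: Lnorm_ge0.
Qed.

Lemma L1P f : intg f <-> f \in Lfun vol3 1.
Proof. by rewrite Lfun1_integrable. Qed.

Lemma Lnorm1_I3 f : intg f -> ('N[vol3]_1[EFin \o f] = (I3 (fun x => `|f x|))%:E)%E.
Proof. by move=> hf; rewrite Lnorm1 -I3_EFin//; exact: intg_norm. Qed.

Definition gsq (G : 'I_3 -> R3 -> R) (x : R3) : R := \sum_(i < 3) G i x ^+ 2.

Lemma gsq_intg (G : 'I_3 -> R3 -> R) : (forall i, L2 (G i)) -> intg (gsq G).
Proof.
move=> hG; apply: (@intg_ext (fun x => G (inord 0) x ^+ 2 + G (inord 1) x ^+ 2 + G (inord 2) x ^+ 2)).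
  by move=> x; rewrite /gsq sum3.
by apply: intgD; [apply: intgD|]; exact: (hG _).2.
Qed.

Lemma energyE (beta : R) u (G : 'I_3 -> R3 -> R) : intg u -> (forall i, L2 (G i)) ->
  energy beta u G = (2^-1 * I3 (gsq G) + beta * I3 (fun x => `|u x|))%:E.
Proof.
move=> hu hG.
have gE : (fun x => grad_norm G x ^+ 2) = gsq G.
  by apply/funext => x; rewrite /grad_norm sqr_sqrtr// sumr_ge0// => i _; exact: sqr_ge0.
have ig : intg (fun x => grad_norm G x ^+ 2) by rewrite gE; exact: gsq_intg.
have [E _] := Lnorm2 ig.
rewrite EFinD !EFinM -gE -E -Lnorm1_I3//.
Qed.

Lemma norm1_L2 u : L2 u -> ('N[vol3]_2%:E[EFin \o u] = 1)%E <-> I3 (fun x => u x ^+ 2) = 1.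
Proof.
move=> [_ iu]; have [E ffin] := Lnorm2 iu.
have := Lnorm_ge0 vol3 2%:E (EFin \o u).
move: E ffin; case: ('N[vol3]_2%:E[EFin \o u])%E => // r E _; rewrite lee_fin => r0.
move: E; rewrite expe2 -EFinM => -[E]; split => [[r1]|I1].
  by rewrite -E r1 mulr1.
by congr EFin; apply/eqP; rewrite -(@eqrXn2 _ 2)// expr2 E I1 expr1n.
Qed.

End L2.

(** * Test functions *)

Section TestFunctions.
Context {R : realType}.
Local Notation R3 := (R * R * R)%type.
Implicit Types (f g : R3 -> R).

Lemma test_partial f i : test_function f -> test_function (partial i f).
Proof.
move=> [Cf cf]; split; first by move=> k; exact: (((Cf k.+1).2 i).2).
apply: subclosed_compact cf _; first exact: closed_closure.
rewrite [X in _ `<=` X](iffLR (closure_id _)); last exact: closed_closure.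
apply: closure_subset => x /= dfx; apply: contrapT => xcl.
move: dfx; rewrite (_ : partial i f x = 0) ?eqxx//.
rewrite /partial (@near_eq_derive _ _ _ f (cst 0)); first exact: derive_cst.
apply: (@filterS _ _ _ (~` closure [set x | f x != 0])).
  move=> y /= ycl; apply: contrapT => /eqP fy; apply: ycl; exact: subset_closure.
apply: open_nbhs_nbhs; split => //; apply: closed_openC; exact: closed_closure.
Qed.

Lemma test_supported f : test_function f -> exists K, supported K f.
Proof.
move=> [_ /compact_bounded[K [_ KP]]]; exists (`|K| + 1) => x xK.
apply: contrapT => /eqP fx; apply: xK.
have /= h : `|x| <= `|K| + 1.
  apply: KP; last exact: subset_closure.
  by rewrite (le_lt_trans (ler_norm _))// ltrDl.
case: x h {fx} => -[x y] z; rewrite !prod_normE /= !ge_max => /andP[/andP[? ?] ?].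
exact/cubeP.
Qed.

Lemma test_continuous f : test_function f -> continuous f.
Proof. by move=> [Cf _] x; have [cf _] := Cf 0%N; exact: cf. Qed.

Lemma test_derivable f i x : test_function f -> derivable f x (basis i).
Proof. by move=> [Cf _]; have [_ /(_ i)[df _]] := Cf 1%N; exact: df. Qed.

Lemma test_intg f : test_function f -> intg f.
Proof.
move=> tf; have [K sf] := test_supported tf.
exact: supported_integrable (test_continuous tf) sf.
Qed.

Lemma test_L2 f : test_function f -> L2 f.
Proof.
move=> tf; have [K sf] := test_supported tf; have cf := test_continuous tf; split.
  exact: continuous_measurable3.
apply: (@supported_integrable _ K).
  by move=> x; apply: cvgM; exact: cf.
by move=> x /sf ->; rewrite expr0n.
Qed.

(** The partial derivatives of the compactly supported product have integral 0. *)
Lemma test_parts f g i : test_function f -> test_function g ->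
  I3 (fun x => f x * partial i g x) = - I3 (fun x => partial i f x * g x).
Proof.
move=> tf tg; have [K sf] := test_supported tf.
have d x : is_derive x (basis i) (fun x => f x * g x) (partial i f x * g x + f x * partial i g x).
  have df := derivableP (@test_derivable f i x tf).
  have dg := derivableP (@test_derivable g i x tg).
  apply: (is_derive_eq (is_deriveM df dg)); rewrite addrC; congr (_ + _).
  by rewrite -[LHS]/(_ * _) mulrC.
have pE : partial i (fun x => f x * g x) = fun x => partial i f x * g x + f x * partial i g x.
  by apply/funext => x; apply: derive_val.
have := @integral_partial0 _ (fun x => f x * g x) K i.
rewrite pE => /(_ _ _ _) h.
have i1 : intg (fun x => partial i f x * g x).
  by apply: L2M; apply: test_L2 => //; exact: test_partial.
have i2 : intg (fun x => f x * partial i g x).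
  by apply: L2M; apply: test_L2 => //; exact: test_partial.
apply/eqP; rewrite -addr_eq0 addrC -I3D//; apply/eqP.
rewrite /I3 /Rintegral h//.
- by move=> x /sf ->; rewrite mul0r.
- have cf := test_continuous tf; have cg := test_continuous tg.
  have cpf := test_continuous (test_partial i tf).
  have cpg := test_continuous (test_partial i tg).
  by move=> x; apply: cvgD; apply: cvgM; [exact: cpf|exact: cg|exact: cf|exact: cpg].
Qed.

End TestFunctions.

(** * The Euler-Lagrange inequality *)

Section Variation.
Context {R : realType}.
Local Notation R3 := (R * R * R)%type.
Local Notation M3 := (measurableTypeR R * measurableTypeR R * measurableTypeR R)%type.
Local Notation vol3 := (@vol3 R).
Variables (beta : R) (phi : R3 -> R) (G : 'I_3 -> R3 -> R).
Hypothesis beta_gt0 : 0 < beta.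
Hypothesis adm : admissible phi G.
Hypothesis phi_min : forall v H, admissible v H -> (energy beta phi G <= energy beta v H)%E.

Lemma phi_L2 : L2 phi. Proof. by case: adm => -[/L2P]. Qed.
Lemma phi_intg : intg phi. Proof. by case: adm => _ /L1P. Qed.
Lemma G_L2 i : L2 (G i). Proof. by case: adm => -[_ /(_ i)/L2P]. Qed.
Lemma phi_weak : weak_gradient phi G. Proof. by case: adm => -[]. Qed.
Lemma phi_norm : I3 (fun x => phi x ^+ 2) = 1.
Proof. by case: adm => _ _ h; apply/norm1_L2; [exact: phi_L2|exact: h]. Qed.

Lemma I3D3 (f0 f1 f2 : R3 -> R) : intg f0 -> intg f1 -> intg f2 ->
  I3 (fun x => f0 x + f1 x + f2 x) = I3 f0 + I3 f1 + I3 f2.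
Proof.
move=> i0 i1 i2; rewrite (I3D (f := fun x => f0 x + f1 x)) ?(I3D i0 i1)//.
exact: intgD.
Qed.

Section Competitor.
Variables (psi : R3 -> R) (e : R).
Hypothesis tpsi : test_function psi.

Let v x := phi x + e * psi x.
Let H i x := G i x + e * partial i psi x.

Lemma v_L2 : L2 v.
Proof. by apply: L2D; [exact: phi_L2|apply: L2Z; exact: test_L2]. Qed.

Lemma v_intg : intg v.
Proof. by apply: intgD; [exact: phi_intg|apply: intgZ; exact: test_intg]. Qed.

Lemma H_L2 i : L2 (H i).
Proof.
by apply: L2D; [exact: G_L2|apply: L2Z; apply: test_L2; exact: test_partial].
Qed.

Lemma v_weak : weak_gradient v H.
Proof.
move=> f tf i; have tpf := test_partial i tf; have tppsi := test_partial i tpsi.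
have i1 : intg (fun x => phi x * partial i f x) by apply: L2M; [exact: phi_L2|exact: test_L2].
have i2 : intg (fun x => psi x * partial i f x) by apply: L2M; exact: test_L2.
have i3 : intg (fun x => G i x * f x) by apply: L2M; [exact: G_L2|exact: test_L2].
have i4 : intg (fun x => partial i psi x * f x) by apply: L2M; exact: test_L2.
rewrite -[LHS]/(I3 (fun x => v x * partial i f x)) -[X in - X]/(I3 (fun x => H i x * f x)).
rewrite (@eq_I3 _ _ (fun x => phi x * partial i f x + e * (psi x * partial i f x))); last first.
  by move=> x; rewrite /v; ring.
rewrite (@eq_I3 _ (fun x => H i x * f x) (fun x => G i x * f x + e * (partial i psi x * f x))); last first.
  by move=> x; rewrite /H; ring.
rewrite !I3D ?I3Z//; try exact: intgZ.
have E1 : I3 (fun x => phi x * partial i f x) = - I3 (fun x => G i x * f x) := phi_weak tf i.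
rewrite E1 (test_parts i tpsi tf); ring.
Qed.

Lemma scaled_weak u (K : 'I_3 -> R3 -> R) (k : R) : L2 u -> (forall i, L2 (K i)) ->
  weak_gradient u K -> weak_gradient (fun x => k * u x) (fun i x => k * K i x).
Proof.
move=> hu hK wu f tf i; have tpf := test_partial i tf.
rewrite -[LHS]/(I3 (fun x => k * u x * partial i f x)) -[X in - X]/(I3 (fun x => k * K i x * f x)).
rewrite (@eq_I3 _ _ (fun x => k * (u x * partial i f x))); last by move=> x; ring.
rewrite (@eq_I3 _ (fun x => k * K i x * f x) (fun x => k * (K i x * f x))); last by move=> x; ring.
rewrite !I3Z; last 2 first.
- by apply: L2M => //; exact: test_L2.
- by apply: L2M => //; exact: test_L2.
have E1 : I3 (fun x => u x * partial i f x) = - I3 (fun x => K i x * f x) := wu f tf i.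
by rewrite E1 mulrN.
Qed.

Let n2 := I3 (fun x => v x ^+ 2).

(** Minimality tested on [v] divided by its norm [N], with [n2 = N ^+ 2]. The
bound [N <= (1 + N ^+ 2) / 2] makes the right-hand side polynomial in [e]
apart from the [L^1] norm of [v], and it costs nothing at first order because
[N = 1] at [e = 0]. *)
Lemma energy_ineq : 0 < n2 ->
  (2^-1 * I3 (gsq G) + beta * I3 (fun x => `|phi x|)) * n2 <=
  2^-1 * I3 (gsq H) + beta * ((1 + n2) / 2) * I3 (fun x => `|v x|).
Proof.
move=> n20.
pose k := (Num.sqrt n2)^-1.
have N0 : 0 < Num.sqrt n2 by rewrite sqrtr_gt0.
have k0 : 0 < k by rewrite invr_gt0.
have kn : k ^+ 2 * n2 = 1 by rewrite /k exprVn sqr_sqrtr ?ltW// mulVf// gt_eqF.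
have kL2 : L2 (fun x => k * v x) by apply: L2Z; exact: v_L2.
have kHL2 i : L2 (fun x => k * H i x) by apply: L2Z; exact: H_L2.
have ki : intg (fun x => k * v x) by apply: intgZ; exact: v_intg.
have adm' : admissible (fun x => k * v x) (fun i x => k * H i x).
  split; [split|exact/L1P|].
  - exact/L2P.
  - by move=> i; apply/L2P.
  - apply: scaled_weak; [exact: v_L2|exact: H_L2|exact: v_weak].
  - apply/norm1_L2 => //.
    rewrite (@eq_I3 _ _ (fun x => k ^+ 2 * v x ^+ 2)) => [|x]; last by ring.
    by rewrite I3Z//; exact: v_L2.2.
have := phi_min adm'.
rewrite (energyE _ phi_intg G_L2) (energyE _ ki kHL2) lee_fin.
have -> : I3 (gsq (fun i x => k * H i x)) = k ^+ 2 * I3 (gsq H).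
  rewrite -I3Z; last exact: gsq_intg H_L2.
  apply: eq_I3 => x; rewrite /gsq mulr_sumr; apply: eq_bigr => i _; ring.
have -> : I3 (fun x => `|k * v x|) = k * I3 (fun x => `|v x|).
  rewrite -I3Z; last exact: intg_norm v_intg.
  by apply: eq_I3 => x; rewrite normrM (gtr0_norm k0).
set E0 := _ + _; set X := I3 (gsq H); set Y := I3 _ => le.
have Y0 : 0 <= Y by apply: I3_ge0.
have kN : k * n2 = Num.sqrt n2.
  by rewrite /k -[X in _ * X](sqr_sqrtr (ltW n20)) expr2 mulrA mulVf ?mul1r// gt_eqF.
apply: (@le_trans _ _ ((2^-1 * (k ^+ 2 * X) + beta * (k * Y)) * n2)).
  by rewrite ler_wpM2r// ltW.
have -> : (2^-1 * (k ^+ 2 * X) + beta * (k * Y)) * n2 =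
    2^-1 * (k ^+ 2 * n2) * X + beta * (k * n2) * Y by ring.
rewrite kn kN mulr1 lerD2l ler_wpM2r// ler_wpM2l ?(ltW beta_gt0)//.
rewrite -[in leRHS](sqr_sqrtr (ltW n20)).
by move: (Num.sqrt n2) => N; have := sqr_ge0 (N - 1); rewrite sqrrB1; lra.
Qed.

Let s := I3 (fun x => phi x * psi x).
Let q := I3 (fun x => psi x ^+ 2).

Lemma n2E : n2 = 1 + 2 * e * s + e ^+ 2 * q.
Proof.
have i1 := phi_L2.2; have i2 := (test_L2 tpsi).2.
have i3 : intg (fun x => phi x * psi x) by apply: L2M; [exact: phi_L2|exact: test_L2].
transitivity (I3 (fun x => phi x ^+ 2) + 2 * e * s + e ^+ 2 * q); last by rewrite phi_norm.
rewrite /n2 /s /q.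
rewrite (@eq_I3 _ _ (fun x => phi x ^+ 2 + (2 * e) * (phi x * psi x) + e ^+ 2 * psi x ^+ 2)).
  have iz k (f : R3 -> R) : intg f -> intg (fun x => k * f x) by exact: intgZ.
  rewrite I3D; [|by apply: intgD => //; exact: iz|exact: iz].
  by rewrite I3D ?I3Z//; exact: iz.
by move=> x; rewrite /v; ring.
Qed.

(** The weak gradient turns the cross term into [phi * laplacian psi], so [G] no
longer occurs at first order. *)
Lemma gsqE : I3 (gsq H) = I3 (gsq G) + 2 * e * (- I3 (fun x => phi x * laplacian psi x)) +
  e ^+ 2 * I3 (gsq (fun i => partial i psi)).
Proof.
have tp i := test_partial i tpsi.
have ig i : intg (fun x => G i x * partial i psi x).
  by apply: L2M; [exact: G_L2|exact: test_L2].
have ip i : intg (fun x => phi x * partial i (partial i psi) x).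
  by apply: L2M; [exact: phi_L2|apply: test_L2; exact: test_partial].
pose cr x := G (inord 0) x * partial (inord 0) psi x + G (inord 1) x * partial (inord 1) psi x +
  G (inord 2) x * partial (inord 2) psi x.
have icr : intg cr by apply: intgD => //; exact: intgD.
have gG := gsq_intg G_L2; have gp : intg (gsq (fun i => partial i psi)).
  by apply: gsq_intg => i; exact: test_L2.
have -> : - I3 (fun x => phi x * laplacian psi x) = I3 cr.
  rewrite (@eq_I3 _ _ (fun x => phi x * partial (inord 0) (partial (inord 0) psi) x +
    phi x * partial (inord 1) (partial (inord 1) psi) x +
    phi x * partial (inord 2) (partial (inord 2) psi) x)); last first.
    by move=> x; rewrite /laplacian sum3 !mulrDr.
  rewrite (I3D3 (ip _) (ip _) (ip _)) /cr (I3D3 (ig _) (ig _) (ig _)).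
  have w i : I3 (fun x => phi x * partial i (partial i psi) x) =
      - I3 (fun x => G i x * partial i psi x) := phi_weak (tp i) i.
  rewrite -[RHS]opprK; congr (- _); rewrite 2!opprD; congr (_ + _ + _); exact: w.
rewrite (@eq_I3 _ _ (fun x => gsq G x + (2 * e) * cr x + e ^+ 2 * gsq (fun i => partial i psi) x)).
  have iz k (f : R3 -> R) : intg f -> intg (fun x => k * f x) by exact: intgZ.
  rewrite I3D; [|by apply: intgD => //; exact: iz|exact: iz].
  by rewrite I3D ?I3Z//; exact: iz.
move=> x; rewrite /gsq !sum3 /H /cr.
move: (G (inord 0) x) (G (inord 1) x) (G (inord 2) x) => a0 a1 a2.
move: (partial (inord 0) psi x) (partial (inord 1) psi x) (partial (inord 2) psi x).
by move=> b0 b1 b2; ring.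
Qed.

End Competitor.

Hypothesis phi_ge0 : forall x, 0 <= phi x.

(** The value of the multiplier is found by testing the Euler-Lagrange equation
with [phi] itself. *)
Definition lagrange := I3 (gsq G) + beta * I3 phi.

(** Integral 0 would make [phi] vanish almost everywhere, against
[phi_norm]. *)
Lemma I3_phi_gt0 : 0 < I3 phi.
Proof.
rewrite lt_def I3_ge0// andbT; apply/eqP => I0.
have : {ae vol3, forall x, setT x -> (EFin \o phi) x = 0%E}.
  apply/(ae_eq_integral_abs vol3 measurableT); first exact: measurable_int phi_intg.
  rewrite -[RHS]/(0%:E) -I0 -(I3_EFin phi_intg); apply: eq_integral => x _ /=.
  by rewrite ger0_norm.
move=> phi0; have : (\int[vol3]_x (phi x ^+ 2)%:E)%E = (\int[vol3]_x (cst 0%E x))%E.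
  apply: ae_eq_integral => //.
    by apply/measurable_EFinP; exact: intg_meas phi_L2.2.
  apply: (@filterS _ _ (ae_filter_ringOfSetsType vol3) _ _ _ phi0) => x /= /(_ I)[->] _.
  by rewrite expr0n.
rewrite integral0 (I3_EFin phi_L2.2) phi_norm => -[] /eqP.
by rewrite oner_eq0.
Qed.

Lemma lagrange_gt0 : 0 < lagrange.
Proof.
apply: ltr_wpDl; last by rewrite mulr_gt0// I3_phi_gt0.
by apply: I3_ge0 => x; apply: sumr_ge0 => i _; exact: sqr_ge0.
Qed.

Definition zero_set : set M3 := [set x | phi x = 0].

Lemma measurable_zero_set : measurable zero_set.
Proof.
rewrite (_ : zero_set = phi @^-1` [set 0]) //.
rewrite -[X in measurable X]setTI; apply: (intg_meas phi_intg) => //.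
Qed.

Lemma meas_indic (A : set M3) : measurable A -> meas (fun x => \1_A x : R).
Proof. by move=> mA; exact: measurable_indic. Qed.

Lemma indic01 (A : set M3) x : 0 <= (\1_A x : R) <= 1.
Proof. by rewrite indicE; case: (_ \in _); rewrite ?lexx ?ler01. Qed.

Lemma intgM_indic (f : R3 -> R) (A : set M3) : measurable A -> intg f ->
  intg (fun x => f x * \1_A x).
Proof.
move=> mA fi; apply: (@intg_le _ _ (fun x => `|f x|)); last exact: intg_norm.
  by apply: measM; [exact: intg_meas|exact: meas_indic].
move=> x; have /andP[i0 i1] := indic01 A x.
by rewrite normrM (ger0_norm i0) ler_piMr.
Qed.

Section Limit.
Variable psi : R3 -> R.
Hypothesis tpsi : test_function psi.

Let Zi x : R := \1_zero_set x.
Let small n : set M3 := [set x | phi x < n.+1%:R^-1 * `|psi x|] `&` ~` zero_set.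
Let delta n := I3 (fun x => `|psi x| * \1_(small n) x).

Lemma measurable_small n : measurable (small n).
Proof.
apply: measurableI; last exact: measurableC measurable_zero_set.
have mp : meas psi by exact: (test_L2 tpsi).1.
have m1 : measurable_fun setT (fun x : M3 => phi x < n.+1%:R^-1 * `|psi x|).
  apply: measurable_fun_ltr; first exact: intg_meas phi_intg.
  by apply: measM; [exact: meas_cst|exact: meas_norm].
have := m1 measurableT [set true] I; rewrite setTI.
by congr measurable; apply/seteqP; split => x.
Qed.

(** [small n] is the part of the positivity set where a perturbation of size
[psi / (n + 1)] may change the sign of [phi]; these sets shrink to the empty
set, and dominated convergence applies. *)
Lemma delta_cvg : delta n @[n --> \oo] --> (0 : R).
Proof.
have ip : intg (fun x => `|psi x|) by apply: intg_norm; exact: test_intg.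
have mi n : meas (fun x => `|psi x| * \1_(small n) x).
  by apply: measM; [exact: intg_meas ip|apply: meas_indic; exact: measurable_small].
have b01 n x : `| `|psi x| * (\1_(small n) x : R)| <= `|psi x|.
  have /andP[i0 i1] := indic01 (small n) x.
  by rewrite normrM normr_id (ger0_norm i0) ler_piMr.
have h : (\int[vol3]_x (`|psi x| * \1_(small n) x)%:E)%E @[n --> \oo] --> (\int[vol3]_x 0%:E)%E.
  apply: (@dominated_cvg _ _ _ vol3 setT measurableT _ _ (EFin \o (fun x => `|psi x|))) => //.
  - by move=> n; apply/measurable_EFinP; exact: mi.
  - move=> x _; apply: cvg_near_cst; case: (pselect (zero_set x)) => [xz|xz].
      near=> n; rewrite indicE memNset ?mulr0// => -[_]; exact.
    have x0 : 0 < phi x by rewrite lt_def phi_ge0 andbT; exact/eqP.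
    near=> n; rewrite indicE memNset ?mulr0// => -[/= + _].
    rewrite ltNge => /negP; apply.
    have C1 : 0 < `|psi x| + 1 by rewrite ltr_wpDl.
    have nn : n.+1%:R^-1 < phi x / (`|psi x| + 1).
      near: n.
      have pos : 0 < phi x / (`|psi x| + 1) by rewrite divr_gt0.
      exact: near_infty_natSinv_lt (PosNum pos).
    rewrite ltr_pdivlMr// mulrDr mulr1 in nn; apply/ltW; apply: le_lt_trans nn.
    by rewrite lerDl invr_ge0.
  - by move=> n x _; rewrite /= lee_fin.
move: h; rewrite integral0 => /fine_cvgP[_] /=; apply: cvg_trans.
by apply: near_eq_cvg; near=> n.
Unshelve. all: by end_near. Qed.

Let s := I3 (fun x => phi x * psi x).
Let q := I3 (fun x => psi x ^+ 2).
Let a := I3 phi.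
Let p1 := - I3 (fun x => phi x * laplacian psi x).
Let p2 := I3 (gsq (fun i => partial i psi)).
Let l1 := I3 (fun x => psi x * (1 - Zi x)).
Let l0 := I3 (fun x => `|psi x| * Zi x).

Let ipsi : intg psi. Proof. exact: test_intg. Qed.
Let inpsi : intg (fun x => `|psi x|). Proof. exact: intg_norm. Qed.
Let il0 : intg (fun x => `|psi x| * Zi x).
Proof. by apply: intgM_indic => //; exact: measurable_zero_set. Qed.
Let il1 : intg (fun x => psi x * (1 - Zi x)).
Proof.
apply: (@intg_ext _ (fun x => psi x - psi x * Zi x)) => [x|]; first by ring.
by apply: intgB => //; apply: intgM_indic => //; exact: measurable_zero_set.
Qed.
Let idelta n : intg (fun x => `|psi x| * \1_(small n) x).
Proof. by apply: intgM_indic => //; exact: measurable_small. Qed.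

(** On the zero set the perturbed function has absolute value [h * |psi|], off
[small n] it keeps its sign and is linear in the perturbation, and on
[small n] linearity fails by at most [2 * h * |psi|]. *)
Lemma L1_upper (sg : R) n : `|sg| = 1 ->
  I3 (fun x => `|phi x + sg * n.+1%:R^-1 * psi x|) <=
  a + sg * n.+1%:R^-1 * l1 + n.+1%:R^-1 * l0 + 2 * n.+1%:R^-1 * delta n.
Proof.
move=> sg1; set h := n.+1%:R^-1; have h0 : 0 < h by rewrite invr_gt0.
have iz k (f : R3 -> R) : intg f -> intg (fun x => k * f x) by exact: intgZ.
have i1 := iz (sg * h) _ il1; have i2 := iz h _ il0; have i3 := iz (2 * h) _ (idelta n).
have i12 := intgD (intgD phi_intg i1) i2.
apply: (@le_trans _ _ (I3 (fun x => phi x + sg * h * (psi x * (1 - Zi x)) +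
    h * (`|psi x| * Zi x) + 2 * h * (`|psi x| * \1_(small n) x)))); last first.
  by rewrite (I3D i12 i3) (I3D (intgD phi_intg i1) i2) (I3D phi_intg i1) !I3Z.
apply: I3_le; [|exact: intgD|].
  by apply: intg_norm; apply: intgD; [exact: phi_intg|exact: intgZ].
move=> x; have p0 := phi_ge0 x.
have hp : `|sg * h * psi x| = h * `|psi x| by rewrite !normrM sg1 mul1r (gtr0_norm h0).
case: (pselect (zero_set x)) => [xz|xz].
  rewrite /Zi !indicE (mem_set xz) memNset; last by case.
  rewrite (xz : phi x = 0) subrr !mulr0 !add0r mulr1 !addr0 hp//.
have xs : (0 : R) <= \1_(small n) x by case/andP: (indic01 (small n) x).
rewrite /Zi !indicE (memNset xz) subr0 !mulr0 mulr1 addr0.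
case: (pselect (small n x)) => [xm|xm].
  rewrite (mem_set xm) mulr1 -(mulrA 2 h) -hp ler_norml.
  by move: (ler_norm (sg * h * psi x)) (ler_norm (- (sg * h * psi x))); rewrite normrN; lra.
rewrite (memNset xm) !mulr0 addr0 ger0_norm//.
have : h * `|psi x| <= phi x.
  rewrite leNgt; apply/negP => lt; apply: xm; split => //.
rewrite -hp; move: (ler_norm (- (sg * h * psi x))); rewrite normrN; lra.
Qed.

(** Put [e = sg / (n + 1)] in [energy_ineq], divide by [1 / (n + 1)] and let [n]
grow. *)
Lemma sign_ineq (sg : R) : `|sg| = 1 -> - (sg * (p1 + beta * l1 - lagrange * s)) <= beta * l0.
Proof.
move=> sg1; have sg2 : sg ^+ 2 = 1 by rewrite -real_normK ?num_real// sg1 expr1n.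
have l00 : 0 <= l0 by apply: I3_ge0 => x; rewrite mulr_ge0//; case/andP: (indic01 zero_set x).
have q0 : 0 <= q by apply: I3_ge0 => x; exact: sqr_ge0.
have a0 : 0 <= a by apply: I3_ge0.
pose D := I3 (fun x => `|psi x|).
have dD n : 0 <= delta n <= D.
  apply/andP; split.
    by apply: I3_ge0 => x; rewrite mulr_ge0//; case/andP: (indic01 (small n) x).
  by apply: I3_le => // x; have /andP[? ?] := indic01 (small n) x; rewrite ler_piMr.
have phiE : I3 (fun x => `|phi x|) = a by apply: eq_I3 => x; rewrite ger0_norm.
(* C bounds the terms of second order in 1 / (n + 1). *)
pose C := `|2^-1 * p2 + 2^-1 * beta * a * q - (2^-1 * I3 (gsq G) + beta * a) * q| +
  beta * (`|l1| + l0 + 2 * D) * (`|s| + q).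
have step : \forall n \near \oo,
    - (sg * (p1 + beta * l1 - lagrange * s)) <= beta * l0 + 2 * beta * delta n + n.+1%:R^-1 * C.
  near=> n.
  have hs : n.+1%:R^-1 < 2^-1 / (`|s| + 1).
    near: n.
    have pos : 0 < 2^-1 / (`|s| + 1) by rewrite divr_gt0// ltr_wpDl.
    exact: near_infty_natSinv_lt (PosNum pos).
  set h : R := n.+1%:R^-1 in hs *.
  have h0 : 0 < h by rewrite invr_gt0.
  have h1 : h <= 1 by rewrite invf_le1// ler1n.
  have nE := n2E (sg * h) tpsi; rewrite -/s -/q in nE.
  have npos : 0 < I3 (fun x => (phi x + sg * h * psi x) ^+ 2).
    rewrite nE.
    rewrite ltr_pdivlMr ?ltr_wpDl// in hs.
    have : `|sg * h * s| <= h * `|s| by rewrite !normrM sg1 mul1r (gtr0_norm h0).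
    rewrite ler_norml => /andP[hs1 hs2].
    have : 0 <= (sg * h) ^+ 2 * q by rewrite mulr_ge0// sqr_ge0.
    nra.
  have := energy_ineq tpsi npos; rewrite nE gsqE// -/p1 -/p2 phiE exprMn sg2 mul1r.
  have Lu := L1_upper n sg1; rewrite -/h in Lu.
  rewrite nE exprMn sg2 mul1r in npos.
  set Y := I3 (fun x => `|_|) in Lu *; set g := I3 (gsq G).
  have /andP[d0 d1] := dD n; move: (delta n) d0 d1 Lu => d d0 d1 Lu ineq.
  set W := (1 + (1 + 2 * (sg * h) * s + h ^+ 2 * q)) / 2 in ineq.
  have W0 : 0 <= W by rewrite /W; lra.
  have WY := ler_wpM2l W0 Lu.
  pose T := (sg * l1 + l0 + 2 * d) * (sg * s + 2^-1 * h * q).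
  pose K := 2^-1 * p2 + 2^-1 * beta * a * q - (2^-1 * g + beta * a) * q.
  have TC : T <= (`|l1| + l0 + 2 * D) * (`|s| + q).
    apply: (le_trans (ler_norm _)); rewrite /T normrM; apply: ler_pM => //.
      apply: (le_trans (ler_normD _ _)); apply: lerD; last by rewrite ger0_norm; lra.
      by apply: (le_trans (ler_normD _ _)); rewrite normrM sg1 mul1r (ger0_norm l00).
    apply: (le_trans (ler_normD _ _)); rewrite normrM sg1 mul1r lerD2l.
    rewrite ger0_norm; last by rewrite !mulr_ge0// ltW.
    rewrite -[leRHS]mul1r ler_wpM2r//.
    by rewrite -[leRHS](mulVf (x := 2)) ?pnatr_eq0// ler_wpM2l; lra.
  have KC : K + beta * T <= C.
    apply: lerD; first exact: ler_norm.
    by rewrite -mulrA ler_wpM2l// ltW.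
  have key : 0 <= h * (sg * (p1 + beta * l1 - lagrange * s) + beta * l0 + 2 * beta * d + h * (K + beta * T)).
    have bWY : beta * (W * Y) <= beta * (W * (a + sg * h * l1 + h * l0 + 2 * h * d)).
      by rewrite ler_wpM2l// ltW.
    have -> : h * (sg * (p1 + beta * l1 - lagrange * s) + beta * l0 + 2 * beta * d + h * (K + beta * T)) =
       2^-1 * (g + 2 * (sg * h) * p1 + h ^+ 2 * p2) + beta * (W * (a + sg * h * l1 + h * l0 + 2 * h * d)) -
       (2^-1 * g + beta * a) * (1 + 2 * (sg * h) * s + h ^+ 2 * q).
      by rewrite /T /K /W /lagrange -/g -/a; field.
    by rewrite subr_ge0; apply: (le_trans ineq); rewrite lerD2l -mulrA.
  rewrite pmulr_rge0// in key.
  have : h * (K + beta * T) <= h * C by rewrite ler_wpM2l// ltW.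
  move: key; lra.
have lim : beta * l0 + 2 * beta * delta n + n.+1%:R^-1 * C @[n --> \oo] --> beta * l0 + 2 * beta * 0 + 0 * C.
  apply: cvgD; first by apply: cvgD; [exact: cvg_cst|apply: cvgM; [exact: cvg_cst|exact: delta_cvg]].
  by apply: cvgM; [exact: cvg_harmonic|exact: cvg_cst].
rewrite mulr0 mul0r !addr0 in lim.
exact: (ler_cvg_to (cvg_cst _) lim step).
Unshelve. all: by end_near. Qed.

(** Variations of both signs give two inequalities, which differ by the one-sided
slopes of the absolute value on the zero set of [phi]. *)
Lemma euler_lagrange :
  `|I3 (fun x => phi x * laplacian psi x) + lagrange * s - beta * l1| <= beta * l0.
Proof.
have h1 := sign_ineq (normr1 R); have h2 := sign_ineq (etrans (normrN 1) (normr1 R)).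
rewrite ler_norml; move: h1 h2; rewrite /p1; lra.
Qed.

End Limit.

End Variation.

(** * The radial profile *)

Section Rearrangement.
Context {R : realType}.
Local Notation R3 := (R * R * R)%type.
Local Notation M3 := (measurableTypeR R * measurableTypeR R * measurableTypeR R)%type.
Local Notation vol3 := (@vol3 R).
Variable phi : R3 -> R.
Hypothesis phi_symm : forall x, phi x = symm_rearr phi x.
Hypothesis phi_intg : intg phi.

Definition superlevel (t : R) : set M3 := [set y | t < `|phi y|].

(** The layer-cake formula makes [phi x] the length of [levels (enorm x)]; see
[phiE]. *)
Definition levels (r : R) : set R :=
  [set t | 0 < t /\ (vol3 (eball r) < vol3 (superlevel t))%E].

Lemma measurable_superlevel t : measurable (superlevel t).
Proof.
have m1 : measurable_fun setT (fun x : M3 => t < `|phi x|).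
  apply: measurable_fun_ltr; first exact: measurable_cst.
  by apply: meas_norm; exact: intg_meas phi_intg.
have := m1 measurableT [set true] I; rewrite setTI.
by congr measurable; apply/seteqP; split => x.
Qed.

Lemma superlevelS s t : s <= t -> superlevel t `<=` superlevel s.
Proof. by move=> st x /=; exact: le_lt_trans. Qed.

Lemma levels_down r s t : 0 < s -> s <= t -> levels r t -> levels r s.
Proof.
move=> s0 st [_ ht]; split => //; apply: (lt_le_trans ht).
apply: le_measure; rewrite ?inE; try exact: measurable_superlevel.
exact: superlevelS.
Qed.

(** The condition on [t] is monotone, so this is an interval. *)
Lemma measurable_levels r : measurable (levels r).
Proof.
apply: is_interval_measurable => s t hs ht u /andP[su ut].
by apply: levels_down ht => //; apply: lt_le_trans su; case: hs.
Qed.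

Lemma levelsS r s : r <= s -> levels s `<=` levels r.
Proof.
move=> rs t [t0 ht]; split => //; apply: le_lt_trans ht.
apply: le_measure; rewrite ?inE; try exact: measurable_eball.
by move=> x; rewrite /eball /= => /lt_le_trans; apply.
Qed.

Lemma phiE x : phi x = fine (lebesgue_measure (levels (enorm x))).
Proof.
rewrite phi_symm /symm_rearr /Rintegral; congr fine.
have E := integral_indic lebesgue_measure measurableT (measurable_levels (enorm x)).
rewrite integral_mkcond; transitivity (\int[lebesgue_measure]_t (\1_(levels (enorm x)) t)%:E)%E.
  apply: eq_integral => t _; rewrite patchE.
  case: ifPn => [|/negP tn].
    rewrite inE/= in_itv/= andbT => t0; rewrite !indicE; congr (_%:R%:E).
    have [h|h] := pselect (levels (enorm x) t); first by rewrite !mem_set//; case: h.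
    by rewrite !memNset// => h'; apply: h.
  rewrite indicE memNset// => -[t0 _]; apply: tn.
  by rewrite inE/= in_itv/= t0.
by rewrite E setIT.
Qed.

Lemma phi_ge0 x : 0 <= phi x.
Proof. by rewrite phiE fine_ge0. Qed.

(** Markov's inequality bounds [t] on [levels r]. Finiteness is needed for
monotonicity, because an infinite length is turned into the value 0. *)
Lemma levels_fin r : 0 < r -> (lebesgue_measure (levels r) < +oo)%E.
Proof.
move=> r0; have c0 : 0 < (@ball_vol R) * r ^+ 3 by rewrite mulr_gt0 ?ball_vol_gt0 ?exprn_gt0.
pose T := I3 (fun x => `|phi x|) / (@ball_vol R * r ^+ 3).
have sub : levels r `<=` `]0, T]%classic.
  move=> t [t0 ht]; rewrite /= in_itv/= t0 /= /T ler_pdivlMr//.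
  have h : (t%:E * vol3 (superlevel t) <= (I3 (fun x => `|phi x|))%:E)%E.
    rewrite -I3_EFin; last exact: intg_norm.
    have mphi := measurable_int vol3 phi_intg.
    have := @le_integral_comp_abse _ _ _ vol3 setT measurableT (EFin \o phi) t id
      (@measurable_id _ _ setT) (fun _ h => h) (fun _ _ _ _ h => h) mphi t0.
    apply: le_trans; rewrite lee_pmul2l ?lte_fin//; apply: le_measure.
    - by rewrite inE; exact: measurable_superlevel.
    - rewrite inE; apply: emeasurable_fun_c_infty => //; exact: measurableT_comp.
    - by move=> x /= tx; split => //; rewrite /= lee_fin ltW.
  have : (t%:E * vol3 (eball r) <= (I3 (fun x => `|phi x|))%:E)%E.
    by apply: le_trans h; rewrite lee_pmul2l// ?lte_fin// ltW.
  by rewrite -lee_fin EFinM -(vol3_eball (ltW r0)).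
apply: (@le_lt_trans _ _ (lebesgue_measure `]0, T]%classic)).
  by apply: le_measure; rewrite ?inE//; exact: measurable_levels.
by rewrite lebesgue_measure_itv/=; case: ifP; rewrite ?ltry// -EFinB ltry.
Qed.

Lemma phi_noninc x y : 0 < enorm x -> enorm x <= enorm y -> phi y <= phi x.
Proof.
move=> x0 xy; have y0 := lt_le_trans x0 xy; rewrite !phiE; apply: fine_le.
- by rewrite ge0_fin_numE// levels_fin.
- by rewrite ge0_fin_numE// levels_fin.
- apply: le_measure; rewrite ?inE; try exact: measurable_levels.
  exact: levelsS.
Qed.

Lemma phi_rad x y : enorm x = enorm y -> phi x = phi y.
Proof. by move=> xy; rewrite !phiE xy. Qed.

Definition axis (r : R) : R3 := (r, 0, 0).

Lemma enorm_axis r : 0 <= r -> enorm (axis r) = r.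
Proof. by move=> r0; rewrite enormE /sqn /axis /= expr0n /= !addr0 sqrtr_sqr ger0_norm. Qed.

Definition radial (r : R) : R := phi (axis r).

Lemma phi_radE x : phi x = radial (enorm x).
Proof. by apply: phi_rad; rewrite enorm_axis// enorm_ge0. Qed.

Lemma rad_ge0 r : 0 <= radial r. Proof. exact: phi_ge0. Qed.

Lemma rad_noninc r s : 0 < r -> r <= s -> radial s <= radial r.
Proof.
by move=> r0 rs; apply: phi_noninc; rewrite !enorm_axis ?(le_trans (ltW r0))// ltW.
Qed.

(** The ball of radius 0 is null, so at the origin the layer-cake formula counts
the [t] for which [phi > t] on a set of positive volume, that is, for which
the profile exceeds [t] somewhere off the origin. *)
Lemma phi0E (b : R) : 0 < b ->
  (forall t, 0 < t -> (exists2 r, 0 < r & t < radial r) <-> t < b) -> phi 0 = b.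
Proof.
move=> b0 hb; rewrite phiE enorm0.
suff -> : levels 0 = `]0, b[%classic.
  by rewrite lebesgue_measure_itv/= lte_fin b0 sube0.
have v0 : vol3 (eball 0) = 0%E by rewrite vol3_eball// expr0n/= mulr0.
apply/seteqP; split => t /=; rewrite in_itv/=; last first.
  move=> /andP[t0 /hb-/(_ t0)[r r0 tr]]; split => //.
  rewrite v0; apply: (@lt_le_trans _ _ (vol3 (shell (r / 2) r))).
    have r2 : r / 2 < r by rewrite ltr_pdivrMr// ltr_pMr// ltrDl.
    rewrite vol3_shell ?ltW ?divr_gt0// lte_fin mulr_gt0 ?ball_vol_gt0// subr_gt0.
    by rewrite ltr_pXn2r ?nnegrE// ltW// divr_gt0.
  apply: le_measure; rewrite ?inE; [exact: measurable_shell|exact: measurable_superlevel|].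
  move=> x /shellP/andP[x1 x2] /=.
  have x0 : 0 < enorm x by apply: lt_le_trans x1; rewrite divr_gt0.
  rewrite /superlevel /= ger0_norm ?phi_ge0// phi_radE; apply: (lt_le_trans tr).
  by apply: rad_noninc => //; exact: ltW.
move=> [t0]; rewrite v0 t0 /= => ht; apply/(hb t t0); apply: contrapT => nr.
suff : (vol3 (superlevel t) <= 0)%E by rewrite leNgt ht.
have cube0 : vol3 (cube 0) = 0%E by rewrite vol3_cube// mulr0 expr0n.
rewrite -cube0; apply: le_measure; rewrite ?inE; [exact: measurable_superlevel|exact: measurable_cube|].
move=> x; rewrite /superlevel /= ger0_norm ?phi_ge0// phi_radE => tx.
have : enorm x = 0.
  apply/eqP; rewrite eq_le enorm_ge0 andbT leNgt; apply/negP => x0; apply: nr.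
  by exists (enorm x).
by move=> x0; rewrite -[X in cube X]x0; exact: enorm_le_cube.
Qed.

End Rearrangement.

(** * The Euler-Lagrange inequality for the profile *)

Section Bridge.
Context {R : realType}.
Local Notation R3 := (R * R * R)%type.
Local Notation M3 := (measurableTypeR R * measurableTypeR R * measurableTypeR R)%type.
Local Notation vol3 := (@vol3 R).
Local Notation c3 := (@ball_vol R).

(** Passage to the limit in a bound with an error linear in [r]. *)
Lemma ler_small (X Y K p : R) : 0 < p -> 0 <= K ->
  (forall r, 0 < r -> r < p -> X <= Y + K * r) -> X <= Y.
Proof.
move=> p0 K0 h; apply/ler_addgt0Pr => e e0.
pose r := Num.min (p / 2) (e / (K + 1)).
have K1 : 0 < K + 1 by rewrite ltr_wpDl.
have r0 : 0 < r by rewrite /r lt_min !divr_gt0.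
have rp : r < p by rewrite /r gt_min ltr_pdivrMr// ltr_pMr// ltrDl ltr01.
apply: (le_trans (h r r0 rp)); rewrite lerD2l.
have re : r * (K + 1) <= e by rewrite -ler_pdivlMr// /r ge_min lexx orbT.
by apply: le_trans re; rewrite mulrC ler_wpM2l ?(ltW r0)// lerDl.
Qed.

Lemma reflected_bound (T p z : R) : 0 <= p <= T -> 0 <= z <= 1 ->
  - T <= p * (1 - 2 * z) <= T.
Proof. by move=> /andP[p0 pT] /andP[z0 z1]; apply/andP; split; nra. Qed.

(** The arithmetic of [flux_inequality]: [Q] and [s] are the integrals of
[phi * laplacian psi] and [phi * psi], [l1] and [l0] those of [psi] over the
positivity and the zero set, [X] the volume of the ball of radius [p] and [D]
that of the shell up to [q']. *)
Lemma flux_combine (b l T X M gp D l0 l1 s Q : R) :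
  0 <= b -> 0 <= l -> 0 <= T -> 0 <= gp -> 0 <= D ->
  `|Q + l * s - b * l1| <= b * l0 -> T * M <= s <= T * M + T * gp * D ->
  l1 + l0 <= T * X + T * D -> T * X - T * D <= l1 - l0 ->
  `|Q - T * (b * X - l * M)| <= T * (b + l * gp) * D.
Proof.
move=> b0 h0 T0 gp0 D0 EL /andP[s1 s2] up lo.
have bup := ler_wpM2l b0 up; have blo := ler_wpM2l b0 lo.
have ls1 := ler_wpM2l h0 s1; have ls2 := ler_wpM2l h0 s2.
have e1 := mulr_ge0 h0 (mulr_ge0 (mulr_ge0 T0 gp0) D0).
move: EL; rewrite !ler_norml => /andP[EL1 EL2]; apply/andP; split; lra.
Qed.

Lemma ball_int0 (f : R3 -> R) : ball_int f 0 = 0.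
Proof.
rewrite /ball_int (_ : eball 0 = set0) ?Rintegral_set0//.
by apply/seteqP; split => x; rewrite /eball /= ?ltNge ?enorm_ge0.
Qed.

Lemma ball_int_all (f : R3 -> R) (r : R) :
  (forall x, r <= enorm x -> f x = 0) -> ball_int f r = I3 f.
Proof.
move=> f0; rewrite /ball_int Rintegral_mkcond; apply: eq_Rintegral => x _.
rewrite patchE; case: ifPn => // /negP xr; rewrite f0// leNgt; apply/negP => h.
by apply: xr; rewrite inE.
Qed.

Variables (beta : R) (phi : R3 -> R) (G : 'I_3 -> R3 -> R).
Hypothesis beta_gt0 : 0 < beta.
Hypothesis adm : admissible phi G.
Hypothesis phi_min : forall v H, admissible v H -> (energy beta phi G <= energy beta v H)%E.
Hypothesis phi_symm : forall x, phi x = symm_rearr phi x.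

Let phi_i := phi_intg adm.
Let phi0 x := phi_ge0 phi_symm phi_i x.
Local Notation g := (radial phi).
Local Notation m := (ball_int phi).
Local Notation lam := (lagrange beta phi G).

Lemma phi_le r x : 0 < r -> r <= enorm x -> phi x <= g r.
Proof.
by move=> r0 rx; rewrite (phi_radE phi_symm phi_i); exact: (rad_noninc phi_symm phi_i).
Qed.

Lemma phi_ge r x : 0 < enorm x -> enorm x <= r -> g r <= phi x.
Proof.
by move=> r0 rx; rewrite (phi_radE phi_symm phi_i x); exact: (rad_noninc phi_symm phi_i).
Qed.

Lemma mass_shell (s t mm MM : R) : 0 < s -> s <= t ->
  (forall u, s <= u < t -> mm <= g u <= MM) ->
  mm * (c3 * (t ^+ 3 - s ^+ 3)) <= m t - m s <= MM * (c3 * (t ^+ 3 - s ^+ 3)).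
Proof.
move=> s0 st gb; apply: shell_bounds => //; first exact: ltW.
by move=> x xst; rewrite (phi_radE phi_symm phi_i); exact: gb.
Qed.

Lemma mass_ge0 r : 0 <= m r.
Proof. by apply: Rintegral_ge0. Qed.

Lemma mass_le r : m r <= I3 phi.
Proof.
rewrite /ball_int Rintegral_mkcond; apply: I3_le => //.
- apply: (@intg_ext _ (fun x => phi x * \1_(eball r : set M3) x)).
    by move=> x; rewrite patchE indicE; case: (_ \in _); rewrite ?mulr1 ?mulr0.
  by apply: intgM_indic => //; exact: measurable_eball.
- by move=> x; rewrite patchE; case: ifP.
Qed.

(** Integrate [phi <= (r * phi ^+ 2 + r^-1) / 2] over the ball and use that [phi]
has norm 1. *)
Lemma mass_small r : 0 < r -> m r <= 2^-1 * (r + c3 * r ^+ 2).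
Proof.
move=> r0; have mb := measurable_eball r.
have rn : r != 0 by rewrite gt_eqF.
have bb : vol3.-integrable (eball r) (EFin \o cst (r^-1)).
  apply: measurable_bounded_integrable => //.
  - exact: (eq_ind_r (fun u : \bar R => (u < +oo)%E) (ltry _) (vol3_eball (ltW r0))).
  - by exists `|r^-1|; split; [exact: num_real|move=> M kM x _; exact: ltW].
have i2 : vol3.-integrable (eball r) (EFin \o (fun x => r * phi x ^+ 2)).
  by apply: (@integrableS _ _ _ _ setT) => //; apply: intgZ; exact: (phi_L2 adm).2.
have i1 : vol3.-integrable (eball r) (EFin \o phi) by apply: (@integrableS _ _ _ _ setT).
have i12 : vol3.-integrable (eball r) (EFin \o (fun x => r * phi x ^+ 2 + r^-1)).
  exact: (integrableD mb i2 bb).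
have le1 : m r <= \int[vol3]_(x in eball r) (2^-1 * (r * phi x ^+ 2 + r^-1)).
  apply: le_Rintegral => //.
    exact: (integrableZl mb (2^-1) i12).
  move=> x _; have := sqr_ge0 (r * phi x - 1).
  rewrite -subr_ge0 => h; rewrite -subr_ge0.
  have -> : 2^-1 * (r * phi x ^+ 2 + r^-1) - phi x = ((r * phi x - 1) ^+ 2) * (2^-1 / r) by field.
  by rewrite mulr_ge0 ?sqr_ge0// divr_ge0// ltW.
apply: (le_trans le1); rewrite RintegralZl// RintegralD// ler_pM2l ?invr_gt0//.
apply: lerD.
  rewrite -[leRHS]mulr1 -(phi_norm adm).
  have -> : r * I3 (fun x => phi x ^+ 2) = I3 (fun x => r * phi x ^+ 2).
    by rewrite I3Z//; exact: (phi_L2 adm).2.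
  rewrite Rintegral_mkcond; apply: I3_le.
  - apply: (@intg_ext _ (fun x => (r * phi x ^+ 2) * \1_(eball r : set M3) x)).
      by move=> x; rewrite patchE indicE; case: (_ \in _); rewrite ?mulr1 ?mulr0.
    apply: intgM_indic => //.
    by apply: intgZ; exact: (phi_L2 adm).2.
  - by apply: intgZ; exact: (phi_L2 adm).2.
  - move=> x; rewrite patchE; case: ifP => // _.
    by rewrite mulr_ge0 ?sqr_ge0// ltW.
rewrite Rintegral_cst//.
have -> : fine (vol3 (eball r)) = c3 * r ^+ 3 by exact: (congr1 fine (vol3_eball (ltW r0))).
by rewrite le_eqVlt; apply/orP; left; apply/eqP; field.
Qed.

(** Otherwise the whole mass of [phi] would lie in arbitrarily small balls,
against [mass_small]. *)
Lemma rad_nontrivial : exists2 r, 0 < r & 0 < g r.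
Proof.
apply: contrapT => h.
have g0 r : 0 < r -> g r = 0.
  move=> r0; apply/eqP; rewrite eq_le (rad_ge0 phi_symm phi_i) andbT leNgt.
  by apply/negP => gr; apply: h; exists r.
have mE : m 1 = I3 phi.
  apply: ball_int_all => x x1; rewrite (phi_radE phi_symm phi_i) g0//.
  exact: lt_le_trans x1.
have := I3_phi_gt0 adm phi0; rewrite -mE ltNge => /negP; apply.
have c0 := @ball_vol_gt0 R.
apply: (@ler_small _ _ (1 + c3) 1) => // [|r r0 r1]; first by rewrite addr_ge0// ltW.
have gb u : r <= u < 1 -> 0 <= g u <= 0.
  by move=> /andP[ru _]; rewrite g0 ?lexx//; exact: lt_le_trans ru.
have /andP[_ m1] := mass_shell r0 (ltW r1) gb; rewrite mul0r in m1.
have mr := mass_small r0.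
have r2 : c3 * r ^+ 2 <= c3 * r by apply: ler_wpM2l; [exact: ltW|rewrite expr2 ler_piMr ?(ltW r0) ?(ltW r1)].
have cr : 0 < c3 * r by exact: mulr_gt0.
lra.
Qed.

(** [euler_lagrange] for the test function of [radial_test]. The integral of
[phi * laplacian psi] is [B - A], and [A] and [B] are averages of [g] over the
two thin shells. On the inner ball [psi] is the constant [T] and [phi] is
positive, so the other terms reduce to [T] times the flux, up to the
contribution of the intermediate shell, where [0 <= psi <= T]. *)
Lemma flux_inequality (p p' q q' : R) : 0 < p -> p < p' -> p' <= q -> q < q' ->
  (forall r, 0 < r -> r < p -> 0 < g r) ->
  exists T A B : R, [/\ p'^-1 - q^-1 <= T <= p^-1 - q'^-1,
    3 * c3 * g p' <= A <= 3 * c3 * g p, 3 * c3 * g q' <= B <= 3 * c3 * g q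
    & `|B - A - T * (beta * (c3 * p ^+ 3) - lam * m p)| <=
      T * (beta + lam * g p) * (c3 * (q' ^+ 3 - p ^+ 3))].
Proof.
move=> p0 pp' p'q qq' gpos.
have p'0 := lt_trans p0 pp'; have q0 := lt_le_trans p'0 p'q; have q'0 := lt_trans q0 qq'.
have pq' : p <= q' by lra.
have [P1 [D1 [sP1 dP1 P1b D10 [P1p P1p']]]] := smooth_step pp'.
have [P2 [D2 [sP2 dP2 P2b D20 [P2q P2q']]]] := smooth_step qq'.
have [psi [T [[tpsi spsi] Lpsi Tb psip [psib psiq']]]] :=
  radial_test p0 pp' p'q qq' sP1 dP1 P1b (fun r h => (P1p r h).1) (fun r h => (P1p' r h).1)
    sP2 dP2 P2b (fun r h => (P2q r h).1) (fun r h => (P2q' r h).1).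
have [iF1 IF1] := profile_integral p0 pp' sP1 dP1 P1p P1p'.
have [iF2 IF2] := profile_integral q0 qq' sP2 dP2 P2q P2q'.
pose F1 (x : R3) := D1 (enorm x) / enorm x ^+ 2.
pose F2 (x : R3) := D2 (enorm x) / enorm x ^+ 2.
have F10 x : 0 <= F1 x by rewrite divr_ge0// sqr_ge0.
have F20 x : 0 <= F2 x by rewrite divr_ge0// sqr_ge0.
have bnd (a b : R) (D : R -> R) : 0 < a -> a < b -> (forall r, r <= a -> D r = 0) ->
    (forall r, b <= r -> D r = 0) -> (forall r, 0 <= D r) ->
    intg (fun x : R3 => D (enorm x) / enorm x ^+ 2) ->
    I3 (fun x : R3 => D (enorm x) / enorm x ^+ 2) = 3 * c3 ->
    intg (fun x => phi x * (D (enorm x) / enorm x ^+ 2)) /\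
    3 * c3 * g b <= I3 (fun x => phi x * (D (enorm x) / enorm x ^+ 2)) <= 3 * c3 * g a.
  move=> a0 ab Da Db D0 iD ID.
  have Fp x : 0 <= D (enorm x) / enorm x ^+ 2 by rewrite divr_ge0// sqr_ge0.
  have up x : phi x * (D (enorm x) / enorm x ^+ 2) <= g a * (D (enorm x) / enorm x ^+ 2).
    have [xa|xa] := leP (enorm x) a; first by rewrite Da// mul0r !mulr0.
    by rewrite ler_wpM2r// phi_le// ltW.
  have lo x : g b * (D (enorm x) / enorm x ^+ 2) <= phi x * (D (enorm x) / enorm x ^+ 2).
    have [xb|xb] := leP b (enorm x); first by rewrite Db// mul0r !mulr0.
    have [xa|xa] := leP (enorm x) a; first by rewrite Da// mul0r !mulr0.
    by rewrite ler_wpM2r// phi_ge ?(ltW xb)// (lt_trans a0).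
  have ipF : intg (fun x => phi x * (D (enorm x) / enorm x ^+ 2)).
    apply: (@intg_le _ _ (fun x => g a * (D (enorm x) / enorm x ^+ 2))).
    - by apply: measM; exact: intg_meas.
    - by move=> x; rewrite ger0_norm// mulr_ge0.
    - exact: intgZ.
  split => //; rewrite -ID mulrC -I3Z// [_ * g a]mulrC -I3Z//; apply/andP; split.
    by apply: I3_le => //; exact: intgZ.
  by apply: I3_le => //; exact: intgZ.
have [iA Ab] := bnd p p' D1 p0 pp' (fun r h => (P1p r h).2) (fun r h => (P1p' r h).2) D10 iF1 IF1.
have [iB Bb] := bnd q q' D2 q0 qq' (fun r h => (P2q r h).2) (fun r h => (P2q' r h).2) D20 iF2 IF2.
set A := I3 _ in Ab; set B := I3 _ in Bb.
exists T, A, B; split => //.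
have EL := euler_lagrange beta_gt0 adm phi_min phi0 tpsi.
have LE : I3 (fun x => phi x * laplacian psi x) = B - A.
  rewrite (@eq_I3 _ _ (fun x => phi x * (D2 (enorm x) / enorm x ^+ 2) - phi x * (D1 (enorm x) / enorm x ^+ 2))).
    by rewrite I3B.
  by move=> x; rewrite Lpsi mulrBl opprB mulrBr.
rewrite LE in EL.
have T0 : 0 <= T by case/andP: (psib 0) => h1 h2; exact: le_trans h2.
have lam0 := lagrange_gt0 beta_gt0 adm phi0.
have ipsi := test_intg tpsi; have inpsi := intg_norm ipsi.
set Z : R3 -> R := fun x => \1_(zero_set phi) x in EL.
have mZ := measurable_zero_set adm.
have Z01 x : 0 <= Z x <= 1 by exact: indic01.
have iZ f : intg f -> intg (fun x => f x * Z x) by move=> h; apply: intgM_indic.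
have i1 : intg (fun x => psi x * (1 - Z x)).
  by apply: (@intg_ext _ (fun x => psi x - psi x * Z x)) => [x|]; [ring|apply: intgB => //; exact: iZ].
have i0 := iZ _ inpsi.
set l1 := I3 (fun x => psi x * (1 - Z x)) in EL; set l0 := I3 (fun x => `|psi x| * Z x) in EL.
set s := I3 (fun x => phi x * psi x) in EL.
have is_ : intg (fun x => phi x * psi x) by apply: L2M; [exact: phi_L2 adm|exact: test_L2].
set Dl := c3 * (q' ^+ 3 - p ^+ 3).
have gp0 : 0 <= g p by exact: (rad_ge0 phi_symm phi_i).
have sb : T * m p <= s <= T * m p + T * g p * Dl.
  have sE : s = ball_int (fun x => phi x * psi x) q'.
    by rewrite ball_int_all// => x /psiq' ->; rewrite mulr0.
  have sp : ball_int (fun x => phi x * psi x) p = T * m p.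
    rewrite mulrC /ball_int -RintegralZr//; last 2 first.
    - exact: measurable_eball.
    - by apply: (@integrableS _ _ _ _ setT) => //; exact: measurable_eball.
    by apply: eq_Rintegral => x; rewrite inE /eball /= => xp; rewrite psip// ltW.
  have := @shell_bounds _ (fun x => phi x * psi x) 0 (g p * T) p q' (ltW p0) pq' is_.
  have h (x : R3) : p <= enorm x < q' -> 0 <= phi x * psi x <= g p * T.
    move=> /andP[px _]; have /andP[h1 h2] := psib x; rewrite mulr_ge0//=.
    by apply: ler_pM => //; exact: phi_le.
  move=> /(_ h); rewrite -sE sp mul0r -/Dl (mulrC (g p)); lra.
have up : l1 + l0 <= T * (c3 * p ^+ 3) + T * Dl.
  have E : l1 + l0 = ball_int psi q'.
    rewrite ball_int_all// /l1 /l0 -I3D//; apply: eq_I3 => x.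
    by have /andP[h _] := psib x; rewrite (ger0_norm h); ring.
  have b1 := @shell_bounds _ psi T T 0 p (lexx _) (ltW p0) ipsi.
  have b2 := @shell_bounds _ psi 0 T p q' (ltW p0) pq' ipsi.
  have /andP[_ {}b1] : T * (c3 * (p ^+ 3 - 0 ^+ 3)) <= ball_int psi p - ball_int psi 0 <= T * (c3 * (p ^+ 3 - 0 ^+ 3)).
    by apply: b1 => x /andP[_ xp]; rewrite psip ?lexx// ltW.
  have /andP[_ {}b2] := b2 (fun x _ => psib x).
  by move: b1 b2; rewrite E ball_int0 expr0n /= -/Dl; lra.
(* The origin may belong to the zero set: a ball of radius r is cut out, then r tends to 0. *)
have lo : T * (c3 * p ^+ 3) - T * Dl <= l1 - l0.
  pose f x := psi x * (1 - Z x) - `|psi x| * Z x.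
  have fi : intg f by exact: intgB.
  have E : l1 - l0 = ball_int f q'.
    rewrite ball_int_all; first by rewrite /l1 /l0 -I3B.
    by move=> x /psiq' h; rewrite /f h normr0 !mul0r subrr.
  have fE x : f x = psi x * (1 - 2 * Z x).
    by rewrite /f; have /andP[h _] := psib x; rewrite (ger0_norm h); ring.
  have fb x : - T <= f x <= T.
    by rewrite fE; exact: reflected_bound (psib x) (Z01 x).
  have c0 := @ball_vol_gt0 R.
  apply: (@ler_small _ _ (2 * T * c3 * p ^+ 2) p) => //; first by rewrite !mulr_ge0 ?exprn_ge0// ltW.
  move=> r r0 rp.
  have /andP[b1 _] := @shell_bounds _ f (- T) T 0 r (lexx _) (ltW r0) fi (fun x _ => fb x).
  have b2 := @shell_bounds _ f T T r p (ltW r0) (ltW rp) fi.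
  have /andP[b3 _] := @shell_bounds _ f (- T) T p q' (ltW p0) pq' fi (fun x _ => fb x).
  have /andP[{}b2 _] : T * (c3 * (p ^+ 3 - r ^+ 3)) <= ball_int f p - ball_int f r <= T * (c3 * (p ^+ 3 - r ^+ 3)).
    apply: b2 => x /andP[rx xp]; rewrite fE psip ?(ltW xp)//.
    have x0 := lt_le_trans r0 rx.
    have -> : Z x = 0.
      rewrite /Z indicE memNset// => /eqP; rewrite (phi_radE phi_symm phi_i) gt_eqF//.
      exact: gpos.
    by rewrite mulr0 subr0 mulr1 lexx.
  have rr : 2 * T * c3 * r ^+ 3 <= 2 * T * c3 * p ^+ 2 * r.
    rewrite -[leRHS]mulrA; apply: ler_wpM2l; first by rewrite !mulr_ge0// ltW.
    by rewrite exprSr ler_wpM2r ?(ltW r0)// ler_pXn2r ?nnegrE// ltW.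
  move: b1 b2 b3 rr; rewrite E ball_int0 expr0n /= -/Dl; lra.
have Dl0 : 0 <= Dl.
  by rewrite /Dl mulr_ge0 ?(ltW (@ball_vol_gt0 R))// subr_ge0 ler_pXn2r ?nnegrE// ltW.
exact: flux_combine (ltW beta_gt0) (ltW lam0) T0 gp0 Dl0 EL sb up lo.
Qed.

End Bridge.

(** * The profile equation and the free boundary *)

Section Profile.
Context {R : realType}.
Variables (g m : R -> R) (c beta lam B : R).
Hypotheses (c0 : 0 < c) (beta0 : 0 < beta) (lam0 : 0 < lam).
Hypothesis g_ge0 : forall r, 0 <= g r.
Hypothesis g_noninc : forall r s, 0 < r -> r <= s -> g s <= g r.
Hypothesis mass : forall s t mm MM : R, 0 < s -> s <= t ->
  (forall u, s <= u < t -> mm <= g u <= MM) ->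
  mm * (c * (t ^+ 3 - s ^+ 3)) <= m t - m s <= MM * (c * (t ^+ 3 - s ^+ 3)).
Hypothesis m_ge0 : forall r, 0 <= m r.
Hypothesis m_le : forall r, m r <= B.
Hypothesis m_small : forall r, 0 < r -> m r <= 2^-1 * (r + c * r ^+ 2).
Hypothesis g_nontrivial : exists2 r, 0 < r & 0 < g r.
Hypothesis key : forall p p' q q' : R, 0 < p -> p < p' -> p' <= q -> q < q' ->
  (forall r, 0 < r -> r < p -> 0 < g r) ->
  exists T A B : R, [/\ p'^-1 - q^-1 <= T <= p^-1 - q'^-1,
    3 * c * g p' <= A <= 3 * c * g p, 3 * c * g q' <= B <= 3 * c * g q
    & `|B - A - T * (beta * (c * p ^+ 3) - lam * m p)| <=
      T * (beta + lam * g p) * (c * (q' ^+ 3 - p ^+ 3))].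

(** The integral of [beta - lam * phi] over the ball of radius [r]. *)
Definition flux r := beta * (c * r ^+ 3) - lam * m r.
Definition pos_below a := forall r, 0 < r -> r < a -> 0 < g r.

Lemma mass_mono s t : 0 < s -> s <= t ->
  g t * (c * (t ^+ 3 - s ^+ 3)) <= m t - m s <= g s * (c * (t ^+ 3 - s ^+ 3)).
Proof.
move=> s0 st; apply: mass => // u /andP[su ut].
by rewrite (g_noninc s0 su) (g_noninc (lt_le_trans s0 su) (ltW ut)).
Qed.

Lemma cube_diff_ge0 (s t : R) : 0 <= s -> s <= t -> 0 <= t ^+ 3 - s ^+ 3.
Proof. by move=> s0 st; rewrite subr_ge0 ler_pXn2r ?nnegrE// (le_trans s0). Qed.

Lemma cube_diff_le (s t b : R) : 0 <= s -> s <= t -> t <= b ->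
  t ^+ 3 - s ^+ 3 <= 3 * b ^+ 2 * (t - s).
Proof.
move=> s0 st tb.
have -> : t ^+ 3 - s ^+ 3 = (t ^+ 2 + t * s + s ^+ 2) * (t - s) by ring.
by apply: ler_wpM2r; [rewrite subr_ge0|nra].
Qed.

Lemma inv_diff (a b : R) : 0 < a -> 0 < b -> a^-1 - b^-1 = (b - a) / (a * b).
Proof. by move=> a0 b0; field; rewrite !gt_eqF. Qed.

Lemma inv_diff_le (a b d : R) : 0 < d -> d <= a -> a <= b -> a^-1 - b^-1 <= (b - a) / d ^+ 2.
Proof.
move=> d0 da ab; have a0 := lt_le_trans d0 da; have b0 := lt_le_trans a0 ab.
rewrite inv_diff// ler_wpM2l ?subr_ge0// lef_pV2 ?posrE ?mulr_gt0 ?exprn_gt0//.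
by rewrite expr2; apply: ler_pM; rewrite ?(ltW d0)//; exact: le_trans da ab.
Qed.

Lemma inv_diff_ge0 (a b : R) : 0 < a -> a <= b -> 0 <= a^-1 - b^-1.
Proof.
by move=> a0 ab; rewrite subr_ge0 lef_pV2 ?posrE//; exact: lt_le_trans ab.
Qed.

Lemma flux_diff s t : 0 < s -> s <= t ->
  - (lam * g s * (c * (t ^+ 3 - s ^+ 3))) <= flux t - flux s <= beta * (c * (t ^+ 3 - s ^+ 3)).
Proof.
move=> s0 st; have /andP[m1 m2] := mass_mono s0 st; rewrite /flux.
have C0 : 0 <= c * (t ^+ 3 - s ^+ 3).
  by apply: mulr_ge0; [exact: ltW|apply: cube_diff_ge0 => //; exact: ltW].
have m1' : 0 <= m t - m s by apply: le_trans m1; exact: mulr_ge0.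
have l1 := mulr_ge0 (ltW lam0) m1'.
have l2 := ler_wpM2l (ltW lam0) m2.
have b1 := mulr_ge0 (ltW beta0) C0.
by apply/andP; split; lra.
Qed.

(** [key] with [p = a], [p' = a + e], [q = b - e], [q' = b]: then [A] is at most
[3 * c * g a] and [B] at least [3 * c * g b]. Let [e] tend to 0. *)
Lemma increment_le a b : 0 < a -> a < b -> pos_below a ->
  3 * c * (g b - g a) <=
  (a^-1 - b^-1) * (flux a + (beta + lam * g a) * (c * (b ^+ 3 - a ^+ 3))).
Proof.
move=> a0 ab pa; set E := flux a + _.
have b0 := lt_trans a0 ab.
apply: (@ler_small _ _ _ (2 * `|E| / a ^+ 2) ((b - a) / 2)).
- by rewrite divr_gt0// subr_gt0.
- by rewrite mulr_ge0// invr_ge0 sqr_ge0.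
move=> e e0 eb.
have h1 : a < a + e by rewrite ltrDl.
have h2 : a + e <= b - e by lra.
have h3 : b - e < b by lra.
have [T [A [B' [/andP[T1 T2] /andP[A1 A2] /andP[B1 B2]]]]] := key a0 h1 h2 h3 pa.
rewrite -/(flux a) ler_norml => /andP[_ K1].
have X : 3 * c * (g b - g a) <= T * E by rewrite /E; lra.
have TE : T * E <= (a^-1 - b^-1) * E + (a^-1 - b^-1 - T) * `|E|.
  have := ler_norm (- E); rewrite normrN => nE.
  have : 0 <= a^-1 - b^-1 - T by lra.
  nra.
apply: (le_trans X); apply: (le_trans TE); rewrite lerD2l.
have i1 := @inv_diff_le a (a + e) a a0 (lexx _) (ltW h1).
have i2 := @inv_diff_le (b - e) b a a0 (le_trans (ltW h1) h2) (ltW h3).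
have -> : 2 * `|E| / a ^+ 2 * e = (2 * e / a ^+ 2) * `|E| by ring.
apply: ler_wpM2r => //; rewrite (_ : 2 * e / a ^+ 2 = e / a ^+ 2 + e / a ^+ 2); last by ring.
move: i1 i2; rewrite (_ : a + e - a = e); last by ring.
by rewrite (_ : b - (b - e) = e); [lra|ring].
Qed.

(** [key] with [p = a - e], [p' = a], [q = b], [q' = b + e]: now [A] is at least
[3 * c * g a] and [B] at most [3 * c * g b]. *)
Lemma increment_ge a b : 0 < a -> a < b -> pos_below a ->
  (a^-1 - b^-1) * (flux a - (beta + lam * g (a / 2)) * (c * (b ^+ 3 - a ^+ 3))) <=
  3 * c * (g b - g a).
Proof.
move=> a0 ab pa; set K := beta + _; set E := flux a - _.
have b0 := lt_trans a0 ab.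
have K0 : 0 <= K by rewrite addr_ge0 ?mulr_ge0// ltW.
pose K1 := (beta + K) * (c * (15 * b ^+ 2)).
have K10 : 0 <= K1.
  apply: mulr_ge0; first by rewrite addr_ge0// ltW.
  by apply: mulr_ge0; [exact: ltW|rewrite mulr_ge0// sqr_ge0].
pose t := a^-1 - b^-1.
have t0 : 0 <= t by exact: inv_diff_ge0 (ltW ab).
apply: (@ler_small _ _ _ (8 / a ^+ 2 * `|E| + (t + 4 / a) * K1) (a / 2)).
- by rewrite divr_gt0.
- apply: addr_ge0; first by rewrite mulr_ge0// divr_ge0// sqr_ge0.
  by apply: mulr_ge0 => //; rewrite addr_ge0// divr_ge0// ltW.
move=> e e0 ea.
have p0 : 0 < a - e by lra.
have h1 : a - e < a by lra.
have h3 : b < b + e by lra.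
have pp : pos_below (a - e) by move=> r r0 ra; apply: pa => //; lra.
have [T [A [B' [/andP[T1 T2] /andP[A1 A2] /andP[B1 B2]]]]] := key p0 h1 (ltW ab) h3 pp.
rewrite -/(flux (a - e)) ler_norml => /andP[K2 _].
have T0 : 0 <= T by exact: le_trans T1.
have gK : beta + lam * g (a - e) <= K.
  by rewrite lerD2l ler_wpM2l ?(ltW lam0)// g_noninc ?divr_gt0//; lra.
have d1 := @cube_diff_le (a - e) a b (ltW p0) (ltW h1) (ltW ab).
have d2 : (b + e) ^+ 3 - b ^+ 3 <= 3 * (2 * b) ^+ 2 * (b + e - b).
  by apply: cube_diff_le; lra.
have /andP[_ f2] := flux_diff p0 (ltW h1).
have X : T * (E - K1 * e) <= 3 * c * (g b - g a).
  apply: (@le_trans _ _ (T * (flux (a - e) - (beta + lam * g (a - e)) * (c * ((b + e) ^+ 3 - (a - e) ^+ 3))))); last by lra.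
  apply: ler_wpM2l => //.
  have D0 : 0 <= (b + e) ^+ 3 - (a - e) ^+ 3 by apply: cube_diff_ge0; lra.
  have cD : (beta + lam * g (a - e)) * (c * ((b + e) ^+ 3 - (a - e) ^+ 3)) <=
     K * (c * ((b + e) ^+ 3 - (a - e) ^+ 3)).
    by apply: ler_wpM2r => //; apply: mulr_ge0 => //; exact: ltW.
  have bd1 : beta * (c * (a ^+ 3 - (a - e) ^+ 3)) <= beta * (c * (3 * b ^+ 2 * e)).
    apply: ler_wpM2l; first exact: ltW.
    by apply: ler_wpM2l; [exact: ltW|move: d1; rewrite (_ : a - (a - e) = e)//; ring].
  have Kd : K * (c * ((b + e) ^+ 3 - (a - e) ^+ 3)) <= K * (c * (b ^+ 3 - a ^+ 3 + 15 * b ^+ 2 * e)).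
    apply: ler_wpM2l => //; apply: ler_wpM2l; first exact: ltW.
    move: d1 d2; rewrite (_ : a - (a - e) = e); last by ring.
    rewrite (_ : b + e - b = e); last by ring.
    rewrite (_ : 3 * (2 * b) ^+ 2 * e = 12 * b ^+ 2 * e); last by ring.
    lra.
  have be : 0 <= beta * (c * (b ^+ 2 * e)).
    by rewrite !mulr_ge0 ?sqr_ge0// ltW.
  rewrite /E /K1; move: f2 cD bd1 Kd be; move: (b ^+ 3 - a ^+ 3) ((b + e) ^+ 3 - (a - e) ^+ 3) => u v.
  lra.
rewrite -/t.
have a20 : 0 < a / 2 by rewrite divr_gt0.
have a2e : a / 2 <= a - e by lra.
have i1 := inv_diff_le a20 a2e (ltW h1).
have i2 := @inv_diff_le b (b + e) a a0 (ltW ab) (ltW h3).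
have Tt : T <= t + 8 / a ^+ 2 * e.
  have i1' : (a - e)^-1 - a^-1 <= e * 4 / a ^+ 2.
    apply: (le_trans i1).
    rewrite (_ : a - (a - e) = e); last by ring.
    by rewrite le_eqVlt; apply/orP; left; apply/eqP; field; rewrite gt_eqF.
  move: i2; rewrite (_ : b + e - b = e); last by ring.
  move: i1'; have : 0 <= e / a ^+ 2 by rewrite divr_ge0 ?sqr_ge0// ltW.
  rewrite (_ : e * 4 / a ^+ 2 = 4 * (e / a ^+ 2)); last by ring.
  rewrite (_ : 8 / a ^+ 2 * e = 8 * (e / a ^+ 2)); last by ring.
  by rewrite /t; move: (e / a ^+ 2) => u; lra.
have Tt' : T <= t + 4 / a.
  apply: (le_trans Tt); rewrite lerD2l.
  rewrite (_ : 4 / a = 8 / a ^+ 2 * (a / 2)); last by field; rewrite gt_eqF.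
  by apply: ler_wpM2l; [rewrite divr_ge0// sqr_ge0|exact: ltW].
have TE : t * E <= T * E + (T - t) * `|E|.
  have := ler_norm (- E); rewrite normrN => nE.
  have : 0 <= T - t by rewrite subr_ge0.
  nra.
have TE2 : (T - t) * `|E| <= 8 / a ^+ 2 * e * `|E| by apply: ler_wpM2r => //; lra.
have TK : T * (K1 * e) <= (t + 4 / a) * (K1 * e) by apply: ler_wpM2r => //; rewrite mulr_ge0// ltW.
have -> : (8 / a ^+ 2 * `|E| + (t + 4 / a) * K1) * e = 8 / a ^+ 2 * e * `|E| + (t + 4 / a) * (K1 * e) by ring.
move: X TE TE2 TK; rewrite mulrBr.
move: (T * E) (T * (K1 * e)) (t * E) ((T - t) * `|E|) (8 / a ^+ 2 * e * `|E|) ((t + 4 / a) * (K1 * e)).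
move=> x1 x2 x3 x4 x5 x6; lra.
Qed.

Lemma shell_gap d a b : 0 < d -> d <= a -> a < b -> b <= 4 * d ->
  (a^-1 - b^-1) * (c * (b ^+ 3 - a ^+ 3)) <= 48 * c * (b - a) ^+ 2.
Proof.
move=> d0 da ab b4; have a0 := lt_le_trans d0 da.
have i1 := inv_diff_le d0 da (ltW ab).
have i2 := inv_diff_ge0 a0 (ltW ab).
have d1 := cube_diff_le (ltW a0) (ltW ab) b4.
have d2 := cube_diff_ge0 (ltW a0) (ltW ab).
apply: (@le_trans _ _ ((b - a) / d ^+ 2 * (c * (3 * (4 * d) ^+ 2 * (b - a))))).
  apply: ler_pM => //; first by rewrite mulr_ge0// ltW.
  by apply: ler_wpM2l => //; exact: ltW.
by rewrite le_eqVlt; apply/orP; left; apply/eqP; field; rewrite gt_eqF.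
Qed.

Definition bound d := beta + lam * g (d / 2).

Lemma bound_ge0 d : 0 <= bound d.
Proof. by rewrite addr_ge0 ?mulr_ge0// ltW. Qed.

Lemma bound_noninc d a : 0 < d -> d <= a -> bound a <= bound d.
Proof.
move=> d0 da; rewrite lerD2l ler_wpM2l ?(ltW lam0)// g_noninc ?divr_gt0//.
by rewrite ler_pM2r.
Qed.

(** The remainder of [increment_le] and [increment_ge] is a product of two
differences of size [b - a], with constants uniform for radii between [d] and
[4 * d]. *)
Lemma step_left d a b : 0 < d -> d <= a -> a < b -> b <= 4 * d -> pos_below a ->
  `|3 * c * (g b - g a) - (a^-1 - b^-1) * flux a| <= 48 * c * bound d * (b - a) ^+ 2.
Proof.
move=> d0 da ab b4 pa; have a0 := lt_le_trans d0 da.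
have := increment_le a0 ab pa; have := increment_ge a0 ab pa; rewrite -/(bound a).
have gap := shell_gap d0 da ab b4.
have i2 := inv_diff_ge0 a0 (ltW ab).
have D0 : 0 <= c * (b ^+ 3 - a ^+ 3).
  by apply: mulr_ge0; [exact: ltW|exact: (cube_diff_ge0 (ltW a0) (ltW ab))].
have b1 : beta + lam * g a <= bound d.
  apply: le_trans (bound_noninc d0 da).
  by rewrite lerD2l ler_wpM2l ?(ltW lam0)// g_noninc ?divr_gt0//; lra.
have b2 := bound_noninc d0 da.
move: gap i2 D0 b1 b2 (bound_ge0 d); move: (a^-1 - b^-1) (c * (b ^+ 3 - a ^+ 3)) => T D.
move: (bound d) (bound a) (beta + lam * g a) (flux a) => k ka kb f gap T0 D0 b1 b2 k0 lo up.
have TD : 0 <= T * D by exact: mulr_ge0.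
have u1 := ler_wpM2l TD b1; have u2 := ler_wpM2l TD b2; have u3 := ler_wpM2l k0 gap.
rewrite ler_norml; apply/andP; split; lra.
Qed.

(** Moving the flux to the other end changes it by [O(b - a)], and it is already
multiplied by [O(b - a)]. *)
Lemma step_right d a b : 0 < d -> d <= a -> a < b -> b <= 4 * d -> pos_below a ->
  `|3 * c * (g b - g a) - (a^-1 - b^-1) * flux b| <= 96 * c * bound d * (b - a) ^+ 2.
Proof.
move=> d0 da ab b4 pa; have a0 := lt_le_trans d0 da.
have := step_left d0 da ab b4 pa.
have gap := shell_gap d0 da ab b4.
have i2 := inv_diff_ge0 a0 (ltW ab).
have /andP[] := flux_diff a0 (ltW ab).
have D0 : 0 <= c * (b ^+ 3 - a ^+ 3).
  by apply: mulr_ge0; [exact: ltW|exact: (cube_diff_ge0 (ltW a0) (ltW ab))].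
have b1 : lam * g a <= bound d.
  apply: le_trans (bound_noninc d0 da); rewrite -[leLHS]add0r lerD ?(ltW beta0)//.
  by rewrite ler_wpM2l ?(ltW lam0)// g_noninc ?divr_gt0//; lra.
have b2 : beta <= bound d by rewrite lerDl mulr_ge0// ltW.
move: gap i2 D0 b1 b2 (bound_ge0 d); move: (a^-1 - b^-1) (c * (b ^+ 3 - a ^+ 3)) => T D.
move: (bound d) (lam * g a) (flux a) (flux b) => k ga fa fb gap T0 D0 b1 b2 k0 lo up.
have TD : 0 <= T * D by exact: mulr_ge0.
have u1 := ler_wpM2l TD b1; have u2 := ler_wpM2l TD b2; have u3 := ler_wpM2l k0 gap.
have u4 := ler_wpM2l T0 lo; have u5 := ler_wpM2l T0 up.
rewrite !ler_norml => /andP[l1 l2]; apply/andP; split; lra.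
Qed.

(** A positive flux at [a] would make [g] increase beyond [a], by
[increment_ge]. *)
Lemma flux_le0 a : 0 < a -> pos_below a -> flux a <= 0.
Proof.
move=> a0 pa.
have c3 : 0 <= 3 * c by rewrite mulr_ge0// ltW.
apply: (@ler_small _ _ _ (bound a * (c * (12 * a ^+ 2))) a a0).
  by rewrite mulr_ge0 ?bound_ge0// mulr_ge0 ?(ltW c0)// mulr_ge0// sqr_ge0.
move=> e e0 ea; have ab : a < a + e by rewrite ltrDl.
have := increment_ge a0 ab pa; rewrite -/(bound a).
have T0 : 0 < a^-1 - (a + e)^-1.
  by rewrite subr_gt0 ltf_pV2 ?posrE// addr_gt0.
have gg : 3 * c * (g (a + e) - g a) <= 0.
  by rewrite mulr_ge0_le0// subr_le0 g_noninc// ltW.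
move=> h; have {h}h := le_trans h gg; rewrite pmulr_rle0// subr_le0 in h.
rewrite add0r; apply: (le_trans h); rewrite -!mulrA ler_wpM2l ?bound_ge0// ler_wpM2l ?(ltW c0)//.
apply: (le_trans (cube_diff_le (ltW a0) (ltW ab) (_ : _ <= 2 * a))); first by lra.
by rewrite (_ : a + e - a = e); [rewrite exprMn; lra|ring].
Qed.

(** Adding to [g] the multiple of [1 / t] with the opposite slope at [r] leaves a
function with quadratic increments at [r]. *)
Lemma profile_derivable r s : 0 < r -> r < s -> pos_below s ->
  is_derive r 1 g (flux r / (3 * c * r ^+ 2)).
Proof.
move=> r0 rs ps; have r20 : 0 < r / 2 by rewrite divr_gt0.
have rn : r != 0 by rewrite gt_eqF.
have cn : c != 0 by rewrite gt_eqF.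
pose k := flux r / (3 * c).
pose f t := g t + k * t^-1.
have df : is_derive r 1 f 0.
  apply: (@isd_sq _ _ _ (32 * bound (r / 2))).
  near=> t.
  have /andP[t1 t2] : r / 2 < t < 2 * r.
    have : `|t - r| < r / 2 by near: t; exact: near_dist.
    by rewrite ltr_norml => /andP[h1 h2]; apply/andP; split; lra.
  have t0 : 0 < t by exact: lt_trans t1.
  have E : `|f t - f r| = `|3 * c * (f t - f r)| / (3 * c).
    by rewrite normrM (@gtr0_norm _ (3 * c)) ?mulr_gt0//; field.
  rewrite E ler_pdivrMr ?mulr_gt0//.
  have [tr|rt|->] := ltgtP t r; last by rewrite !subrr expr0n/= !mulr0 normr0 mul0r.
    have pt : pos_below t by move=> u u0 ut; apply: ps => //; lra.
    have := @step_right (r / 2) t r r20 (ltW t1) tr (ltac:(lra)) pt.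
    have -> : 3 * c * (f t - f r) = - (3 * c * (g r - g t) - (t^-1 - r^-1) * flux r).
      by rewrite /f /k; field; rewrite ?(gt_eqF t0) ?rn ?cn.
    rewrite normrN -(sqrrN (t - r)) opprB; lra.
  have pt : pos_below r by move=> u u0 ut; apply: ps => //; lra.
  have := @step_left (r / 2) r t r20 (ltac:(lra)) rt (ltac:(lra)) pt.
  have -> : 3 * c * (f t - f r) = 3 * c * (g t - g r) - (r^-1 - t^-1) * flux r.
    by rewrite /f /k; field; rewrite ?(gt_eqF t0) ?rn ?cn.
  move=> h; apply: (le_trans h).
  have : 0 <= c * bound (r / 2) * (t - r) ^+ 2.
    by rewrite mulr_ge0 ?sqr_ge0// mulr_ge0 ?bound_ge0// ltW.
  lra.
rewrite (_ : g = fun t => f t - k * t^-1); last by apply/funext => t; rewrite /f addrK.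
apply: isd_eq (isdB df (isdZ k (isdV rn (isd_id r)))) _.
by rewrite /k; field; rewrite ?rn ?cn.
Unshelve. all: by end_near. Qed.

Lemma mass_derivable r s : 0 < r -> r < s -> pos_below s ->
  is_derive r 1 m (3 * c * r ^+ 2 * g r).
Proof.
move=> r0 rs ps; apply: shell_derivative => //; first exact: ltW.
exact: isd_continuous (profile_derivable r0 rs ps).
Qed.

(** If [g] never vanished, [flux_le0] would bound [beta * c * a ^+ 3] by
[lam * B] for every [a]. *)
Lemma profile_vanishes : exists2 r, 0 < r & g r = 0.
Proof.
apply: contrapT => h.
have gp r : 0 < r -> 0 < g r.
  by move=> r0; rewrite lt_neqAle g_ge0 andbT; apply/negP => /eqP e; apply: h; exists r.
have bc : 0 < beta * c by exact: mulr_gt0.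
have B0 : 0 <= B by exact: le_trans (m_le 1).
have q0 : 0 <= lam * B / (beta * c) by rewrite divr_ge0 ?mulr_ge0// ltW.
pose a := 1 + lam * B / (beta * c).
have a0 : 0 < a by rewrite ltr_wpDr.
have := @flux_le0 a a0 (fun r r0 _ => gp r r0); rewrite /flux.
have := ler_wpM2l (ltW lam0) (m_le a).
have a3 : a <= a ^+ 3.
  by rewrite -[leLHS]expr1; apply: ler_weXn2l => //; rewrite lerDl.
have := ler_wpM2l (ltW bc) a3.
have -> : beta * c * a = beta * c + lam * B.
  by rewrite /a; field; rewrite !gt_eqF.
lra.
Qed.

Lemma free_radius : exists2 rho, 0 < rho &
  pos_below rho /\ forall r, rho < r -> g r = 0.
Proof.
have [z z0 gz] := profile_vanishes; have [y y0 gy] := g_nontrivial.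
pose S : set R := [set r | 0 < r /\ 0 < g r].
have Sz : ubound S z.
  move=> r [r0 gr]; rewrite leNgt; apply/negP => /ltW zr.
  by have := g_noninc z0 zr; rewrite gz leNgt gr.
have Sy : S y by [].
have hS : has_sup S by split; [exists y|exists z].
exists (sup S); first exact: lt_le_trans (ub_le_sup hS.2 Sy).
split=> [r r0 rS|r Sr].
  have [s [s0 gs] rs] := sup_gt hS.1 rS.
  exact: lt_le_trans (g_noninc r0 (ltW rs)).
apply/eqP; rewrite eq_le g_ge0 andbT leNgt; apply/negP => gr.
have Sr' : S r by split=> //; apply: lt_trans Sr; exact: lt_le_trans (ub_le_sup hS.2 Sy).
by move: (ub_le_sup hS.2 Sr'); rewrite leNgt Sr.
Qed.

Section FreeBoundary.
Variable rho : R.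
Hypotheses (rad0 : 0 < rho) (inside : pos_below rho)
  (outside : forall r, rho < r -> g r = 0).

(** Beyond [rho] the profile is 0, and [step_left] bounds the increment from
[rho - e] to [rho + e] by a multiple of [e]. *)
Lemma profile_boundary : g rho = 0.
Proof.
apply/eqP; rewrite eq_le g_ge0 andbT.
have d0 : 0 < rho / 2 by rewrite divr_gt0.
have B0 : 0 <= B by exact: le_trans (m_le 1).
have c30 : 0 < 3 * c by rewrite mulr_gt0.
pose K := (2 / (rho / 2) ^+ 2 * (lam * B) + 96 * c * bound (rho / 2) * (2 * rho)) / (3 * c).
apply: (@ler_small _ _ _ K (rho / 2)) => //.
  apply: divr_ge0; last exact: ltW.
  apply: addr_ge0; first by rewrite mulr_ge0 ?divr_ge0 ?sqr_ge0// mulr_ge0// ltW.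
  by rewrite !mulr_ge0 ?bound_ge0// ltW.
move=> e e0 er; rewrite add0r.
have a0 : 0 < rho - e by lra.
have ab : rho - e < rho + e by lra.
have pa : pos_below (rho - e) by move=> u u0 ut; apply: inside => //; lra.
have da : rho / 2 <= rho - e by lra.
have := @step_left (rho / 2) (rho - e) (rho + e) d0 da ab (ltac:(lra)) pa.
rewrite (outside (_ : rho < rho + e)) ?ltrDl// sub0r.
have i1 := inv_diff_le d0 da (ltW ab).
have i2 := inv_diff_ge0 a0 (ltW ab).
have gr : g rho <= g (rho - e) by apply: g_noninc => //; lra.
have f1 : - flux (rho - e) <= lam * B.
  have h1 := ler_wpM2l (ltW lam0) (m_le (rho - e)).
  have h2 : 0 <= beta * (c * (rho - e) ^+ 3).
    by rewrite mulr_ge0 ?(ltW beta0)// mulr_ge0 ?(ltW c0)// exprn_ge0// ltW.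
  by rewrite /flux; lra.
have lB : 0 <= lam * B by rewrite mulr_ge0// ltW.
move: i1; rewrite (_ : rho + e - (rho - e) = 2 * e); last by ring.
rewrite (_ : 2 * e / (rho / 2) ^+ 2 = 2 / (rho / 2) ^+ 2 * e); last by ring.
have KE x : 3 * c * x <= (2 / (rho / 2) ^+ 2 * (lam * B) + 96 * c * bound (rho / 2) * (2 * rho)) * e ->
    x <= K * e.
  by rewrite /K [_ / _ * e]mulrAC ler_pdivlMr// (mulrC x).
move=> i1 h; apply: KE; move: i1 h.
move: i2 f1 => + + i1; move: (_^-1 - _) (flux _) i1 => T F i1 T0 f1; rewrite ler_norml => /andP[+ _].
have := ler_wpM2l T0 f1; have := ler_wpM2r lB i1.
have := ler_wpM2l (ltW c30) gr.
have ee : (2 * e) ^+ 2 <= 2 * (2 * rho) * e.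
  by rewrite exprMn expr2; nra.
have k0 : 0 <= 48 * c * bound (rho / 2) by rewrite !mulr_ge0 ?bound_ge0// ltW.
have := ler_wpM2l k0 ee.
move: (2 / _ ^+ 2) => w; lra.
Qed.

(** [g] is 0 at both ends of a step that starts at [rho], so [increment_le]
excludes a negative flux. *)
Lemma flux_boundary : flux rho = 0.
Proof.
apply/eqP; rewrite eq_le flux_le0//=.
apply: (@ler_small _ _ _ ((beta + lam * g rho) * (c * (12 * rho ^+ 2))) rho) => //.
  rewrite mulr_ge0//; first by rewrite addr_ge0 ?mulr_ge0// ltW.
  by rewrite mulr_ge0 ?(ltW c0)// mulr_ge0// sqr_ge0.
move=> e e0 er; have ab : rho < rho + e by rewrite ltrDl.
have := increment_le rad0 ab inside.
rewrite (outside ab) profile_boundary subrr mulr0 pmulr_rge0; last first.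
  by rewrite subr_gt0 ltf_pV2 ?posrE// addr_gt0.
move=> h; apply: (le_trans h); rewrite lerD2l -!mulrA.
apply: ler_wpM2l; first by rewrite mulr0 addr0 ltW.
apply: ler_wpM2l; first exact: ltW.
apply: (le_trans (cube_diff_le (ltW rad0) (ltW ab) (_ : _ <= 2 * rho))); first by lra.
by rewrite (_ : rho + e - rho = e); [rewrite exprMn; lra|ring].
Qed.

(** With [flux rho = 0] and [g rho = 0], only the quadratic error of [step_right]
remains. *)
Lemma profile_flat : \forall t \near rho, g t <= 32 * bound (rho / 2) * (t - rho) ^+ 2.
Proof.
have d0 : 0 < rho / 2 by rewrite divr_gt0.
near=> t.
have /andP[t1 t2] : rho / 2 < t < 2 * rho.
  have : `|t - rho| < rho / 2 by near: t; exact: near_dist.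
  by rewrite ltr_norml => /andP[h1 h2]; apply/andP; split; lra.
have rhs0 : 0 <= 32 * bound (rho / 2) * (t - rho) ^+ 2.
  by rewrite mulr_ge0 ?sqr_ge0// mulr_ge0 ?bound_ge0.
have [tr|rt|->] := ltgtP t rho.
- have pt : pos_below t by move=> u u0 ut; apply: inside => //; lra.
  have := @step_right (rho / 2) t rho d0 (ltW t1) tr (ltac:(lra)) pt.
  rewrite flux_boundary profile_boundary mulr0 subr0 sub0r mulrN normrN.
  move=> /ler_normlW h; rewrite -(ler_pM2l (_ : 0 < 3 * c)) ?mulr_gt0//.
  by apply: (le_trans h); rewrite -(sqrrN (t - rho)) opprB; lra.
- by rewrite outside.
- by rewrite profile_boundary subrr expr0n/= mulr0.
Unshelve. all: by end_near. Qed.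

Let mu := Num.sqrt lam.

Lemma sin_bounds (z : R) : 0 <= z -> `|sin z| <= z.
Proof.
move=> z0.
have h1 : 0 - sin 0 <= z - sin z.
  apply: (@isd_le _ (fun t => t - sin t) (fun t => 1 - cos t)) => //.
have h2 : 0 + sin 0 <= z + sin z.
  apply: (@isd_le _ (fun t => t + sin t) (fun t => 1 + cos t)) => //.
move: h1 h2; rewrite sin0 => h1 h2; rewrite ler_norml; apply/andP; split; lra.
Qed.

Lemma sin_defect (z : R) : 0 <= z -> `|z * cos z - sin z| <= z ^+ 3.
Proof.
move=> z0.
have d (t : R) : is_derive t 1 (fun t => t * cos t - sin t) (- (t * sin t)).
  apply: isd_eq (isdB (isdM (isd_id t) (is_derive_cos t)) (is_derive_sin t)) _; ring.
have d3 (t : R) : is_derive t 1 (fun t => t ^+ 3) (3 * t ^+ 2).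
  by apply: isd_eq (isdX 3 (isd_id t)) _; rewrite mulr1.
have b (t : R) : 0 <= t -> `|t * sin t| <= t ^+ 2.
  by move=> t0; rewrite normrM ger0_norm// expr2 ler_wpM2l// sin_bounds.
have h1 : 0 ^+ 3 - (0 * cos 0 - sin 0) <= z ^+ 3 - (z * cos z - sin z).
  apply: (@isd_le _ (fun t => t ^+ 3 - (t * cos t - sin t)) (fun t => 3 * t ^+ 2 - (- (t * sin t)))) => // t.
  move=> /andP[t0 _]; have := b t (ltW t0); rewrite ler_norml => /andP[? ?].
  have := sqr_ge0 t; lra.
have h2 : 0 ^+ 3 + (0 * cos 0 - sin 0) <= z ^+ 3 + (z * cos z - sin z).
  apply: (@isd_le _ (fun t => t ^+ 3 + (t * cos t - sin t)) (fun t => 3 * t ^+ 2 + (- (t * sin t)))) => // t.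
  move=> /andP[t0 _]; have := b t (ltW t0); rewrite ler_norml => /andP[? ?].
  have := sqr_ge0 t; lra.
move: h1 h2; rewrite sin0 mul0r subr0 expr0n/= => h1 h2.
rewrite ler_norml; apply/andP; split; lra.
Qed.

(* Here w' = v and v' = - lam * w. *)
Let w r := r * (g r - beta / lam).
Let v r := (g r - beta / lam) + flux r / (3 * c * r).

Lemma mu_gt0 : 0 < mu. Proof. by rewrite sqrtr_gt0. Qed.

Lemma mu_sqr : mu ^+ 2 = lam. Proof. by rewrite sqr_sqrtr// ltW. Qed.

Lemma w_derive r : 0 < r -> r < rho -> is_derive r 1 w (v r).
Proof.
move=> r0 rr; have dg := profile_derivable r0 rr inside.
apply: isd_eq (isdM (isd_id r) (isdB dg (isd_cst (beta / lam) r))) _.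
rewrite /v; move: (flux r) (g r) (beta / lam) => F G k.
by field; rewrite !gt_eqF.
Qed.

Lemma v_derive r : 0 < r -> r < rho -> is_derive r 1 v (- lam * w r).
Proof.
move=> r0 rr; have dg := profile_derivable r0 rr inside.
have dm := mass_derivable r0 rr inside.
have r3 : 3 * c * r != 0 by rewrite !mulf_neq0// gt_eqF.
have dF : is_derive r 1 flux (beta * (c * (3 * r ^+ 2)) - lam * (3 * c * r ^+ 2 * g r)).
  have d3 : is_derive r 1 (fun t => t ^+ 3) (3 * r ^+ 2).
    by apply: isd_eq (isdX 3 (isd_id r)) _; rewrite mulr1.
  exact: (isdB (isdZ beta (isdZ c d3)) (isdZ lam dm)).
have d1 := isdM dF (isdV r3 (isdZ (3 * c) (isd_id r))).
apply: isd_eq (isdD (isdB dg (isd_cst (beta / lam) r)) d1) _.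
rewrite /w; move: (flux r) (g r) => F G.
by field; rewrite !gt_eqF.
Qed.

Let dsin (r : R) : is_derive r 1 (fun t => sin (mu * t)) (mu * cos (mu * r)).
Proof.
apply: (@isd_eq _ _ _ (cos (mu * r) * (mu * 1))); last by rewrite mulr1 mulrC.
Qed.

Let dcos (r : R) : is_derive r 1 (fun t => cos (mu * t)) (- (mu * sin (mu * r))).
Proof.
apply: (@isd_eq _ _ _ (- sin (mu * r) * (mu * 1))); last by rewrite mulr1; ring.
Qed.

(* The coordinates of w in the basis of sin (mu r) and cos (mu r). *)
Let a1 r := w r * sin (mu * r) + mu^-1 * v r * cos (mu * r).
Let b1 r := w r * cos (mu * r) - mu^-1 * v r * sin (mu * r).

Let constant (f : R -> R) r s : (forall t, 0 < t -> t < rho -> is_derive t 1 f 0) ->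
  0 < r < rho -> 0 < s < rho -> f r = f s.
Proof.
move=> df; wlog rs : r s / r <= s.
  move=> H hr hs; have [/H|/ltW/H h] := leP r s; first exact.
  by rewrite h.
move=> /andP[r0 _] /andP[_ s1]; apply: (@isd_eq_cst _ f (fun=> 0) r s rs) => // t /andP[tr ts].
by apply: df; [exact: lt_le_trans tr|exact: le_lt_trans s1].
Qed.

Lemma a1_derive r : 0 < r -> r < rho -> is_derive r 1 a1 0.
Proof.
move=> r0 rr; have dw := w_derive r0 rr; have dv := v_derive r0 rr.
apply: isd_eq (isdD (isdM dw (dsin r)) (isdM (isdZ mu^-1 dv) (dcos r))) _.
rewrite -mu_sqr; move: mu mu_gt0 (w r) (v r) (sin _) (cos _) => n n0 w1 v1 s1 c1.
by field; rewrite gt_eqF.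
Qed.

Lemma b1_derive r : 0 < r -> r < rho -> is_derive r 1 b1 0.
Proof.
move=> r0 rr; have dw := w_derive r0 rr; have dv := v_derive r0 rr.
apply: isd_eq (isdB (isdM dw (dcos r)) (isdM (isdZ mu^-1 dv) (dsin r))) _.
rewrite -mu_sqr; move: mu mu_gt0 (w r) (v r) (sin _) (cos _) => n n0 w1 v1 s1 c1.
by field; rewrite gt_eqF.
Qed.

Lemma mass_linear r : 0 < r -> r < 1 -> m r <= (1 + c) * r.
Proof.
move=> r0 r1; apply: (le_trans (m_small r0)).
have : c * r ^+ 2 <= c * r.
  by rewrite ler_wpM2l ?(ltW c0)// expr2 ler_piMr ?(ltW r0)// ltW.
have : 0 <= c * r by rewrite mulr_ge0// ltW.
have : 0 <= c * r ^+ 2 by rewrite mulr_ge0 ?sqr_ge0// ltW.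
lra.
Qed.

Lemma profile_cube r : 0 < r -> c * (g r * r ^+ 3) <= 2 * m r.
Proof.
move=> r0; have r20 : 0 < r / 2 by rewrite divr_gt0.
have /andP[h _] := mass_mono r20 (ltac:(lra) : r / 2 <= r).
have := m_ge0 (r / 2); have : 0 <= c * (g r * r ^+ 3).
  by rewrite mulr_ge0 ?(ltW c0)// mulr_ge0// exprn_ge0// ltW.
move: h; rewrite exprMn; lra.
Qed.

(** [w r] tends to 0 at the origin in the mean: the mass of the ball of radius
[s] is [O(s)], and monotonicity bounds [g s * s ^+ 3] by a multiple of that
mass ([profile_cube]). The constant [b1] is therefore at most [K * s] for all
small [s]. *)
Lemma b1_eq0 r : 0 < r < rho -> b1 r = 0.
Proof.
move=> rr; apply/eqP; rewrite -normr_eq0 eq_le normr_ge0 andbT.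
pose k := beta / lam; have k0 : 0 <= k by rewrite divr_ge0// ltW.
pose K := lam * (2 * (1 + c) / c + k) + (beta * c + lam * (1 + c)) / (3 * c).
have c1 : 0 <= 1 + c by rewrite addr_ge0// ltW.
apply: (@ler_small _ _ _ K (Num.min 1 rho)).
- by rewrite lt_min rad0 ltr01.
- rewrite /K !addr_ge0 ?mulr_ge0 ?invr_ge0 ?addr_ge0 ?mulr_ge0 ?invr_ge0//; exact: ltW.
move=> s s0; rewrite lt_min => /andP[s1 sr]; rewrite add0r.
have -> : b1 r = b1 s by apply: (constant b1_derive) => //; rewrite s0 sr.
have n0 := mu_gt0.
have E : b1 s = (g s - k) * ((mu * s * cos (mu * s) - sin (mu * s)) / mu) -
    flux s / (3 * c) * (sin (mu * s) / (mu * s)).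
  rewrite /b1 /w /v -/k; move: mu n0 (g s) (flux s) (sin _) (cos _) => n n0 G F si co.
  by field; rewrite !gt_eqF.
have z0 : 0 <= mu * s by rewrite mulr_ge0// ltW.
have X1 : `|(mu * s * cos (mu * s) - sin (mu * s)) / mu| <= lam * s ^+ 3.
  rewrite normrM normfV (gtr0_norm n0) ler_pdivrMr//.
  by apply: (le_trans (sin_defect z0)); rewrite -mu_sqr le_eqVlt; apply/orP; left; apply/eqP; ring.
have X2 : `|sin (mu * s) / (mu * s)| <= 1.
  have ms : 0 < mu * s by exact: mulr_gt0.
  by rewrite normrM normfV (gtr0_norm ms) ler_pdivrMr// mul1r sin_bounds.
have X3 : `|g s - k| <= g s + k.
  by apply: (le_trans (ler_normB _ _)); rewrite !ger0_norm.
have ml := mass_linear s0 s1.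
have s3 : s ^+ 3 <= s.
  by rewrite -[leRHS]expr1 ler_wiXn2l// ltW.
have s30 : 0 <= s ^+ 3 by rewrite exprn_ge0// ltW.
have X4 : `|flux s| <= (beta * c + lam * (1 + c)) * s.
  apply: (le_trans (ler_normB _ _)); rewrite !ger0_norm; last 2 first.
  - by rewrite mulr_ge0 ?(ltW lam0).
  - by rewrite mulr_ge0 ?(ltW beta0)// mulr_ge0// ltW.
  have h1 := ler_wpM2l (ltW lam0) ml.
  have h2 : beta * c * s ^+ 3 <= beta * c * s by rewrite ler_wpM2l// mulr_ge0// ltW.
  lra.
have X5 : (g s + k) * s ^+ 3 <= (2 * (1 + c) / c + k) * s.
  rewrite mulrDl [leRHS]mulrDl lerD//; last by rewrite ler_wpM2l.
  rewrite mulrAC ler_pdivlMr// mulrC.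
  by apply: (le_trans (profile_cube s0)); lra.
have cc : 0 < 3 * c by rewrite mulr_gt0.
rewrite E; apply: (le_trans (ler_normB _ _)).
rewrite /K [leRHS]mulrDl lerD//.
  rewrite normrM; apply: (@le_trans _ _ ((g s + k) * (lam * s ^+ 3))); first exact: ler_pM.
  by rewrite mulrCA -mulrA ler_wpM2l// ltW.
rewrite normrM -[leRHS]mulr1; apply: ler_pM => //.
by rewrite normrM normfV (gtr0_norm cc) [leRHS]mulrAC ler_pM2r ?invr_gt0.
Qed.

Lemma profile_inside : exists A, forall r, 0 < r -> r < rho ->
  r * (g r - beta / lam) = A * sin (mu * r).
Proof.
exists (a1 (rho / 2)) => r r0 rr.
have r2 : 0 < rho / 2 < rho by apply/andP; split; lra.
have h : 0 < r < rho by rewrite r0 rr.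
have -> : a1 (rho / 2) = a1 r by exact: (constant a1_derive r2 h).
have := b1_eq0 h; rewrite -/(w r) /a1 /b1.
have := sin2cos2 (mu * r).
move: (w r) (mu^-1 * v r) (sin _) (cos _) => p q s t h1 h2.
have h4 : p * s ^+ 2 = p * (1 - t ^+ 2) by rewrite h1.
have := congr1 (fun x => x * t) h2; rewrite mul0r => h3.
lra.
Qed.

End FreeBoundary.

Lemma profile_solution : exists rho A C : R, [/\ 0 < rho, pos_below rho,
  forall r, 0 < r -> r < rho -> r * (g r - beta / lam) = A * sin (Num.sqrt lam * r),
  forall r, rho <= r -> g r = 0 &
  \forall t \near rho, g t <= C * (t - rho) ^+ 2].
Proof.
have [rho rad0 [inside outside]] := free_radius.
have [A hA] := profile_inside rad0 inside.
exists rho, A, (32 * bound (rho / 2)); split=> //.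
  move=> r; rewrite le_eqVlt => /predU1P[<-|]; last exact: outside.
  exact: profile_boundary.
exact: profile_flat.
Qed.

End Profile.

(** * The sine quotient as an entire function *)

Section Sinc.
Context {R : realType}.
Local Notation R3 := (R * R * R)%type.
Implicit Types (a : nat -> R) (t : R).

(** Domination by the coefficients of a multiple of [exp (B x)] is preserved by
termwise differentiation. *)
Definition entire a := exists A B : R, [/\ 0 <= A, 0 <= B &
  forall n, `|a n| <= A * (B ^+ n / n`!%:R)].

Definition power_sum a (x : R) : R := limn (pseries a x).

Lemma entire_cvg a (x : R) : entire a -> cvgn (pseries a x).
Proof.
move=> [A [B [A0 B0 aB]]]; apply: normed_cvg.
apply: (@series_le_cvg _ _ (fun n => A * exp_coeff (B * `|x|) n)) => [n|n|n|].
- exact: normr_ge0.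
- by rewrite mulr_ge0//= divr_ge0// exprn_ge0// mulr_ge0.
- rewrite /exp_coeff/= normrM normrX exprMn.
  rewrite (_ : A * _ = A * (B ^+ n / n`!%:R) * `|x| ^+ n); last by ring.
  by rewrite ler_wpM2r ?exprn_ge0.
- exact/is_cvg_seriesZ/is_cvg_series_exp_coeff.
Qed.

Lemma entire_diffs a : entire a -> entire (pseries_diffs a).
Proof.
move=> [A [B [A0 B0 aB]]]; exists (A * B), B; split=> // [|n]; first exact: mulr_ge0.
rewrite /pseries_diffs normrM normr_nat.
have n0 : n.+1%:R != 0 :> R by rewrite pnatr_eq0.
have nf : n`!%:R != 0 :> R by rewrite pnatr_eq0 -lt0n fact_gt0.
rewrite (_ : A * B * _ = n.+1%:R * (A * (B ^+ n.+1 / n.+1`!%:R))).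
  by rewrite ler_wpM2l.
rewrite factS natrM exprS; move: (n.+1%:R) n0 (n`!%:R) nf (B ^+ n) => p p0 q q0 w.
by field; rewrite p0 q0.
Qed.

Lemma power_sum_derive a (x : R) : entire a ->
  is_derive x 1 (power_sum a) (power_sum (pseries_diffs a) x).
Proof.
move=> ea; have ed := entire_diffs ea.
apply: (@pseries_snd_diffs _ a (`|x| + 1)).
- exact: entire_cvg.
- exact: entire_cvg.
- by apply: entire_cvg; exact: entire_diffs.
- by rewrite (@ger0_norm _ (`|x| + 1)) ?addr_ge0// ltrDl.
Qed.

Lemma power_sum0 a : power_sum a 0 = a 0%N.
Proof.
apply: cvg_lim => //; rewrite -(cvg_shiftS _).
rewrite (_ : [sequence _]_n = cst (a 0%N)); first exact: cvg_cst.
apply/funext => n; rewrite /pseries /series/= big_nat_recl// expr0 mulr1 big1 ?addr0// => i _.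
by rewrite exprS mul0r mulr0.
Qed.

(** The coefficients of [sin (mu * r) / (mu * r)] as a series in [r ^+ 2], for
[lam = mu ^+ 2]; see [sinc_sin]. *)
Definition sinc_coeff (lam : R) n : R := (- lam) ^+ n / (n.*2.+1)`!%:R.

Lemma entire_sinc (lam : R) : entire (sinc_coeff lam).
Proof.
exists 1, `|lam|; split => // n; rewrite mul1r normrM normrX normrN ler_wpM2l//.
rewrite ger0_norm ?invr_ge0// lef_pV2 ?posrE ?ltr0n ?fact_gt0// ler_nat.
by apply: leq_fact; rewrite -addnn -addSn leq_addl.
Qed.

Lemma sinc_sin (mu r : R) :
  mu * r * power_sum (sinc_coeff (mu ^+ 2)) (r ^+ 2) = sin (mu * r).
Proof.
rewrite -(cvg_lim (@norm_hausdorff _ _) (@cvg_sin_coeff' _ (mu * r))); symmetry.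
apply: cvg_lim; first exact: norm_hausdorff.
rewrite (_ : series _ = fun n => mu * r * pseries (sinc_coeff (mu ^+ 2)) (r ^+ 2) n).
  by apply: cvgM; [exact: cvg_cst|exact/entire_cvg/entire_sinc].
apply/funext => n; rewrite /pseries /series/= big_distrr/=; apply: eq_bigr => i _.
rewrite /sin_coeff' /sinc_coeff -exprnP exprS -mul2n exprM (exprMn 2) (exprMn i).
rewrite -(mulN1r (mu ^+ 2)) [(-1 * _) ^+ i]exprMn.
by move: ((-1) ^+ i) (mu ^+ 2 ^+ i) (r ^+ 2 ^+ i) (_^-1) => e u v f; ring.
Qed.

Local Notation H lam := (power_sum (sinc_coeff lam)).
Local Notation H1 lam := (power_sum (pseries_diffs (sinc_coeff lam))).
Local Notation H2 lam := (power_sum (pseries_diffs (pseries_diffs (sinc_coeff lam)))).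

(** For [t = r ^+ 2 > 0] differentiate [mu * r * H (r ^+ 2) = sin (mu * r)] twice;
at [t = 0] compare the first two coefficients. *)
Lemma sinc_ode (mu t : R) : 0 < mu -> 0 <= t ->
  4 * t * H2 (mu ^+ 2) t + 6 * H1 (mu ^+ 2) t + mu ^+ 2 * H (mu ^+ 2) t = 0.
Proof.
move=> mu0; set lam := mu ^+ 2.
have eh := entire_sinc lam; have eh1 := entire_diffs eh.
rewrite le_eqVlt => /predU1P[<-|t0].
  rewrite mulr0 mul0r add0r !power_sum0 /pseries_diffs /sinc_coeff.
  rewrite expr0 expr1 (_ : (0.*2.+1)`! = 1)%N// (_ : (1.*2.+1)`! = 6)%N//.
  by field.
pose r := Num.sqrt t; have r0 : 0 < r by rewrite sqrtr_gt0.
have -> : t = r ^+ 2 by rewrite sqr_sqrtr// ltW.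
have d2 (s : R) : is_derive s 1 (fun s => s ^+ 2) (2 * s).
  by apply: isd_eq (isdX 2 (isd_id s)) _; rewrite mulr1.
have dH (s : R) : is_derive s 1 (fun s => H lam (s ^+ 2)) (H1 lam (s ^+ 2) * (2 * s)).
  exact: isd_comp (power_sum_derive _ eh) (d2 s).
have dH1 (s : R) : is_derive s 1 (fun s => H1 lam (s ^+ 2)) (H2 lam (s ^+ 2) * (2 * s)).
  exact: isd_comp (power_sum_derive _ eh1) (d2 s).
have dm (s : R) : is_derive s 1 (fun s => mu * s) mu.
  by apply: isd_eq (isdZ mu (isd_id s)) _; rewrite mulr1.
have e1 (s : R) : H lam (s ^+ 2) + 2 * s ^+ 2 * H1 lam (s ^+ 2) = cos (mu * s).
  have A1 := isdM (dm s) (dH s).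
  have E : (fun s => mu * s * H lam (s ^+ 2)) = (fun s => sin (mu * s)).
    by apply/funext => u; exact: sinc_sin.
  rewrite E in A1.
  have := isd_unique A1 (isd_comp (is_derive_sin (mu * s)) (dm s)).
  move=> h; apply: (mulfI (lt0r_neq0 mu0)); rewrite (mulrC mu (cos _)) -h; ring.
have A1 := isdD (dH r) (isdM (isdZ 2 (d2 r)) (dH1 r)).
have E : (fun s => H lam (s ^+ 2) + 2 * s ^+ 2 * H1 lam (s ^+ 2)) = (fun s => cos (mu * s)).
  by apply/funext => u; exact: e1.
rewrite E in A1.
have h := isd_unique A1 (isd_comp (is_derive_cos (mu * r)) (dm r)).
have hs : mu * r * H lam (r ^+ 2) = sin (mu * r) by exact: sinc_sin.
apply: (mulfI (lt0r_neq0 r0)); rewrite mulr0.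
move: h; rewrite -hs /lam; move: (H _ (r ^+ 2)) (H1 _ (r ^+ 2)) (H2 _ (r ^+ 2)) => h0 h1 h2 h.
lra.
Qed.

Lemma Ck_congr k (A : set R3) (f g : R3 -> R) : open A ->
  (forall x, A x -> f x = g x) -> Ck k A f -> Ck k A g.
Proof.
move=> oA; have nb (h1 h2 : R3 -> R) x : (forall y, A y -> h1 y = h2 y) -> A x -> \forall y \near x, h1 y = h2 y.
  by move=> h Ax; apply: filterS (open_nbhs_nbhs (conj oA Ax)) => y; exact: h.
have cont (h1 h2 : R3 -> R) x : (forall y, A y -> h1 y = h2 y) -> A x ->
    {for x, continuous h1} -> {for x, continuous h2}.
  move=> h Ax; rewrite /prop_for /continuous_at -(h x Ax) => ch; apply: cvg_trans ch.
  by apply: near_eq_cvg; exact: nb.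
elim: k f g => [|k IH] f g fg /= [cf df].
  by split=> // x Ax; exact: cont (cf x Ax).
split=> [x Ax|i]; first exact: cont (cf x Ax).
have [di Cki] := df i; split=> [x Ax|].
  by apply: near_eq_derivable (di x Ax); exact: nb.
apply: IH Cki => x Ax; rewrite /partial; apply: near_eq_derive; exact: nb.
Qed.

End Sinc.

(** * Functions of the squared norm *)

Section Radial.
Context {R : realType}.
Local Notation R3 := (R * R * R)%type.
Variables (k a : R) (h h1 h2 : R -> R).
Hypothesis dh : forall t : R, is_derive t 1 h (h1 t).
Hypothesis dh1 : forall t : R, is_derive t 1 h1 (h2 t).
Hypothesis ch2 : continuous h2.

Let f (y : R3) := k + a * h (sqn y).

Lemma partial_sqn i : (forall x, is_derive x (basis i) f (2 * a * (coord i x * h1 (sqn x)))) /\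
  partial i f = fun x => 2 * a * (coord i x * h1 (sqn x)).
Proof.
have d x : is_derive x (basis i) f (2 * a * (coord i x * h1 (sqn x))).
  have := is_deriveD (is_derive_cst k x (basis i))
    (is_deriveM (is_derive_cst a x (basis i)) (is_derive_comp_sqn i (dh (sqn x)))).
  move=> d; apply: (is_derive_eq d); rewrite scaler0 addr0 add0r.
  by rewrite -[LHS]/(a * _); ring.
by split=> //; apply/funext => x; exact: derive_val.
Qed.

Lemma partial2_sqn i j : let f2 x := 2 * a * ((i == j)%:R * h1 (sqn x) +
    coord i x * (2 * coord j x * h2 (sqn x))) in
  (forall x, is_derive x (basis j) (partial i f) (f2 x)) /\ partial j (partial i f) = f2.
Proof.
move=> f2; rewrite (partial_sqn i).2.
have d x : is_derive x (basis j) (fun x => 2 * a * (coord i x * h1 (sqn x))) (f2 x).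
  have := is_deriveM (is_derive_cst (2 * a) x (basis j))
    (is_deriveM (is_derive_coord i j x) (is_derive_comp_sqn j (dh1 (sqn x)))).
  move=> d; apply: (is_derive_eq d); rewrite scaler0 addr0 /f2.
  rewrite -[LHS]/(2 * a * (coord i x * (2 * coord j x * h2 (sqn x)) + h1 (sqn x) * (i == j)%:R)).
  by congr (_ * _); rewrite addrC; congr (_ + _); exact: mulrC.
by split=> //; apply/funext => x; exact: derive_val.
Qed.

Lemma comp_sqn_continuous (u : R -> R) : continuous u -> continuous (fun x : R3 => u (sqn x)).
Proof. by move=> cu x; apply: continuous_comp; [exact: sqn_continuous|exact: cu]. Qed.

Lemma Ck2_sqn (A : set R3) : Ck 2 A f.
Proof.
have ch : continuous h by move=> t; exact: isd_continuous (dh t).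
have ch1 : continuous h1 by move=> t; exact: isd_continuous (dh1 t).
have c0 (z : R) : continuous (fun _ : R3 => z) by move=> x; exact: cvg_cst.
have cM (u v : R3 -> R) : continuous u -> continuous v -> continuous (fun x => u x * v x).
  by move=> cu cv x; apply: cvgM; [exact: cu|exact: cv].
have cD (u v : R3 -> R) : continuous u -> continuous v -> continuous (fun x => u x + v x).
  by move=> cu cv x; apply: cvgD; [exact: cu|exact: cv].
split=> [x _|i].
  by apply: (cD) => //; apply: (cM) => //; exact: comp_sqn_continuous.
split=> [x _|]; first by case: ((partial_sqn i).1 x).
split=> [x _|j].
  rewrite (partial_sqn i).2; apply: (cM) => //; apply: (cM); last exact: comp_sqn_continuous.
  exact: coord_continuous.
split=> [x _|]; first by case: ((partial2_sqn i j).1 x).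
split=> // x _; rewrite (partial2_sqn i j).2.
apply: (cM) => //; apply: (cD); apply: (cM) => //; first exact: comp_sqn_continuous.
  exact: coord_continuous.
apply: (cM); last exact: comp_sqn_continuous.
by apply: (cM) => //; exact: coord_continuous.
Qed.

(** The second derivative [d_i d_i] of [h (sqn x)] is
[2 h1 + 4 x_i ^+ 2 h2]. *)
Lemma laplacian_sqn x : laplacian f x = a * (6 * h1 (sqn x) + 4 * sqn x * h2 (sqn x)).
Proof.
rewrite /laplacian (eq_bigr (fun i => 2 * a * h1 (sqn x) + 4 * a * h2 (sqn x) * coord i x ^+ 2)).
  rewrite big_split/= sumr_const card_ord -big_distrr/= sum_coord_sqr -mulr_natl.
  by ring.
move=> i _; rewrite (partial2_sqn i i).2 eqxx (_ : true%:R = 1)//; ring.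
Qed.

End Radial.

(** * The equation in the ball and on its boundary *)

Section Final.
Context {R : realType}.
Local Notation R3 := (R * R * R)%type.

Lemma open_eball (r : R) : open (eball r : set R3).
Proof.
rewrite (_ : eball r = (@enorm R) @^-1` [set s | s < r])//.
by apply: open_comp; [move=> x _; exact: enorm_continuous|exact: open_lt].
Qed.

Lemma enorm_scale (s : R) (x : R3) : enorm (s *: x) = `|s| * enorm x.
Proof.
case: x => -[x y] z; rewrite /enorm /= -![s *: _]/(s * _) !exprMn -!mulrDr.
by rewrite sqrtrM ?sqr_ge0// sqrtr_sqr.
Qed.

Variables (beta mu rho A C : R) (phi : R3 -> R) (g : R -> R).
Hypotheses (mu0 : 0 < mu) (rho0 : 0 < rho).
Hypothesis phiE : forall x, phi x = g (enorm x).
Hypothesis g_ge0 : forall r, 0 <= g r.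
Hypothesis g_noninc : forall r s, 0 < r -> r <= s -> g s <= g r.
Hypothesis g_inside : forall r, 0 < r -> r < rho -> 0 < g r.
Hypothesis g_sin : forall r, 0 < r -> r < rho ->
  r * (g r - beta / mu ^+ 2) = A * sin (mu * r).
Hypothesis g_outside : forall r, rho <= r -> g r = 0.
Hypothesis g_flat : \forall t \near rho, g t <= C * (t - rho) ^+ 2.
Hypothesis phi0E : forall b, 0 < b ->
  (forall t, 0 < t -> (exists2 r, 0 < r & t < g r) <-> t < b) -> phi 0 = b.

Let H := power_sum (sinc_coeff (mu ^+ 2)).
Let sol r := beta / mu ^+ 2 + A * mu * H (r ^+ 2).

Lemma g_sol r : 0 < r -> r < rho -> g r = sol r.
Proof.
move=> r0 rr; have rn : r != 0 by rewrite gt_eqF.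
apply: (mulfI rn); rewrite /sol mulrDr.
have := g_sin r0 rr; rewrite -sinc_sin -/H => h.
have -> : r * (A * mu * H (r ^+ 2)) = A * (mu * r * H (r ^+ 2)) by ring.
by rewrite -h; ring.
Qed.

Lemma sol_continuous : continuous sol.
Proof.
move=> r; apply: cvgD; first exact: cvg_cst.
apply: cvgM; first exact: cvg_cst.
apply: continuous_comp; first exact: exprn_continuous.
exact: isd_continuous (power_sum_derive _ (entire_sinc _)).
Qed.

Lemma g_le_sol0 r : 0 < r -> g r <= sol 0.
Proof.
move=> r0; apply/ler_addgt0Pr => e e0.
have : \forall s \near (0 : R), `|sol 0 - sol s| < e.
  by have /cvgrPdist_lt := @sol_continuous 0; apply.
move=> /nbhs_ballP[d /= d0 hd].
pose m := Num.min d (Num.min r rho).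
have m0 : 0 < m by rewrite !lt_min d0 r0 rho0.
have md : m <= d by rewrite ge_min lexx.
have mr : m <= r by rewrite !ge_min lexx orbT.
have mq : m <= rho by rewrite !ge_min lexx !orbT.
have s0 : 0 < m / 2 by rewrite divr_gt0.
have := hd (m / 2); rewrite /ball/= sub0r normrN gtr0_norm// => /(_ (ltac:(lra))).
rewrite ltr_norml => /andP[h _].
apply: (@le_trans _ _ (g (m / 2))); first by apply: g_noninc => //; lra.
by rewrite g_sol//; lra.
Qed.

(** Continuity and monotonicity make [sol 0] the supremum of [g], which is the
value that [phi0E] asks for. *)
Lemma phi_origin : phi 0 = sol 0.
Proof.
have b0 : 0 < sol 0.
  have r2 : 0 < rho / 2 by rewrite divr_gt0.
  apply: lt_le_trans (g_le_sol0 r2); apply: g_inside => //; lra.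
apply: phi0E => // t t0; split=> [[r r0 tr]|tb].
  exact: lt_le_trans tr (g_le_sol0 r0).
have e0 : 0 < sol 0 - t by rewrite subr_gt0.
have : \forall s \near (0 : R), `|sol 0 - sol s| < sol 0 - t.
  by have /cvgrPdist_lt := @sol_continuous 0; apply.
move=> /nbhs_ballP[d /= d0 hd].
pose m := Num.min d rho.
have m0 : 0 < m by rewrite lt_min d0 rho0.
have md : m <= d by rewrite ge_min lexx.
have mq : m <= rho by rewrite !ge_min lexx !orbT.
have s0 : 0 < m / 2 by rewrite divr_gt0.
exists (m / 2) => //.
have := hd (m / 2); rewrite /ball/= sub0r normrN gtr0_norm// => /(_ (ltac:(lra))).
rewrite ltr_norml => /andP[_ h]; rewrite g_sol//; lra.
Qed.

Lemma phi_inside x : enorm x < rho -> phi x = beta / mu ^+ 2 + A * mu * H (sqn x).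
Proof.
move=> xr; have [x0|x0] := eqVneq (enorm x) 0.
  have -> : x = 0 by exact: enorm_eq0.
  by rewrite phi_origin /sol -enorm_sqr enorm0.
by rewrite phiE g_sol// ?lt_def ?x0 ?enorm_ge0// /sol enorm_sqr.
Qed.

Lemma g_derive0 r : rho <= r -> \forall t \near r, `|g t - g r| <= C * (t - r) ^+ 2.
Proof.
move=> rr; rewrite (g_outside rr); move: rr; rewrite le_eqVlt => /predU1P[<-|rr].
  by apply: filterS g_flat => t gt; rewrite subr0 ger0_norm.
have C0 : 0 <= C.
  have [d /= d0 hd] := (iffLR (nbhs_ballP _ _) g_flat).
  have d2 : 0 < d / 2 by rewrite divr_gt0.
  have := hd (rho + d / 2); rewrite /ball/= opprD addrA subrr sub0r normrN gtr0_norm//.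
  move=> /(_ (ltac:(lra))) h; have {h} := le_trans (g_ge0 _) h.
  by rewrite addrC addKr pmulr_lge0// exprn_gt0.
near=> t; rewrite subr0 g_outside.
  by rewrite normr0 mulr_ge0// sqr_ge0.
by apply: ltW; near: t; exact: lt_nbhsr.
Unshelve. all: by end_near. Qed.

Lemma phi_Ck2 : Ck 2 (eball rho) phi.
Proof.
apply: (@Ck_congr _ _ _ (fun x => beta / mu ^+ 2 + A * mu * H (sqn x))).
- exact: open_eball.
- by move=> x xr; rewrite phi_inside.
have e0 := entire_sinc (mu ^+ 2); have e1 := entire_diffs e0.
apply: Ck2_sqn => t; [exact: power_sum_derive|exact: power_sum_derive|].
exact: isd_continuous (power_sum_derive t (entire_diffs e1)).
Qed.

Lemma phi_continuous : continuous phi.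
Proof.
move=> x; have [xr|xr] := ltP (enorm x) rho.
  by have [c _] := phi_Ck2; exact: c.
rewrite (_ : phi = fun x => g (enorm x)); last by apply/funext => y; exact: phiE.
apply: continuous_comp; first exact: enorm_continuous.
exact: isd_continuous (isd_sq (g_derive0 xr)).
Qed.

Lemma phi_helmholtz x : enorm x < rho -> laplacian phi x + mu ^+ 2 * phi x = beta.
Proof.
move=> xr; pose f (y : R3) := beta / mu ^+ 2 + A * mu * H (sqn y).
have nb (u v : R3 -> R) y : eball rho y -> (forall z, eball rho z -> u z = v z) ->
    \forall z \near y, u z = v z.
  by move=> yr uv; apply: filterS (open_nbhs_nbhs (conj (@open_eball rho) yr)).
have -> : laplacian phi x = laplacian f x.
  apply: eq_bigr => i _; apply: near_eq_derive; apply: (nb) => // y yr.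
  by apply: near_eq_derive; apply: (nb) => // z zr; exact: phi_inside.
have e0 := entire_sinc (mu ^+ 2); have e1 := entire_diffs e0.
rewrite (laplacian_sqn _ _ (fun t => power_sum_derive t e0) (fun t => power_sum_derive t e1)).
have s0 : 0 <= sqn x by exact: sqn_ge0.
rewrite phi_inside// /H; have := sinc_ode mu0 s0.
move: (power_sum _ _) (power_sum _ _) (power_sum _ _) => p0 p1 p2 ode.
have -> : mu ^+ 2 * (beta / mu ^+ 2 + A * mu * p0) = beta + A * mu * (mu ^+ 2 * p0).
  by field; rewrite gt_eqF.
have -> : mu ^+ 2 * p0 = - (4 * sqn x * p2 + 6 * p1).
  by apply/eqP; rewrite -addr_eq0 addrC ode.
by ring.
Qed.

(** Along the normal line [phi] is [g |s + rho|], which is quadratically flat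
at [s = 0]. *)
Lemma phi_neumann x : enorm x = rho -> is_derive x (rho^-1 *: x) phi 0.
Proof.
move=> xr; apply: is_derive_dir.
have E s : phi (s *: (rho^-1 *: x) + x) = g `|s + rho|.
  rewrite phiE scalerA -{2}[x]scale1r -scalerDl enorm_scale xr -{2}(gtr0_norm rho0) -normrM.
  by congr (g `|_|); field; rewrite gt_eqF.
apply: (@isd_sq _ _ _ C).
have h : \forall s \near (0 : R), `|g (s + rho) - g rho| <= C * (s + rho - rho) ^+ 2.
  have c : (fun s : R => s + rho) @ (0 : R) --> rho.
    by rewrite -{2}[rho]add0r; apply: cvgD; [exact: cvg_id|exact: cvg_cst].
  by have := c _ (g_derive0 (lexx rho)).
near=> s; have hs : `|g (s + rho) - g rho| <= C * (s + rho - rho) ^+ 2 by near: s.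
have : `|s - 0| < rho by near: s; exact: near_dist.
rewrite subr0 ltr_norml => /andP[sr _].
rewrite !E add0r (gtr0_norm rho0) (@ger0_norm _ (s + rho)); first by rewrite addrK in hs.
by lra.
Unshelve. all: by end_near. Qed.

Lemma phi_solution : helmholtz_solution beta mu rho phi.
Proof.
split; first by split; [exact: phi_Ck2|exact: phi_continuous].
- exact: phi_helmholtz.
- by move=> x xr; rewrite phiE g_outside.
- exact: phi_neumann.
Qed.

End Final.

Theorem theorem8 (R : realType) (beta : R) (phi : R * R * R -> R)
    (beta_gt0 : 0 < beta)
    (phi_min : is_minimizer beta phi)
    (phi_symm : forall x, phi x = symm_rearr phi x) :
  exists mu rad : R,
    [/\ 0 < mu, 0 < rad & helmholtz_solution beta mu rad phi].
Proof.
have [G adm gmin] := phi_min; have phi_i := phi_intg adm.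
pose lam := lagrange beta phi G.
have lam0 : 0 < lam := lagrange_gt0 beta_gt0 adm (phi_ge0 phi_symm phi_i).
have mu0 : 0 < Num.sqrt lam by rewrite sqrtr_gt0.
have [rho [A [C [rho0 inside gsin outside flat]]]] :=
  profile_solution ball_vol_gt0 beta_gt0 lam0 (rad_ge0 phi_symm phi_i)
    (rad_noninc phi_symm phi_i) (mass_shell adm phi_symm) (mass_ge0 adm phi_symm)
    (mass_le adm phi_symm) (mass_small adm) (rad_nontrivial adm phi_symm)
    (flux_inequality beta_gt0 adm gmin phi_symm).
exists (Num.sqrt lam), rho; split=> //.
apply: (@phi_solution _ _ _ _ A C _ (radial phi)) => //.
- exact: phi_radE.
- exact: rad_ge0.
- exact: rad_noninc.
- by move=> r r0 rr; rewrite sqr_sqrtr ?(ltW lam0)//; exact: gsin.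
- exact: phi0E.
Qed.
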